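(* Let $[\rho]\in\mathcal{X}$, where $\mathcal{X}$ is the space of type-preserving $\mathrm{SL}(2,\mathbb{C})$ characters of the once-punctured torus $T$. If there exists $X\in\mathscr{C}$ (the set of free homotopy classes of essential simple closed curves on $T$) such that $|\mathrm{tr}\,\rho(X)|<0.5$, then $[\rho]\in\mathrm{int}(\mathcal{X}\setminus\mathcal{X}_{BQ})$, where $\mathcal{X}_{BQ}\subset\mathcal{X}$ is the Bowditch space and the interior is taken in $\mathcal{X}$.
   Context: Let $T$ be the once-punctured torus, and let $X_0,Y_0$ be a pair of simple closed curves on $T$ with geometric intersection number one, so that $\pi:=\pi_1(T)=\langle X_0,Y_0\rangle$ is free on $X_0,Y_0$. The relative character variety $\mathcal{X}$ of type-preserving characters is the set of equivalence classes $[\rho]$ of representations $\rho\in\mathrm{Hom}(\pi,\mathrm{SL}(2,\mathbb{C}))$ satisfying $\mathrm{tr}\,\rho(X_0Y_0X_0^{-1}Y_0^{-1})=-2$, where two representations are equivalent if they are conjugate by an element of $\mathrm{SL}(2,\mathbb{C})$. (The definition does not depend on the choice of pair of generators of $\pi$.) The map $\iota[\rho]=(\mathrm{tr}\,\rho(X_0),\mathrm{tr}\,\rho(Y_0),\mathrm{tr}\,\rho(X_0Y_0))$ is a bijection from $\mathcal{X}$ onto $\{(x,y,z)\in\mathbb{C}^3: x^2+y^2+z^2=xyz\}$; $\mathcal{X}$ is identified with this cubic variety and given the induced topology (subspace topology from $\mathbb{C}^3$). $\mathscr{C}$ denotes the set of free homotopy classes of essential (i.e. non-trivial and non-peripheral)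 unoriented simple closed curves on $T$. For $X\in\mathscr{C}$ and $[\rho]\in\mathcal{X}$, $\mathrm{tr}\,\rho(X)$ denotes the trace of $\rho$ on any element of $\pi$ representing $X$; it is well defined, since it is invariant under conjugation and inversion of the element of $\pi$ and under conjugation of $\rho$. The Bowditch space $\mathcal{X}_{BQ}\subset\mathcal{X}$ is the set of all $[\rho]\in\mathcal{X}$ such that: (i) $\mathrm{tr}\,\rho(X)\notin[-2,2]$ for every $X\in\mathscr{C}$; and (ii) $|\mathrm{tr}\,\rho(X)|\le 2$ for only finitely many (possibly no) $X\in\mathscr{C}$. *)

(* Defs.v *)
From HB Require Import structures.
From mathcomp Require Import all_boot all_order all_algebra.
From mathcomp Require Import generic_quotient complex.
From mathcomp Require Import all_classical all_reals all_analysis.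
From mathcomp Require Import lra.

Set Implicit Arguments.
Unset Strict Implicit.
Unset Printing Implicit Defensive.

Import Order.TTheory GRing.Theory Num.Theory.
Import numFieldNormedType.Exports.

Local Open Scope classical_set_scope.
Local Open Scope ring_scope.
Local Open Scope quotient_scope.

(* The once-punctured torus is S^1 x S^1 minus the point (1, 1), seen inside
   R^2 x R^2. *)

Definition circle (R : realType) : set (R * R) :=
  [set p | p.1 ^+ 2 + p.2 ^+ 2 = 1].
Arguments circle : clear implicits.

Definition puncture (R : realType) : (R * R) * (R * R) := ((1, 0), (1, 0)).

Definition ptorus (R : realType) : set ((R * R) * (R * R)) :=
  (circle R `*` circle R) `\ puncture R.
Arguments ptorus : clear implicits.

(* A curve is a function on R of which only the restriction to [0, 1] is
   relevant; the relations below never look at other parameters. *)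
Definition curve (R : realType) : Type := R -> (R * R) * (R * R).

Definition closed_curve (R : realType) (c : curve R) : Prop :=
  [/\ {within `[0, 1], continuous c},
      forall t : R, t \in `[0, 1] -> ptorus R (c t) & c 0 = c 1].

Definition simple_closed_curve (R : realType) (c : curve R) : Prop :=
  closed_curve c /\ {in `[0, 1[ &, injective c}.

Definition reverse (R : realType) (c : curve R) : curve R := fun t => c (1 - t).

(* H (s, t): s is the time of the deformation, t the parameter of the curve. *)
Definition homotopy (R : realType) (c d : curve R)
    (H : R * R -> (R * R) * (R * R)) : Prop :=
  [/\ {within `[0, 1] `*` `[0, 1], continuous H},
      forall s t : R, s \in `[0, 1] -> t \in `[0, 1] -> ptorus R (H (s, t)),
      forall t : R, t \in `[0, 1] -> H (0, t) = c t &
      forall t : R, t \in `[0, 1] -> H (1, t) = d t].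

Definition freely_homotopic (R : realType) (c d : curve R) : Prop :=
  exists H, homotopy c d H /\ forall s : R, s \in `[0, 1] -> H (s, 0) = H (s, 1).

Definition trivial_curve (R : realType) (c : curve R) : Prop :=
  exists2 p, ptorus R p & freely_homotopic c (fun=> p).

(* Homotopic into every neighborhood of the puncture. *)
Definition peripheral (R : realType) (c : curve R) : Prop :=
  forall U, nbhs (puncture R) U ->
    exists2 d : curve R, freely_homotopic c d & forall t : R, t \in `[0, 1] -> U (d t).

Definition unoriented_class (R : realType) (c : curve R) : set (curve R) :=
  [set d | freely_homotopic c d \/ freely_homotopic c (reverse d)].

Definition essential_classes (R : realType) : set (set (curve R)) :=
  [set unoriented_class c | c in
    [set c | [/\ simple_closed_curve c, ~ trivial_curve c & ~ peripheral c]]].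
Arguments essential_classes : clear implicits.

Definition basepoint (R : realType) : (R * R) * (R * R) := ((-1, 0), (-1, 0)).

Definition is_loop (R : realType) (c : curve R) : Prop :=
  closed_curve c /\ c 0 = basepoint R.

Definition loop_homotopic (R : realType) (c d : curve R) : Prop :=
  exists H, homotopy c d H /\
    forall s : R, s \in `[0, 1] -> H (s, 0) = basepoint R /\ H (s, 1) = basepoint R.

Definition concat (R : realType) (c d : curve R) : curve R :=
  fun t => if t <= 2^-1 then c (2 * t) else d (2 * t - 1).

(* The two coordinate circles through the base point, which meet only there. *)
Definition X0 (R : realType) : curve R :=
  fun t => ((- cos (2 * pi * t), - sin (2 * pi * t)), (-1, 0)).
Definition Y0 (R : realType) : curve R :=
  fun t => ((-1, 0), (- cos (2 * pi * t), - sin (2 * pi * t))).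

Arguments X0 : clear implicits.
Arguments Y0 : clear implicits.

Lemma within_comp (T U V : topologicalType) (A : set T) (B : set U) (phi : T -> U)
    (f : U -> V) : continuous phi -> (forall x, A x -> B (phi x)) ->
  {within B, continuous f} -> {within A, continuous (f \o phi)}.
Proof.
move=> cphi AB /subspace_continuousP cf; apply/subspace_continuousP => x Ax.
apply: cvg_trans (cf _ (AB _ Ax)); move=> P /=.
rewrite /within /= /nbhs /= => fP.
have := cphi x _ fP; rewrite /nbhs /=.
apply: filterS => y /= + Ay; apply; exact: AB.
Qed.

Lemma is_loop_X0Y0 (R : realType) : is_loop (X0 R) /\ is_loop (Y0 R).
Proof.
have cc : continuous (fun t : R => - cos (2 * pi * t)).
  move=> t; apply: cvgN; apply: (@continuous_comp _ _ _ ( *%R (2 * pi)) cos).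
    exact: mulrl_continuous.
  exact: continuous_cos.
have cs : continuous (fun t : R => - sin (2 * pi * t)).
  move=> t; apply: cvgN; apply: (@continuous_comp _ _ _ ( *%R (2 * pi)) sin).
    exact: mulrl_continuous.
  exact: continuous_sin.
have m1 : circle R (-1, 0) by rewrite /circle /= sqrrN expr1n expr0n addr0.
have cT t : circle R (- cos (2 * pi * t), - sin (2 * pi * t)).
  by rewrite /circle /= !sqrrN cos2Dsin2.
have n1 : -1 <> 1 :> R by apply/eqP; rewrite lt_eqF //; lra.
have [e0 e1] : cos (2 * pi * 0) = 1 :> R /\ sin (2 * pi * 0) = 0 :> R.
  by rewrite mulr0 cos0 sin0.
have [e2 e3] : cos (2 * pi * 1) = 1 :> R /\ sin (2 * pi * 1) = 0 :> R.
  by rewrite mulr1 [2 * _]mulrC mulr_natr cos2pi sin2pi.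
split; split; try by rewrite /X0 /Y0 e0 e1 oppr0.
- split; last by rewrite /X0 e0 e1 e2 e3.
    apply: continuous_subspaceT => t.
    exact: (cvg_pair (cvg_pair (cc t) (cs t)) (cvg_cst _)).
  by move=> t _; split; [split; [exact: cT|exact: m1]|case=> _ _ /n1].
- split; last by rewrite /Y0 e0 e1 e2 e3.
    apply: continuous_subspaceT => t.
    exact: (cvg_pair (cvg_cst _) (cvg_pair (cc t) (cs t))).
  by move=> t _; split; [split; [exact: m1|exact: cT]|case=> /n1].
Qed.

Lemma is_loop_concat (R : realType) (c d : curve R) :
  is_loop c -> is_loop d -> is_loop (concat c d).
Proof.
move=> [[cc cT c01] c0] [[dc dT d01] d0].
have lo : concat c d 0 = c 0 by rewrite /concat invr_ge0 ler0n mulr0.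
have hi : concat c d 1 = d 1.
  by rewrite /concat ifF; [congr d; lra | apply/negbTE; rewrite -ltNge; lra].
split; last by rewrite lo.
split; last by rewrite lo hi c0 -d01.
  have -> : [set` `[0, 1]] = [set` `[0, 2^-1]] `|` [set` `[2^-1, 1]] :> set R.
    apply/seteqP; split => t /=; rewrite !in_itv/=.
      move=> /andP[t0 t1]; case: (leP t 2^-1) => h; [left|right]; lra.
    by case=> /andP[t0 t1]; lra.
  apply: withinU_continuous; [exact: interval_closed..| |].
  - have cc' : {within [set` `[0, 2^-1]], continuous (c \o *%R 2)}.
      apply: within_comp cc => [|t /=]; first exact: mulrl_continuous.
      by rewrite !in_itv/=; lra.
    apply: subspace_eq_continuous cc' => t; rewrite inE /= in_itv/=.
    by move=> /andP[_ t1]; rewrite /from_subspace /concat t1.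
  - have dc' : {within [set` `[2^-1, 1]], continuous (d \o (fun t => 2 * t - 1))}.
      apply: within_comp dc => [t|t /=]; last by rewrite !in_itv/=; lra.
      by apply: cvgB; [exact: mulrl_continuous|exact: cvg_cst].
    apply: subspace_eq_continuous dc' => t; rewrite inE /= in_itv/=.
    move=> /andP[t1 _]; rewrite /from_subspace /concat; case: leP => // t2.
    have -> : t = 2^-1 by apply/eqP; rewrite eq_le t1 t2.
    by rewrite /= mulfV ?pnatr_eq0// subrr d0 -c0 c01.
move=> t; rewrite in_itv/= => /andP[t0 t1]; rewrite /concat.
by case: leP => h; [apply: cT|apply: dT]; rewrite in_itv/=; lra.
Qed.

(* A homomorphism from the fundamental group at the base point to SL(2, C) is
   a function on loops that is invariant under based homotopy and
   multiplicative; its values on curves that are not loops are irrelevant. *)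
Record representation (R : realType) := Representation {
  rep_val :> curve R -> 'M[R[i]]_2;
  rep_det : forall c, is_loop c -> \det (rep_val c) = 1;
  rep_homotopic : forall c d, is_loop c -> is_loop d ->
    loop_homotopic c d -> rep_val c = rep_val d;
  rep_concat : forall c d, is_loop c -> is_loop d ->
    rep_val (concat c d) = rep_val c *m rep_val d }.

Record type_preserving (R : realType) := TypePreserving {
  tp_val :> representation R;
  tp_commutator :
    \tr (tp_val (concat (concat (concat (X0 R) (Y0 R)) (reverse (X0 R)))
                        (reverse (Y0 R)))) = - 2 }.

HB.instance Definition _ (R : realType) := gen_eqMixin (type_preserving R).
HB.instance Definition _ (R : realType) := gen_choiceMixin (type_preserving R).

Definition conjugate_rep (R : realType) (rho sigma : type_preserving R) : Prop :=
  exists2 g : 'M[R[i]]_2, \det g = 1 &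
    forall c, is_loop c -> sigma c = g *m rho c *m invmx g.

Definition conjugateb (R : realType) (rho sigma : type_preserving R) : bool :=
  `[< conjugate_rep rho sigma >].

Lemma conjugateb_equiv (R : realType) : equiv_class_of (@conjugateb R).
Proof.
have det_unit (g : 'M[R[i]]_2) : \det g = 1 -> g \in unitmx.
  by move=> dg; rewrite unitmxE dg unitr1.
have sym (r s : type_preserving R) : conjugate_rep r s -> conjugate_rep s r.
  move=> [g dg rs]; have ug := det_unit _ dg.
  exists (invmx g) => [|c lc]; first by rewrite det_inv dg invr1.
  by rewrite rs // invmxK !mulmxA mulVmx // mul1mx -mulmxA mulVmx // mulmx1.
split.
- move=> r; apply/asboolP; exists 1%:M => [|c _]; first by rewrite det1.
  by rewrite invmx1 mul1mx mulmx1.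
- by move=> r s; apply/asboolP/asboolP; exact: sym.
- move=> s r t /asboolP[g dg rs] /asboolP[h dh st]; apply/asboolP.
  have [ug uh] := (det_unit _ dg, det_unit _ dh).
  exists (h *m g) => [|c lc]; first by rewrite det_mulmx dg dh mulr1.
  have -> : invmx (h *m g) = invmx g *m invmx h by exact: invrM.
  by rewrite st // rs // !mulmxA.
Qed.

Canonical conjugate_equiv (R : realType) := EquivRelPack (conjugateb_equiv R).

Definition char_variety (R : realType) : Type :=
  {eq_quot (@conjugate_equiv R)}.

HB.instance Definition _ (R : realType) := Choice.on (char_variety R).
HB.instance Definition _ (R : realType) := EqQuotient.on (char_variety R).

Definition char_class (R : realType) (rho : type_preserving R) :
  char_variety R := \pi_(char_variety R) rho.

(* R[i]^o carries the topology of the complex modulus. *)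
Definition char_coords (R : realType) (chi : char_variety R) :
    R[i]^o * R[i]^o * R[i]^o :=
  let rho := repr chi in
  (\tr (rho (X0 R)), \tr (rho (Y0 R)), \tr (rho (concat (X0 R) (Y0 R)))).

Lemma char_coords_class (R : realType) (rho : type_preserving R) :
  char_coords (char_class rho) =
    (\tr (rho (X0 R)), \tr (rho (Y0 R)), \tr (rho (concat (X0 R) (Y0 R)))).
Proof.
have [lX lY] := is_loop_X0Y0 R; have lXY := is_loop_concat lX lY.
have : conjugate_rep rho (repr (char_class rho)).
  by apply/asboolP; have /eqmodP := esym (reprK (char_class rho)).
move=> [g dg grho]; have ug : g \in unitmx by rewrite unitmxE dg unitr1.
rewrite /char_coords /= !grho //.
by rewrite !(mxtrace_mulC (_ *m _) (invmx g)) !mulmxA !mulVmx // !mul1mx.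
Qed.

HB.instance Definition _ (R : realType) :=
  Topological.copy (char_variety R) (initial_topology (@char_coords R)).

(* X is a free homotopy class; the trace is taken on some loop of X at the base
   point, and does not depend on which one. *)
Definition curve_trace (R : realType) (rho : representation R)
    (X : set (curve R)) : R[i] :=
  \tr (rho (xget (fun=> basepoint R) [set c | is_loop c /\ X c])).

(* On R[i], z <= w means that w - z is a nonnegative real, so - 2 <= z <= 2 says
   that z lies in the real segment [-2, 2]. *)
Definition bowditch (R : realType) : set (char_variety R) :=
  [set char_class rho | rho in [set rho : type_preserving R |
    (forall X, essential_classes R X -> ~ (- 2 <= curve_trace rho X <= 2)) /\
    finite_set [set X | essential_classes R X /\ `|curve_trace rho X| <= 2]]].
Arguments bowditch : clear implicits.

(* Main.v *)
(** The torus punctured at one point is the quotient by Z^2 of the plane minus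
    Z^2, so a representation rho becomes a parallel transport along plane curves.
    Lift a simple closed curve and record, with sign and position, how it crosses
    the lines of the unit grid: the arcs between consecutive crossings are disjoint
    in a square, and the combinatorics of such a noncrossing pattern shows that the
    trace of the curve is either 2, or that of the commutator (which is -2), or the
    trace of the first entry of a pair obtained from (rho X0, rho Y0) by Nielsen
    moves.  A trace of modulus less than 1/2 is of the last kind; it is then a
    polynomial in the coordinates of the character, so the condition is open.

    It remains to see that no Bowditch character has such a trace x = tr P of modulus
    less than 1/2.  As x is not in [-2, 2], P has eigenvalues l, 1/l with |l| > 1, and
    tr (P^n Q) = A l^n + B l^-n with A B (x^2 - 4) = x^2 by the trace identity
    of the commutator.  For n chosen so that the two terms are of comparable size,
    one of tr (P^n Q), tr (P^(n+1) Q) is smaller than x.  All these traces belong to straight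
    closed curves, which are essential because their lifts are not closed, so this
    contradicts the finiteness of the set of essential curves with trace at most 2. *)

From HB Require Import structures.
Require Import Defs.
From mathcomp Require Import all_boot all_order all_algebra complex.
From mathcomp Require Import all_classical all_reals all_analysis.
From mathcomp Require Import ring lra zify.

Set Implicit Arguments.
Unset Strict Implicit.
Unset Printing Implicit Defensive.

Import Order.TTheory GRing.Theory Num.Theory.
Import numFieldNormedType.Exports.

Local Open Scope classical_set_scope.
Local Open Scope ring_scope.

(** * Continuity *)

Section Continuity.
Context {R : realType} {T : topologicalType}.
Implicit Types f g : T -> R.

Lemma ct_cst (U : topologicalType) (c : U) : continuous (fun _ : T => c).
Proof. by move=> x; exact: cvg_cst. Qed.

Lemma ct_id : continuous (fun x : T => x).
Proof. by move=> x; exact: cvg_id. Qed.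

Lemma ct_comp (U V : topologicalType) (h : U -> V) (k : T -> U) :
  continuous h -> continuous k -> continuous (fun x => h (k x)).
Proof. by move=> ch ck x; apply: (@continuous_comp _ _ _ k h); [exact: ck|exact: ch]. Qed.

Lemma ct_add f g : continuous f -> continuous g -> continuous (fun x => f x + g x).
Proof. by move=> cf cg x; apply: cvgD; [exact: cf|exact: cg]. Qed.

Lemma ct_opp f : continuous f -> continuous (fun x => - f x).
Proof. by move=> cf x; apply: cvgN; exact: cf. Qed.

Lemma ct_mul f g : continuous f -> continuous g -> continuous (fun x => f x * g x).
Proof. by move=> cf cg x; apply: cvgM; [exact: cf|exact: cg]. Qed.

Lemma ct_inv f : (forall x, f x != 0) -> continuous f -> continuous (fun x => (f x)^-1).
Proof. by move=> f0 cf x; apply: cvgV; [exact: f0|exact: cf]. Qed.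

Lemma ct_max f g : continuous f -> continuous g -> continuous (fun x => Num.max (f x) (g x)).
Proof. by move=> cf cg x; apply: (@continuous_max R T f g x); [exact: cf|exact: cg]. Qed.

Lemma ct_min f g : continuous f -> continuous g -> continuous (fun x => Num.min (f x) (g x)).
Proof. by move=> cf cg x; apply: (@continuous_min R T f g x); [exact: cf|exact: cg]. Qed.

Lemma ct_norm f : continuous f -> continuous (fun x => `|f x|).
Proof. by move=> cf x; apply: cvg_norm; exact: cf. Qed.

Lemma ct_pair (U V : topologicalType) (f : T -> U) (g : T -> V) :
  continuous f -> continuous g -> continuous (fun x => (f x, g x)).
Proof. by move=> cf cg x; apply: cvg_pair; [exact: cf|exact: cg]. Qed.

Lemma ct_fst (U V : topologicalType) (f : T -> U * V) :
  continuous f -> continuous (fun x => (f x).1).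
Proof. by move=> cf x; apply: (@continuous_comp _ _ _ f fst); [exact: cf|exact: cvg_fst]. Qed.

Lemma ct_snd (U V : topologicalType) (f : T -> U * V) :
  continuous f -> continuous (fun x => (f x).2).
Proof. by move=> cf x; apply: (@continuous_comp _ _ _ f snd); [exact: cf|exact: cvg_snd]. Qed.

End Continuity.

Lemma unif_cont (R : realType) (T : pseudoMetricType R) (K : set T) (f : T -> R) :
  compact K -> continuous f -> forall e : R, 0 < e ->
  exists2 d : R, 0 < d & forall x y, K x -> ball x d y -> `|f x - f y| < e.
Proof.
move=> /compact_near_coveringP cK cf e e0.
have e20 : 0 < e / 2 by rewrite divr_gt0.
have [] := cK R 0^'+ (fun d x => forall y, ball x d y -> `|f x - f y| < e) _.
  move=> x Kx; have := cf x; move/cvgrPdist_lt => /(_ _ e20).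
  rewrite -nbhs_ballE => -[r /= r0 xr].
  exists (ball x (r / 2), [set d | 0 < d < r / 2]) => /=.
    split; first by apply: nbhsx_ballx; rewrite divr_gt0.
    exists (r / 2); rewrite /= ?divr_gt0// => d /=; rewrite sub0r normrN => + d0.
    by rewrite gtr0_norm // d0 => ->.
  move=> [x' d] /= [xx' /andP[d0 dr]] y x'y.
  have h1 : `|f x - f x'| < e / 2.
    by apply: xr; apply: (le_ball _ xx'); rewrite ler_pdivrMr // ler_peMr ?ler1n// ltW.
  have h2 : `|f x - f y| < e / 2.
    apply: xr; rewrite [r]splitr; apply: (ball_triangle xx').
    by apply: (le_ball _ x'y); exact: ltW.
  have -> : f x' - f y = (f x - f y) - (f x - f x') by ring.
  by rewrite [e]splitr (le_lt_trans (ler_normB _ _)) // ltrD.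
move=> d0 /= d00 H; exists (d0 / 2); first by rewrite divr_gt0.
move=> x y Kx xy; apply: (H (d0 / 2)) => //=.
  by rewrite sub0r normrN gtr0_norm ?divr_gt0 // gtr_pMr // invf_lt1 // ltr1n.
by rewrite divr_gt0.
Qed.

Section RealLine.
Context {R : realType}.
Implicit Types (h : R -> R) (a b t : R).

Definition clamp a b t : R := Num.max a (Num.min b t).
Definition kap t : R := clamp 0 1 t.

Lemma clamp_id a b t : a <= t <= b -> clamp a b t = t.
Proof. by move=> /andP[h1 h2]; rewrite /clamp min_r // max_r. Qed.
Lemma clamp_le a b t : a <= b -> t <= a -> clamp a b t = a.
Proof. by move=> ab ta; rewrite /clamp min_r ?max_l // (le_trans ta). Qed.
Lemma clamp_ge a b t : a <= b -> b <= t -> clamp a b t = b.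
Proof. by move=> ab ta; rewrite /clamp min_l ?max_r // (le_trans ta). Qed.
Lemma clamp_in a b t : a <= b -> a <= clamp a b t <= b.
Proof. by move=> ab; rewrite /clamp le_max lexx /= ge_max ab /= ge_min lexx. Qed.

Lemma kap_id t : 0 <= t <= 1 -> kap t = t. Proof. exact: clamp_id. Qed.
Lemma kap0 t : t <= 0 -> kap t = 0. Proof. exact: clamp_le. Qed.
Lemma kap1 t : 1 <= t -> kap t = 1. Proof. exact: clamp_ge. Qed.
Lemma kap_in t : 0 <= kap t <= 1. Proof. exact: clamp_in. Qed.

Lemma ct_clamp (T : topologicalType) (f : T -> R) a b :
  continuous f -> continuous (fun x => clamp a b (f x)).
Proof.
move=> cf; apply: ct_max; first exact: ct_cst.
by apply: ct_min => //; exact: ct_cst.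
Qed.

Lemma ct_kap (T : topologicalType) (f : T -> R) :
  continuous f -> continuous (fun x => kap (f x)).
Proof. exact: ct_clamp. Qed.

Lemma ivt h a b v : continuous h -> a <= b -> h a <= v <= h b \/ h b <= v <= h a ->
  exists2 c, a <= c <= b & h c = v.
Proof.
move=> ch ab hv.
have [||c + hc] := @IVT R h a b v ab.
- exact: continuous_subspaceT.
- by case: hv => /andP[h1 h2]; rewrite ge_min le_max h1 h2 ?orbT.
- by rewrite in_itv /= => ?; exists c.
Qed.

Lemma last_time h a b v : continuous h -> a <= b -> h a <= v -> v < h b ->
  exists2 s, a <= s < b & h s = v /\ forall t, s < t <= b -> v < h t.
Proof.
move=> ch ab hav hvb.
pose S := [set t | a <= t <= b /\ h t <= v].
have Sa : S a by rewrite /S /= lexx ab.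
have hS : has_sup S by split; [exists a | exists b => t [/andP[]]].
have [sa sb] : a <= sup S /\ sup S <= b.
  split; first exact: (ub_le_sup hS.2).
  by apply: ge_sup; [exists a|move=> t [/andP[]]].
have after t : sup S < t <= b -> v < h t.
  move=> /andP[st tb]; rewrite ltNge; apply/negP => htv.
  suff : t <= sup S by rewrite leNgt st.
  by apply: (ub_le_sup hS.2); split=> //; rewrite (le_trans sa (ltW st)).
have hsv : h (sup S) <= v.
  rewrite leNgt; apply/negP => vh.
  have := ch (sup S); move/cvgrPdist_lt => /(_ (h (sup S) - v)); rewrite subr_gt0.
  move=> /(_ vh); rewrite -nbhs_ballE => -[r /= r0 xr].
  have [t [/andP[ta tb] htv] tr] := sup_adherent r0 hS.
  have ts : t <= sup S by apply: (ub_le_sup hS.2); rewrite /S /= ta tb.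
  have : `|h (sup S) - h t| < h (sup S) - v.
    by apply: xr; rewrite /ball /= ger0_norm; lra.
  by rewrite ltr_norml; lra.
have ltb : sup S < b.
  by rewrite lt_neqAle sb andbT; apply/eqP => E; move: hsv; rewrite E; lra.
exists (sup S); first by rewrite sa ltb.
split => //.
have hv : h (sup S) <= v <= h b by rewrite hsv ltW.
have [c /andP[c1 c2] hc] := ivt ch sb (or_introl hv).
have [->//|cs] := eqVneq (sup S) c.
by have := after c; rewrite lt_neqAle cs c1 c2 hc ltxx => /(_ isT).
Qed.

Lemma first_time h a b v : continuous h -> a <= b -> h a < v -> v <= h b ->
  exists2 s, a < s <= b & h s = v /\ forall t, a <= t < s -> h t < v.
Proof.
move=> ch ab hav hvb.
have ch' : continuous (fun t => - h (- t)).
  by apply: ct_opp; apply: (ct_comp ch); apply: ct_opp; exact: ct_id.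
have [|||s /andP[s1 s2] [hs H]] := @last_time (fun t => - h (- t)) (- b) (- a) (- v) ch'.
- lra.
- by rewrite opprK; lra.
- by rewrite opprK; lra.
exists (- s); first by lra.
split; first by lra.
by move=> t /andP[t1 t2]; have := H (- t); rewrite opprK; lra.
Qed.

End RealLine.

Ltac ct :=
  lazymatch goal with
  | |- continuous (fun x => x) => exact: ct_id
  | |- continuous (GRing.mul _) => exact: mulrl_continuous
  | |- continuous (fun _ => ?c) => exact: ct_cst
  | |- continuous (fun x => (@?f x, @?g x)) => apply: (@ct_pair _ _ _ f g); cbv beta; ct
  | |- continuous (fun x => fst (@?f x)) => apply: (@ct_fst _ _ _ f); cbv beta; ct
  | |- continuous (fun x => snd (@?f x)) => apply: (@ct_snd _ _ _ f); cbv beta; ct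
  | |- continuous (fun x => @?f x + @?g x) => apply: (@ct_add _ _ f g); cbv beta; ct
  | |- continuous (fun x => - @?f x) => apply: (@ct_opp _ _ f); cbv beta; ct
  | |- continuous (fun x => @?f x * @?g x) => apply: (@ct_mul _ _ f g); cbv beta; ct
  | |- continuous (fun x => `|@?f x|) => apply: (@ct_norm _ _ f); cbv beta; ct
  | |- continuous (fun x => Num.max (@?f x) (@?g x)) => apply: (@ct_max _ _ f g); cbv beta; ct
  | |- continuous (fun x => Num.min (@?f x) (@?g x)) => apply: (@ct_min _ _ f g); cbv beta; ct
  | |- continuous (fun x => kap (@?f x)) => apply: (@ct_kap _ _ f); cbv beta; ct
  | |- continuous (fun x => clamp ?a ?b (@?f x)) => apply: (@ct_clamp _ _ f a b); cbv beta; ct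
  | H : continuous ?h |- continuous ?h => exact: H
  | H : context [continuous (?h _)] |- continuous (fun x => ?h _ (@?f x)) =>
      apply: (ct_comp (H _)); cbv beta; ct
  | H : continuous ?h |- continuous (fun x => ?h (@?f x)) =>
      apply: (@ct_comp _ _ _ h f H); cbv beta; ct
  | |- forall _, continuous _ => move=> ?; ct
  | |- _ => idtac
  end.

(** * Crossing arcs *)

Section Parity.
Context {R : realType}.
Variables (N : nat) (X Y : nat -> nat -> R) (d : R).
Hypothesis d0 : 0 < d.
Hypothesis far : forall i j, (i <= N)%N -> (j <= N)%N -> d <= `|X i j| \/ d <= `|Y i j|.
Hypothesis near : forall i j i' j', (i <= N)%N -> (j <= N)%N -> (i' <= N)%N -> (j' <= N)%N ->
  (i <= i' <= i.+1)%N -> (j <= j' <= j.+1)%N ->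
  `|X i j - X i' j'| < d / 4 /\ `|Y i j - Y i' j'| < d / 4.

Let up i j := 0 < Y i j.
Let neg i j := X i j < 0.
Let hor i j := (up i j (+) up i.+1 j) && neg i j.
Let ver i j := (up i j (+) up i j.+1) && neg i j.

Let far' i j : (i <= N)%N -> (j <= N)%N -> X i j <= - d \/ d <= X i j \/ Y i j <= -d \/ d <= Y i j.
Proof.
move=> iN jN; case: (far iN jN); rewrite ler_normr => /orP[]; lra.
Qed.

Let near' i j i' j' : (i <= N)%N -> (j <= N)%N -> (i' <= N)%N -> (j' <= N)%N ->
  (i <= i' <= i.+1)%N -> (j <= j' <= j.+1)%N ->
  - (d / 4) < X i j - X i' j' < d / 4 /\ - (d / 4) < Y i j - Y i' j' < d / 4.
Proof. by move=> iN jN iN' jN' h1 h2; have := near iN jN iN' jN' h1 h2; rewrite !ltr_norml. Qed.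

Let cell i j : (i < N)%N -> (j < N)%N -> hor i j (+) hor i j.+1 (+) ver i j (+) ver i.+1 j = false.
Proof.
move=> iN jN.
have [||[a1 b1]] := @near' i j i j.+1 (ltnW iN) (ltnW jN) (ltnW iN) jN; [by rewrite leqnn leqnSn|by rewrite leqnSn leqnn|].
have [||[a2 b2]] := @near' i j i.+1 j (ltnW iN) (ltnW jN) iN (ltnW jN); [by rewrite leqnn leqnSn|by rewrite leqnSn leqnn|].
have [||[a3 b3]] := @near' i j i.+1 j.+1 (ltnW iN) (ltnW jN) iN jN; [by rewrite leqnn leqnSn|by rewrite leqnSn leqnn|].
have f0 := @far' i j (ltnW iN) (ltnW jN).
have [[E1 E2 E3]|/andP[y1 y2]] : [/\ up i.+1 j = up i j, up i j.+1 = up i j & up i.+1 j.+1 = up i j] \/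
    - (d / 4) < Y i j < d / 4.
    clear f0; rewrite /up; case: (ltP (- (d / 4)) (Y i j)) => y1; last first.
      by left; split; apply/idP/idP; lra.
    case: (ltP (Y i j) (d / 4)) => y2; first by right.
    by left; split; apply/idP/idP; lra.
  by rewrite /hor /ver E1 E2 E3 addbb.
have [[n1 n2 n3]] : [/\ neg i.+1 j = neg i j, neg i j.+1 = neg i j & neg i.+1 j.+1 = neg i j].
  have [xl|xg] : X i j <= - d \/ d <= X i j by clear a1 b1 a2 b2 a3 b3; case: f0 => [|[|[|]]] ?; lra.
    by clear f0; split; apply/idP/idP; rewrite /neg; lra.
  by clear f0; split; apply/idP/idP; rewrite /neg; lra.
rewrite /hor /ver n1 n2.
by move: (up i j) (up i.+1 j) (up i j.+1) (up i.+1 j.+1) (neg i j); clear; do 5!case.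
Qed.

Let row j n : (j < N)%N -> (n <= N)%N ->
  \big[addb/false]_(i < n) hor i j (+) \big[addb/false]_(i < n) hor i j.+1 = ver 0 j (+) ver n j.
Proof.
move=> jN; elim: n => [|n IH] nN; first by rewrite !big_ord0 !addbb.
rewrite !big_ord_recr /=; have := cell nN jN; move: (IH (ltnW nN)).
set a := \big[_/_]_(i < n) hor i j; set b := \big[_/_]_(i < n) hor i j.+1.
by case: a; case: b; case: (hor n j); case: (hor n j.+1); case: (ver 0 j); case: (ver n j); case: (ver n.+1 j).
Qed.

Hypothesis Y0 : forall i, (i <= N)%N -> Y i 0%N <= 0 /\ Y i N <= 0.
Hypothesis Y1 : forall j, (j <= N)%N -> 0 <= Y 0%N j /\ 0 <= Y N j.

Let side i n : i = 0%N \/ i = N -> (n <= N)%N ->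
  \big[addb/false]_(j < n) ver i j = (~~ up i 0 && neg i 0) (+) (~~ up i n && neg i n).
Proof.
move=> hi; have iN : (i <= N)%N by lia.
elim: n => [|n IH] nN; first by rewrite big_ord0 !addbb.
rewrite big_ord_recr /= IH ?(ltnW nN) // -addbA; congr (_ (+) _).
have [||[a1 b1]] := @near' i n i n.+1 iN (ltnW nN) iN nN; [by rewrite leqnn leqnSn|by rewrite leqnSn leqnn|].
have f0 := @far' i n iN (ltnW nN).
have y0 : 0 <= Y i n by case: hi => ->; have := Y1 (ltnW nN); tauto.
have y1 : 0 <= Y i n.+1 by case: hi => ->; have := Y1 nN; tauto.
case/andP: a1 => a1 a1'; case/andP: b1 => b1 b1'.
have [y2|y2] := ltP (Y i n) (d / 4); last first.
  have [y3 y4] : up i n = true /\ up i n.+1 = true by split; apply/idP/idP; rewrite /up; lra.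
  by rewrite /ver y3 y4.
have -> : neg i n.+1 = neg i n.
  have [xl|xg] : X i n <= - d \/ d <= X i n by case: f0 => [|[|[|]]] ?; lra.
    by clear f0; apply/idP/idP; rewrite /neg; lra.
  by clear f0; apply/idP/idP; rewrite /neg; lra.
by rewrite /ver; case: (up i n); case: (up i n.+1); case: (neg i n).
Qed.

Lemma grid_parity :
  neg 0 0 (+) neg 0 N (+) neg N 0 (+) neg N N = false.
Proof.
have tot n : (n <= N)%N -> \big[addb/false]_(i < N) hor i 0 (+) \big[addb/false]_(i < N) hor i n =
    \big[addb/false]_(j < n) ver 0 j (+) \big[addb/false]_(j < n) ver N j.
  elim: n => [|n IH] nN; first by rewrite !big_ord0 !addbb.
  rewrite !big_ord_recr /=; have := row nN (leqnn N); move: (IH (ltnW nN)).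
  set a := \big[_/_]_(i < N) hor i 0; set b := \big[_/_]_(i < N) hor i n.
  set c := \big[_/_]_(i < N) hor i n.+1; set e := \big[_/_]_(j < n) ver 0 j; set f := \big[_/_]_(j < n) ver N j.
  by case: a; case: b; case: c; case: e; case: f; case: (ver 0 n); case: (ver N n).
have zero j : j = 0%N \/ j = N -> \big[addb/false]_(i < N) hor i j = false.
  move=> hj; rewrite big1 // => i _; rewrite /hor /up.
  have iN := ltn_ord i.
  have [a b] : Y i j <= 0 /\ Y i.+1 j <= 0.
    by case: hj => ->; have := Y0 iN; have := Y0 (ltnW iN); tauto.
  by rewrite !ltNge a b.
have := tot N (leqnn N); rewrite !zero; [|by right|by left].
rewrite !side //; [|by right|by left].
have [y00 y0N] := Y0 (leq0n N); have [yN0 yNN] := Y0 (leqnn N).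
rewrite /up !ltNge y00 y0N yN0 yNN /=.
by case: (neg 0 0); case: (neg 0 N); case: (neg N 0); case: (neg N N).
Qed.

End Parity.

Lemma unit_square_compact (R : realType) : compact ([set` `[0, 1]] `*` [set` `[0, 1]] : set (R * R)).
Proof. by apply: compact_setX; exact: segment_compact. Qed.

Lemma ex_mesh (R : realType) (d : R) : 0 < d -> exists2 n : nat, (0 < n)%N & n%:R^-1 < d.
Proof.
move=> d0; exists (Num.truncn d^-1).+1 => //.
by rewrite -[ltRHS]invrK ltf_pV2 ?posrE ?invr_gt0 // truncnS_gt.
Qed.

Section HalfPlane.
Context {R : realType}.
Variables (f g : R -> R * R) (p q r s : R).
Hypotheses (cf : continuous f) (cg : continuous g).
Hypothesis f_up : forall t : R, 0 <= t <= 1 -> 0 <= (f t).2.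
Hypothesis g_up : forall t : R, 0 <= t <= 1 -> 0 <= (g t).2.
Hypotheses (f0 : f 0 = (p, 0)) (f1 : f 1 = (q, 0)) (g0 : g 0 = (r, 0)) (g1 : g 1 = (s, 0)).
Hypothesis disj : forall t u : R, 0 <= t <= 1 -> 0 <= u <= 1 -> f t <> g u.

Lemma half_plane_crossing : (p < r) (+) (q < r) (+) (p < s) (+) (q < s) = false.
Proof.
pose K : set (R * R) := [set` `[0, 1]] `*` [set` `[0, 1]].
pose X (z : R * R) := (g (kap z.2)).1 - (f (kap z.1)).1.
pose Y (z : R * R) := (g (kap z.2)).2 - (f (kap z.1)).2.
have cX : continuous X by rewrite /X; ct.
have cY : continuous Y by rewrite /Y; ct.
pose M z : R := Num.max `|X z| `|Y z|.
have cM : continuous M by rewrite /M; ct.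
have K0 : K !=set0 by exists (0, 0); split; rewrite /= in_itv /= lexx ler01.
have [z0 _ Mz0] := compact_EVT_min K0 (@unit_square_compact R) (continuous_subspaceT cM).
pose d : R := M z0.
have d0 : 0 < d.
  rewrite /d /M lt_max !normr_gt0; apply/negPn/negP; rewrite negb_or !negbK !subr_eq0.
  move=> /andP[/eqP E1 /eqP E2].
  apply: (@disj (kap z0.1) (kap z0.2)); rewrite ?kap_in //.
  by apply/eqP; rewrite [f _]surjective_pairing [g _]surjective_pairing xpair_eqE E1 E2 !eqxx.
have d40 : 0 < d / 4 by rewrite divr_gt0.
have [e1 e10 H1] := unif_cont (@unit_square_compact R) cX d40.
have [e2 e20 H2] := unif_cont (@unit_square_compact R) cY d40.
have [N N0 Nd] : exists2 n : nat, (0 < n)%N & n%:R^-1 < Num.min e1 e2.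
  by apply: ex_mesh; rewrite lt_min e10 e20.
have Nr : 0 < N%:R :> R by rewrite ltr0n.
pose P (i j : nat) : R * R := (i%:R / N%:R, j%:R / N%:R).
have in01 i : (i <= N)%N -> 0 <= (i%:R / N%:R : R) <= 1.
  by move=> iN; rewrite divr_ge0 ?ler0n // ler_pdivrMr // mul1r ler_nat.
have PK i j : (i <= N)%N -> (j <= N)%N -> K (P i j).
  by move=> iN jN; split; rewrite /= in_itv /= in01.
have clos i i' : (i <= i' <= i.+1)%N -> `|i%:R / N%:R - i'%:R / N%:R| < Num.min e1 e2 :> R.
  move=> h; apply: le_lt_trans Nd; rewrite -mulrBl normrM [X in _ * X]gtr0_norm ?invr_gt0 //.
  rewrite ler_piMl ?invr_ge0 ?ler0n // distrC -natrB; last by lia.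
  by rewrite normr_nat (ler_nat _ _ 1); lia.
have far i j : (i <= N)%N -> (j <= N)%N -> d <= `|X (P i j)| \/ d <= `|Y (P i j)|.
  move=> iN jN; have := Mz0 (P i j); rewrite inE => /(_ (PK _ _ iN jN)).
  by rewrite -/d {1}/M le_max => /orP.
have near i j i' j' : (i <= N)%N -> (j <= N)%N -> (i' <= N)%N -> (j' <= N)%N ->
    (i <= i' <= i.+1)%N -> (j <= j' <= j.+1)%N ->
    `|X (P i j) - X (P i' j')| < d / 4 /\ `|Y (P i j) - Y (P i' j')| < d / 4.
  move=> iN jN i'N j'N hi hj; have := clos _ _ hi; have := clos _ _ hj.
  rewrite !lt_min => /andP[a1 a2] /andP[b1 b2].
  by split; [apply: H1|apply: H2]; rewrite /ball /= ?/prod_ball //=; try exact: PK.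
have pos n : (n <= N)%N -> kap (n%:R / N%:R : R) = n%:R / N%:R by move=> nN; rewrite kap_id ?in01.
have zz : 0%:R / N%:R = 0 :> R by rewrite mul0r.
have oo : N%:R / N%:R = 1 :> R by rewrite divff // gt_eqF.
have Yb i : (i <= N)%N -> Y (P i 0%N) <= 0 /\ Y (P i N) <= 0.
  move=> iN; rewrite /Y /= !pos // zz oo g0 g1 /= sub0r oppr_le0.
  by rewrite f_up ?in01.
have Ya j : (j <= N)%N -> 0 <= Y (P 0%N j) /\ 0 <= Y (P N j).
  move=> iN; rewrite /Y /= !pos // zz oo f0 f1 /= subr0.
  by rewrite g_up ?in01.
have := grid_parity d0 far near Yb Ya.
rewrite /X /= !pos // zz oo f0 f1 g0 g1 /= !subr_lt0.
move=> E.
have nd t u : 0 <= t <= 1 -> 0 <= u <= 1 -> (f t).2 = 0 -> (g u).2 = 0 ->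
   ((g u).1 < (f t).1) = ~~ ((f t).1 < (g u).1).
  move=> t1 u1 ft gu; rewrite -leNgt le_eqVlt; case: eqP => // h; exfalso.
  by apply: (disj t1 u1); rewrite [f t]surjective_pairing [g u]surjective_pairing h ft gu.
have Z : 0 <= (0 : R) <= 1 by rewrite lexx ler01.
have O : 0 <= (1 : R) <= 1 by rewrite lexx ler01.
have := nd 0 0 Z Z; have := nd 0 1 Z O; have := nd 1 0 O Z; have := nd 1 1 O O.
rewrite f0 f1 g0 g1 /= => /(_ erefl erefl) a1 /(_ erefl erefl) a2 /(_ erefl erefl) a3 /(_ erefl erefl) a4.
move: E; rewrite a1 a2 a3 a4.
by case: (p < r); case: (q < r); case: (p < s); case: (q < s).
Qed.

End HalfPlane.

Section Box.
Context {R : realType}.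

(* Sides of the unit square, labelled by the crossing that enters through them:
   (true, true) is left, (true, false) right, (false, true) bottom and
   (false, false) top.  [bdpt] parametrizes the boundary clockwise by (0, 4),
   starting at the lower left corner. *)
Definition bdpt (ax dr : bool) (w : R) : R :=
  if ax then (if dr then w else 3 - w) else (if dr then 4 - w else 1 + w).

Definition unlinked (p q r s : R) : bool :=
  ~~ ((p < r) (+) (q < r) (+) (p < s) (+) (q < s)).

Lemma bdpt_lt_mono (ax dr ax' dr' : bool) (w w' v v' : R) :
  0 < w < 1 -> 0 < w' < 1 -> 0 < v < 1 -> 0 < v' < 1 ->
  (ax = ax' -> dr = dr' -> (w < w') = (v < v') /\ (w' < w) = (v' < v)) ->
  (bdpt ax dr w < bdpt ax' dr' w') = (bdpt ax dr v < bdpt ax' dr' v').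
Proof.
move=> /andP[w0 w1] /andP[w0' w1'] /andP[v0 v1] /andP[v0' v1'] H; rewrite /bdpt.
have sm (c : R) : (c + w < c + w') = (w < w') by rewrite ltrD2l.
case: ax ax' dr dr' H => [] [] [] [] H; rewrite ?ltrD2l ?ltrN2;
  try by case: (H erefl erefl).
all: by clear H; apply/idP/idP => ?; lra.
Qed.

Definition halfplane_map (z : R * R) : R * R :=
  let r := (Num.max z.1 z.2)^-1 in let a := (z.1 - z.2) * r * r in
  (a, r - 1 - Num.max 0 (`|a| - 1)).

Definition on_side (ax dr : bool) (w : R) (z : R * R) : Prop :=
  z = if ax then (if dr then (0, w) else (1, w)) else (if dr then (w, 0) else (w, 1)).

Let xi (ax dr : bool) (w : R) : R :=
  if ax then (if dr then - w^-1 else 1 - w) else (if dr then w^-1 else w - 1).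

Let xi_side ax dr (w : R) z : 0 < w < 1 -> on_side ax dr w z -> halfplane_map z = (xi ax dr w, 0).
Proof.
move=> /andP[w0 w1] ->; have w1' : 1 < w^-1 by rewrite invf_gt1.
have ww : w * w^-1 = 1 by rewrite divff // gt_eqF.
rewrite /halfplane_map /xi; case: ax; case: dr => /=; congr pair.
- by rewrite max_r ?(ltW w0) // sub0r mulNr ww mulN1r.
- rewrite max_r ?(ltW w0) // sub0r mulNr ww mulN1r normrN gtr0_norm ?max_r; lra.
- by rewrite max_l ?(ltW w1) // invr1 !mulr1.
- rewrite max_l ?(ltW w1) // invr1 !mulr1 subrr sub0r ger0_norm ?max_l; lra.
- by rewrite max_l ?(ltW w0) // subr0 ww mul1r.
- rewrite max_l ?(ltW w0) // subr0 ww mul1r gtr0_norm ?max_r; lra.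
- by rewrite max_r ?(ltW w1) // invr1 !mulr1.
- rewrite max_r ?(ltW w1) // invr1 !mulr1 subrr sub0r ler0_norm ?max_l; lra.
Qed.

Let xi_lt ax dr (w : R) ax' dr' (w' : R) : 0 < w < 1 -> 0 < w' < 1 ->
  (xi ax dr w < xi ax' dr' w') = (bdpt ax dr w < bdpt ax' dr' w').
Proof.
move=> /andP[w0 w1] /andP[w0' w1'].
have v1 : 1 < w^-1 by rewrite invf_gt1.
have v1' : 1 < w'^-1 by rewrite invf_gt1.
have e : (w^-1 < w'^-1) = (w' < w) by rewrite ltf_pV2.
have e' : (w'^-1 < w^-1) = (w < w') by rewrite ltf_pV2.
rewrite /xi /bdpt; case: ax ax' dr dr' => [] [] [] []; rewrite ?ltrD2l ?ltrN2 ?e ?e' //.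
all: clear e e'; by apply/idP/idP => ?; lra.
Qed.

Let hp_up (z : R * R) : 0 <= z.1 <= 1 -> 0 <= z.2 <= 1 -> 0 < Num.max z.1 z.2 ->
  0 <= (halfplane_map z).2.
Proof.
case: z => x y /= /andP[x0 x1] /andP[y0 y1] m0.
set r := (Num.max x y)^-1.
have r1 : 1 <= r by rewrite invf_ge1 // ge_max x1 y1.
have rm : Num.max x y * r = 1 by rewrite divff // gt_eqF.
have : `|x - y| * r <= 1.
  rewrite -rm ler_wpM2r //; first by lra.
  by rewrite ler_norml le_max; case: (leP x y) => h; apply/andP; split; try lra.
rewrite !normrM (ger0_norm (_ : 0 <= r)); last lra.
move=> h.
have : `|x - y| * r * r <= r by rewrite -[leRHS]mul1r ler_wpM2r //; lra.
by case: (leP 0 (`|x - y| * r * r - 1)) => ? ?; lra.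
Qed.

Let hp_inj (z z' : R * R) : 0 < Num.max z.1 z.2 -> 0 < Num.max z'.1 z'.2 ->
  halfplane_map z = halfplane_map z' -> z = z'.
Proof.
case: z z' => x y [x' y'] /= m0 m0' [E].
rewrite E => /addIr /addIr /invr_inj Em.
move: E; rewrite Em => /(mulIf (_ : _ != 0)) E.
have r0 : (Num.max x' y')^-1 != 0 by rewrite invr_eq0 gt_eqF.
have {}E : x - y = x' - y' by apply: (mulIf r0); apply: E.
move: Em; case: (leP x y) => ?; case: (leP x' y') => ? ?; congr pair; lra.
Qed.

Lemma unit_square_crossing (f g : R -> R * R) ax1 dr1 (w1 : R) ax2 dr2 (w2 : R) ax3 dr3 (w3 : R) ax4 dr4 (w4 : R) :
  continuous f -> continuous g ->
  (forall t : R, 0 <= t <= 1 -> [/\ 0 <= (f t).1 <= 1, 0 <= (f t).2 <= 1 & f t <> (0, 0)]) ->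
  (forall t : R, 0 <= t <= 1 -> [/\ 0 <= (g t).1 <= 1, 0 <= (g t).2 <= 1 & g t <> (0, 0)]) ->
  (forall t u : R, 0 <= t <= 1 -> 0 <= u <= 1 -> f t <> g u) ->
  0 < w1 < 1 -> 0 < w2 < 1 -> 0 < w3 < 1 -> 0 < w4 < 1 ->
  on_side ax1 dr1 w1 (f 0) -> on_side ax2 dr2 w2 (f 1) ->
  on_side ax3 dr3 w3 (g 0) -> on_side ax4 dr4 w4 (g 1) ->
  unlinked (bdpt ax1 dr1 w1) (bdpt ax2 dr2 w2) (bdpt ax3 dr3 w3) (bdpt ax4 dr4 w4).
Proof.
move=> cf cg If Ig dis h1 h2 h3 h4 s1 s2 s3 s4.
have maxp (h : R -> R * R) : (forall t : R, 0 <= t <= 1 ->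
    [/\ 0 <= (h t).1 <= 1, 0 <= (h t).2 <= 1 & h t <> (0, 0)]) ->
    forall t : R, 0 <= t <= 1 -> 0 < Num.max (h t).1 (h t).2.
  move=> Ih t t01; have [/andP[a0 a1] /andP[b0 b1] n0] := Ih t t01.
  rewrite lt_max !lt_neqAle a0 b0 !andbT -negb_and; apply/negP => /andP[/eqP e1 /eqP e2].
  by apply: n0; rewrite [h t]surjective_pairing -e1 -e2.
pose F t := halfplane_map (f (kap t)); pose G t := halfplane_map (g (kap t)).
have ch (h : R -> R * R) : continuous h -> (forall t : R, 0 <= t <= 1 ->
    0 < Num.max (h t).1 (h t).2) -> continuous (fun t => halfplane_map (h (kap t))).
  move=> ch mh.
  have ci : continuous (fun t => (Num.max (h (kap t)).1 (h (kap t)).2)^-1).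
    by apply: ct_inv => [t|]; [rewrite gt_eqF // mh ?kap_in|ct].
  by rewrite /halfplane_map; ct.
have k0 : kap (0 : R) = 0 by rewrite kap0.
have k1 : kap (1 : R) = 1 by rewrite kap1.
rewrite /unlinked -!xi_lt //; apply/negbT.
apply: (@half_plane_crossing R F G).
- exact: ch (maxp _ If).
- exact: ch (maxp _ Ig).
- move=> t t01; have [? ? ?] := If _ (kap_in t); apply: hp_up => //; exact: (maxp _ If) (kap_in t).
- move=> t t01; have [? ? ?] := Ig _ (kap_in t); apply: hp_up => //; exact: (maxp _ Ig) (kap_in t).
- by rewrite /F k0; apply: xi_side.
- by rewrite /F k1; apply: xi_side.
- by rewrite /G k0; apply: xi_side.
- by rewrite /G k1; apply: xi_side.
move=> t u t01 u01 /hp_inj E; apply: (dis (kap t) (kap u)); rewrite ?kap_in //.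
by apply: E; [exact: (maxp _ If) (kap_in t)|exact: (maxp _ Ig) (kap_in u)].
Qed.

Lemma box_crossing (a b A B t0 t1 u0 u1 : R) (f g : R -> R * R)
    ax1 dr1 (w1 : R) ax2 dr2 (w2 : R) ax3 dr3 (w3 : R) ax4 dr4 (w4 : R) :
  let N (z : R * R) := ((z.1 - a) / A, (z.2 - b) / B) in
  0 < A -> 0 < B -> t0 <= t1 -> u0 <= u1 -> continuous f -> continuous g ->
  (forall t, t0 <= t <= t1 -> [/\ a <= (f t).1 <= a + A, b <= (f t).2 <= b + B & f t <> (a, b)]) ->
  (forall t, u0 <= t <= u1 -> [/\ a <= (g t).1 <= a + A, b <= (g t).2 <= b + B & g t <> (a, b)]) ->
  (forall t u, t0 <= t <= t1 -> u0 <= u <= u1 -> f t <> g u) ->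
  0 < w1 < 1 -> 0 < w2 < 1 -> 0 < w3 < 1 -> 0 < w4 < 1 ->
  on_side ax1 dr1 w1 (N (f t0)) -> on_side ax2 dr2 w2 (N (f t1)) ->
  on_side ax3 dr3 w3 (N (g u0)) -> on_side ax4 dr4 w4 (N (g u1)) ->
  unlinked (bdpt ax1 dr1 w1) (bdpt ax2 dr2 w2) (bdpt ax3 dr3 w3) (bdpt ax4 dr4 w4).
Proof.
move=> N A0 B0 t01 u01 cf cg If Ig dis h1 h2 h3 h4 s1 s2 s3 s4.
have seg (x0 x1 t : R) : x0 <= x1 -> 0 <= t <= 1 -> x0 <= x0 + t * (x1 - x0) <= x1 by move=> ? ?; nra.
have unit (h : R -> R * R) (x0 x1 : R) : x0 <= x1 ->
    (forall t, x0 <= t <= x1 -> [/\ a <= (h t).1 <= a + A, b <= (h t).2 <= b + B & h t <> (a, b)]) ->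
    forall t : R, 0 <= t <= 1 -> let z := N (h (x0 + t * (x1 - x0))) in
    [/\ 0 <= z.1 <= 1, 0 <= z.2 <= 1 & z <> (0, 0)].
  move=> x01 Ih t tt; have [/andP[m1 m2] /andP[m3 m4] m5] := Ih _ (seg _ _ _ x01 tt).
  move=> z; rewrite /z /N /= !ler_pdivrMr // !mul1r !divr_ge0 ?subr_ge0 ?(ltW A0) ?(ltW B0) //=.
  rewrite !lerBlDl m2 m4; split => // -[/eqP E1 /eqP E2]; apply: m5.
  move: E1 E2; rewrite !mulf_eq0 !invr_eq0 !(gt_eqF A0, gt_eqF B0) !orbF !subr_eq0 => /eqP E1 /eqP E2.
  by rewrite [h _]surjective_pairing E1 E2.
have cN (h : R -> R * R) (x0 x1 : R) : continuous h -> continuous ((fun t : R => N (h (x0 + t * (x1 - x0)))) : R -> R * R).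
  by move=> ch; rewrite /N; ct.
apply: (@unit_square_crossing (fun t => N (f (t0 + t * (t1 - t0)))) (fun t => N (g (u0 + t * (u1 - u0))))) => //=.
- exact: cN.
- exact: cN.
- exact: unit.
- exact: unit.
- move=> t u tt uu [/(mulIf (_ : _ != 0)) E1 /(mulIf (_ : _ != 0)) E2].
  have nA : A^-1 != 0 by rewrite invr_eq0 gt_eqF.
  have nB : B^-1 != 0 by rewrite invr_eq0 gt_eqF.
  move: (E1 nA) (E2 nB) => /addIr e1 /addIr e2.
  apply: (dis _ _ (seg _ _ _ t01 tt) (seg _ _ _ u01 uu)).
  by rewrite [f _]surjective_pairing [g _]surjective_pairing e1 e2.
- by rewrite mul0r addr0.
- by rewrite mul1r subrKC.
- by rewrite mul0r addr0.
- by rewrite mul1r subrKC.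
Qed.

End Box.

(** * Pairs in SL2 *)

Section SL2.
Context {F : fieldType}.
Local Notation M := 'M[F]_2.
Implicit Types U V P : M.

Lemma mx2P U V : U 0 0 = V 0 0 -> U 0 1 = V 0 1 -> U 1 0 = V 1 0 -> U 1 1 = V 1 1 -> U = V.
Proof.
move=> h1 h2 h3 h4; apply/matrixP => i j.
by case: (unliftP 0 i) => [i'|] ->; case: (unliftP 0 j) => [j'|] ->;
  rewrite ?(ord1 i') ?(ord1 j') //; do ?[rewrite (_ : lift 0 0 = 1); last exact: val_inj].
Qed.

Lemma mul2E U V i j : (U * V) i j = U i 0 * V 0 j + U i 1 * V 1 j.
Proof.
rewrite -mulmxE mxE !big_ord_recl big_ord0 addr0; congr (_ * _ + _ * _); congr (fun_of_matrix _ _ _);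
  exact: val_inj.
Qed.

Lemma tr2E U : \tr U = U 0 0 + U 1 1.
Proof.
rewrite /mxtrace !big_ord_recl big_ord0 addr0; congr (_ + _); congr (fun_of_matrix _ _ _); exact: val_inj.
Qed.

Lemma det2E U : \det U = U 0 0 * U 1 1 - U 0 1 * U 1 0.
Proof.
rewrite (expand_det_row _ 0) !big_ord_recl big_ord0 addr0 /cofactor !det_mx11 !mxE /=.
rewrite (_ : lift 0 0 = 1); last exact: val_inj.
rewrite (_ : lift 1 0 = 0); last exact: val_inj.
by rewrite /= addn0 expr0 mul1r expr1 mulN1r mulrN.
Qed.

Lemma trC U V : \tr (U * V) = \tr (V * U).
Proof. exact: mxtrace_mulC. Qed.

Lemma CH U : U * U = \tr U *: U - (\det U)%:M.
Proof. by rewrite tr2E det2E; apply: mx2P; rewrite !(mul2E, mxE) /=; ring. Qed.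

Lemma SL2_unit U : \det U = 1 -> U \is a GRing.unit.
Proof. by move=> dU; rewrite -[_ \is a _]/(U \in unitmx) unitmxE dU unitr1. Qed.

Lemma SL2_inv U : \det U = 1 -> U^-1 = (\tr U)%:M - U.
Proof.
move=> dU; apply: (mulrI (SL2_unit dU)); rewrite divrr ?SL2_unit // mulrBr CH dU.
by rewrite -[(\tr U)%:M]scalemx1 -[U * _]scalerAr mulr1 opprB addrCA subrr addr0.
Qed.

Lemma det_mul U V : \det (U * V) = \det U * \det V.
Proof. exact: det_mulmx. Qed.
Lemma SL2_invP U : \det U = 1 -> \det U^-1 = 1.
Proof. by move=> dU; rewrite -[U^-1]/(invmx U) det_inv dU invr1. Qed.
Lemma SL2_mul U V : \det U = 1 -> \det V = 1 -> \det (U * V) = 1.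
Proof. by move=> dU dV; rewrite det_mul dU dV mulr1. Qed.

Lemma tr_inv U : \det U = 1 -> \tr U^-1 = \tr U.
Proof. by move=> dU; rewrite SL2_inv // linearB /= mxtrace_scalar mulr2n addrK. Qed.

Lemma tr_conj P U : \det P = 1 -> \tr (P * U * P^-1) = \tr U.
Proof. by move=> dP; rewrite trC mulrA mulVr ?SL2_unit // mul1r. Qed.

Lemma inv_uniq U V : U * V = 1 -> V = U^-1.
Proof.
by move=> UV; have uU : U \is a GRing.unit := (mulmx1_unit UV).1;
  rewrite -[V]mul1r -(mulVr uU) -mulrA UV mulr1.
Qed.

Lemma tr_commV U V : \det U = 1 -> \det V = 1 ->
  \tr (U^-1 * V * U * V^-1) = \tr (U * V * U^-1 * V^-1).
Proof.
move=> dU dV; have [uU uV] := (SL2_unit dU, SL2_unit dV).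
rewrite -[LHS]tr_inv; last by rewrite !SL2_mul ?SL2_invP.
have -> : (U^-1 * V * U * V^-1)^-1 = V * U^-1 * V^-1 * U.
  by apply/esym/inv_uniq; rewrite !mulrA mulrVK // mulrK // mulrK // mulVr.
by rewrite [LHS]trC !mulrA.
Qed.

Inductive move := Swap | Invert | Twist.

Definition act1 (m : move) (p : M * M) : M * M :=
  match m with
  | Swap => (p.2, p.1)
  | Invert => (p.1, p.2^-1)
  | Twist => (p.1, p.1 * p.2)
  end.

Definition act (ms : seq move) (p : M * M) : M * M := foldl (fun p m => act1 m p) p ms.

Definition SL2pair (p : M * M) := \det p.1 = 1 /\ \det p.2 = 1.

Lemma act1_SL2 m p : SL2pair p -> SL2pair (act1 m p).
Proof. by case: p => U V [/= dU dV]; case: m; split; rewrite //= ?SL2_invP ?SL2_mul. Qed.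

Lemma act_SL2 ms p : SL2pair p -> SL2pair (act ms p).
Proof. by elim: ms p => //= m ms IH p /(act1_SL2 m) /IH. Qed.

Lemma act_cat ms1 ms2 p : act (ms1 ++ ms2) p = act ms2 (act ms1 p).
Proof. by rewrite /act foldl_cat. Qed.

Definition conjp P (p : M * M) := (P * p.1 * P^-1, P * p.2 * P^-1).

Lemma act_conj ms P p : \det P = 1 -> SL2pair p -> act ms (conjp P p) = conjp P (act ms p).
Proof.
move=> dP; elim: ms p => //= m ms IH p sp; rewrite -IH; last exact: act1_SL2.
have uP := SL2_unit dP.
case: p sp => U V [/= dU dV]; have [uU uV] := (SL2_unit dU, SL2_unit dV).
case: m => //=; rewrite /conjp /=; congr (act _ (_, _)).
  apply/esym/inv_uniq; by rewrite !mulrA (mulrVK uP) (mulrK uV) divrr.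
by rewrite !mulrA mulrVK.
Qed.

Lemma tr_act_conj ms P p : \det P = 1 -> SL2pair p ->
  \tr (act ms (conjp P p)).1 = \tr (act ms p).1.
Proof. by move=> dP sp; rewrite act_conj //= tr_conj. Qed.

Lemma tr_rot (T : Type) (L : T -> M) (n : nat) (s : seq T) :
  \tr (\prod_(i <- rot n s) L i) = \tr (\prod_(i <- s) L i).
Proof. by rewrite /rot big_cat /= trC -big_cat cat_take_drop. Qed.

Definition rotn (m n i : nat) : nat := if (i < n)%N then (i + m)%N else (i - n)%N.

Lemma rotation_filter m n x p (U V : M) : (0 < n <= m)%N -> (x < m)%N ->
  path (frel (rotn m n)) x p -> (last x p < m)%N ->
  path (frel (rotn (m - n) n)) x (seq.filter (fun i => i < m)%N p) /\
  \prod_(i <- p) (if (i < m)%N then U else V) =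
  \prod_(i <- seq.filter (fun i => i < m)%N p) (if (i < m - n)%N then U else V * U).
Proof.
move=> nm; have [k] := ubnP (size p); elim: k x p => // k IH x [|y p] /=.
  by rewrite !big_nil.
rewrite ltnS => pk xm /andP[/eqP xy yp] lm; move: xy; rewrite {1}/rotn.
case: (ltnP x n) => xn xy; last first.
  have ym : (y < m)%N by lia.
  have [h1 h2] := IH y p pk ym yp lm.
  rewrite ym /= h1 big_cons ym h2 big_cons; split.
    by rewrite andbT /rotn ltnNge xn /= xy eqxx.
  by rewrite (_ : y < m - n)%N //; lia.
have ym : (y < m)%N = false by lia.
case: p yp lm pk => [|z p] /=; first by rewrite ym.
move=> /andP[/eqP yz zp] lm pk; move: yz; rewrite {1}/rotn (_ : (y < n)%N = false) => [yz|]; last lia.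
have zm : (z < m)%N by lia.
have [h1 h2] := IH z p (ltnW pk) zm zp lm.
rewrite ym /= zm /= h1 !big_cons ym zm h2 ?big_cons; split.
  by rewrite andbT /rotn xn; apply/eqP; lia.
by rewrite (_ : (z < m - n)%N = false) ?mulrA //; lia.
Qed.

Lemma rotation_fixed (T : eqType) (f : T -> T) (s : seq T) : fcycle f s -> uniq s -> s != [::] ->
  (forall i, i \in s -> f i = i) -> exists x, s = [:: x].
Proof.
case: s => // x [|y s] /=; first by exists x.
move=> /andP[/eqP <- _] /andP[+ _] _ fx; rewrite fx ?inE ?eqxx //.
Qed.

Lemma rotation_word_aux N m n (s : seq nat) : (m + n <= N)%N -> s != [::] -> uniq s ->
  all (fun i => i < m + n)%N s -> fcycle (rotn m n) s ->
  exists ms, forall U V, \det U = 1 -> \det V = 1 ->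
    \tr (\prod_(i <- s) (if (i < m)%N then U else V)) = \tr (act ms (U, V)).1.
Proof.
elim: N m n s => [|N IH] m n s mnN s0 us sb cs.
  by case: s s0 sb {us cs} => // x s _ /= /andP[xl _]; exfalso; lia.
have [n0|n0] := posnP n.
  have [|x sx] := rotation_fixed cs us s0.
    by move=> i _; rewrite /rotn n0 subn0.
  exists [::] => U V _ _; move: sb; rewrite sx big_seq1 /= n0 addn0 andbT => -> //.
have [m0|m0] := posnP m.
  have [|x sx] := rotation_fixed cs us s0.
    move=> i si; rewrite /rotn m0 addn0; case: ltnP => //; move/allP: sb => /(_ _ si); lia.
  by exists [:: Swap] => U V _ _; rewrite sx big_seq1 m0.
have main m' n' (t : seq nat) : (m' + n' = m + n)%N -> (0 < n' <= m')%N -> t != [::] -> uniq t ->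
    all (fun i => i < m' + n')%N t -> fcycle (rotn m' n') t ->
    exists ms, forall U V, \det U = 1 -> \det V = 1 ->
    \tr (\prod_(i <- t) (if (i < m')%N then U else V)) = \tr (act ms (U, V)).1.
  move=> mn nm t0 ut tb ct.
  have [x [p [k [xm tk]]]] : exists x p k, (x < m')%N /\ rot k t = x :: p.
    case: t t0 ut tb ct => // x p _ ut tb ct; case: (ltnP x m') => xm.
      by exists x, p, 0%N; rewrite rot0.
    case: p ut tb ct => [|y p] /= ut /andP[xb tb] /andP[/eqP xy ct].
      by move: xy xm xb nm; clear; rewrite /rotn; case: ltnP; lia.
    exists y, (rcons p x), 1%N; rewrite rot1_cons; split => //.
    by move: xy xm xb nm; clear; rewrite /rotn; case: ltnP; lia.
  have uxp : uniq (x :: p) by rewrite -tk rot_uniq.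
  have bxp : all (fun i => i < m' + n')%N (x :: p) by apply/allP => i; rewrite -tk mem_rot => /(allP tb).
  have cxp : fcycle (rotn m' n') (x :: p) by rewrite -tk rot_cycle.
  have lx : (last x (rcons p x) < m')%N by rewrite last_rcons.
  have fil : seq.filter (fun i => i < m')%N (rcons p x) = rcons (seq.filter (fun i => i < m')%N p) x.
    by rewrite filter_rcons xm.
  have [|||||ms Hms] := IH (m' - n')%N n' (x :: seq.filter (fun i => i < m')%N p).
  - by clear - mnN mn nm; lia.
  - by [].
  - by move: uxp => /= /andP[xp up]; rewrite mem_filter negb_and xp orbT filter_uniq.
  - have mm : (m' - n' + n')%N = m' by clear - nm; lia.
    by apply/allP => i; rewrite mm inE mem_filter => /orP[/eqP->|/andP[]].
  - have [+ _] := rotation_filter 1 1 nm xm cxp lx.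
    by rewrite fil.
  exists (Twist :: ms) => U V dU dV.
  rewrite -(tr_rot _ k) tk -(tr_rot _ 1) rot1_cons.
  have [_ ->] := rotation_filter U V nm xm cxp lx.
  rewrite fil -rot1_cons tr_rot Hms ?SL2_mul //.
  rewrite -(tr_act_conj _ dU) /=; last by split; rewrite //= SL2_mul.
  by rewrite /conjp /= !mulrK ?SL2_unit // mulrA mulrK ?SL2_unit.
case: (leqP n m) => nm.
  by apply: (main m n) => //; rewrite n0.
pose r i := (m + n - i.+1)%N.
have sb' i : i \in s -> (i < m + n)%N by move/allP: sb; apply.
have [||||||ms Hms] := main n m (map r s).
- lia.
- by rewrite m0 ltnW.
- by case: (s) s0.
- rewrite map_inj_in_uniq // => i j /sb' ? /sb' ?; rewrite /r; lia.
- by apply/allP => _ /mapP[i /sb' ? ->]; rewrite /r; lia.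
- rewrite cycle_map; apply: sub_in_cycle cs; last exact: sb.
  move=> i j; rewrite !unfold_in /= => ib _ /eqP <-; apply/eqP; move: ib; rewrite /r /rotn.
  by case: (ltnP i n); case: (ltnP (m + n - i.+1) m); lia.
exists (Swap :: ms) => U V dU dV /=; rewrite -Hms // big_map; congr (\tr _).
apply: eq_big_seq => i /sb' ib; rewrite /r.
by case: (ltnP (m + n - i.+1) n); case: (ltnP i m) => //; lia.
Qed.

Lemma rotation_word m n (s : seq nat) : s != [::] -> uniq s ->
  all (fun i => i < m + n)%N s -> fcycle (rotn m n) s ->
  exists ms, forall U V, \det U = 1 -> \det V = 1 ->
    \tr (\prod_(i <- s) (if (i < m)%N then U else V)) = \tr (act ms (U, V)).1.
Proof. exact: rotation_word_aux (leqnn _). Qed.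

End SL2.

(** * Crossing patterns of simple closed curves *)

Lemma perm_next (T : eqType) (W : seq T) : uniq W -> perm_eq (map (next W) W) W.
Proof.
move=> uW; apply: uniq_perm => //.
  by rewrite map_inj_in_uniq // => x y _ _; apply: (can_inj (prev_next uW)).
move=> x; apply/mapP/idP => [[y yW ->]|xW]; first by rewrite mem_next.
by exists (prev W x); rewrite ?mem_prev ?next_prev.
Qed.

Lemma count_next (T : eqType) (W : seq T) (P : pred T) : uniq W ->
  count (fun w => P (next W w)) W = count P W.
Proof. move=> uW; have /permP E := perm_next uW; rewrite -(E P) count_map. exact: eq_count. Qed.

Lemma next_const (T S : eqType) (W : seq T) (f : T -> S) : uniq W ->
  (forall u, u \in W -> f (next W u) = f u) -> {in W &, forall u v, f u = f v}.
Proof.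
move=> uW fn; have cW : cycle (fun x y => f x == f y) W.
  by apply: cycle_from_next => // u uW'; rewrite fn.
case: W cW {uW fn} => // x p /= cW.
suff H : {in x :: p, forall u, f u = f x} by move=> u v /H -> /H ->.
move=> u; rewrite -[u \in _]/(u \in x :: p) inE => /orP[/eqP->//|].
have : path (fun x y => f x == f y) x p by move: cW; rewrite rcons_path => /andP[].
elim: p x {cW} => //= y p IH x /andP[/eqP -> yp]; rewrite inE => /orP[/eqP->//|].
exact: IH.
Qed.

Lemma seq_max (R : realType) (T : eqType) (W : seq T) (P : pred T) (f : T -> R) : has P W ->
  exists2 x, (x \in W) && P x & forall y, y \in W -> P y -> f y <= f x.
Proof.
elim: W => //= a W IH; have [/IH[x /andP[xW Px] xm] _|nW] := boolP (has P W).
  have [Pa|nPa] := boolP (P a); last first.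
    exists x; rewrite ?inE ?xW ?orbT // => y; rewrite inE => /orP[/eqP->|]; last exact: xm.
    by rewrite (negbTE nPa).
  have [ax|xa] := leP (f a) (f x).
    exists x; rewrite ?inE ?xW ?orbT // => y; rewrite inE => /orP[/eqP->//|]; exact: xm.
  exists a; rewrite ?inE ?eqxx // => y; rewrite inE => /orP[/eqP->//|yW Py].
  by rewrite (le_trans (xm _ yW Py)) ?ltW.
rewrite orbF => Pa; exists a; rewrite ?inE ?eqxx // => y; rewrite inE => /orP[/eqP->//|yW Py].
by case/hasP: nW; exists y.
Qed.

Lemma seq_min (R : realType) (T : eqType) (W : seq T) (P : pred T) (f : T -> R) : has P W ->
  exists2 x, (x \in W) && P x & forall y, y \in W -> P y -> f x <= f y.
Proof.
move=> /(seq_max (fun x => - f x))[x h H]; exists x => // y yW Py.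
by rewrite -lerN2 H.
Qed.

Section MonotoneCycle.
Context {R : realType} {T : eqType}.
Variables (W : seq T) (o : T -> R).
Hypotheses (uW : uniq W) (W0 : W != [::]).
Hypothesis oI : {in W, forall u, 0 < o u < 2 /\ o u != 1}.
Hypothesis o_inj : {in W &, injective o}.
Let i u := if o u < 1 then o u + 1 else o u - 1.
Hypothesis mono : {in W &, forall u v, o u < o v -> i (next W u) < i (next W v)}.

Lemma monotone_cycle (F : fieldType) : exists ms, forall A B : 'M[F]_2, \det A = 1 -> \det B = 1 ->
  \tr (\prod_(u <- W) (if o u < 1 then A else B)) = \tr (act ms (A, B)).1.
Proof.
pose r u := count (fun w => o w < o u) W.
pose r' u := count (fun w => i w < i u) W.
pose m := count (fun w => o w < 1) W.
pose n := count (fun w => ~~ (o w < 1)) W.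
have iff u v : u \in W -> v \in W -> (i (next W u) < i (next W v)) = (o u < o v).
  move=> uW' vW'; apply/idP/idP; last exact: mono.
  case: (ltgtP (o u) (o v)) => // [h|/(o_inj uW' vW')->]; last by rewrite ltxx.
  by have := mono vW' uW' h; move=> h1 h2; have := lt_trans h1 h2; rewrite ltxx.
have rr' u : u \in W -> r u = r' (next W u).
  move=> uW'; rewrite /r /r' -(count_next (fun w => i w < i (next W u)) uW).
  by apply: eq_in_count => w wW; rewrite iff.
have rA v : v \in W -> o v < 1 -> r' v = (n + r v)%N.
  move=> vW vA; rewrite /r' /n /r -(count_predUI (fun w => ~~ (o w < 1)) (fun w => o w < o v)).
  rewrite [count (predI _ _) _](eq_in_count (a2 := pred0)) ?count_pred0 ?addn0; last first.
    by move=> w wW /=; apply/negbTE/negP; lra.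
  apply: eq_in_count => w wW /=; have [/andP[w1 w2] _] := oI wW; have [/andP[v1 v2] _] := oI vW.
  by rewrite /i vA; case: ifP => wA /=; apply/idP/idP; lra.
have rB v : v \in W -> (o v < 1) = false -> r v = (m + r' v)%N.
  move=> vW vB; rewrite /r' /m /r -(count_predUI (fun w => o w < 1) (fun w => i w < i v)).
  have [/andP[v1 v2] v3] := oI vW.
  have v4 : 1 < o v by rewrite lt_neqAle eq_sym v3 leNgt vB.
  rewrite [count (predI _ _) _](eq_in_count (a2 := pred0)) ?count_pred0 ?addn0; last first.
    move=> w wW /=; have [/andP[w1 w2] _] := oI wW; apply/negbTE/negP.
    by rewrite /i vB; case: ifP => wA /=; lra.
  apply: eq_in_count => w wW /=; have [/andP[w1 w2] w3] := oI wW.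
  rewrite /i vB; case: ifP => wA /=; apply/idP/idP; lra.
have rm u : u \in W -> (r u < m)%N = (o u < 1).
  move=> uW'; apply/idP/idP => [|uA].
    by case E: (o u < 1) => //; rewrite (rB _ uW' E); lia.
  rewrite /r /m; have -> : count (fun w => o w < 1) W =
     (count (fun w => (o w < o u)%R) W + count (fun w => (o u <= o w < 1)%R) W)%N.
    rewrite -(count_predUI (fun w => o w < o u) (fun w => o u <= o w < 1)).
    rewrite [count (predI _ _) _](eq_in_count (a2 := pred0)) ?count_pred0 ?addn0; last first.
      by move=> w wW /=; apply/negbTE/negP; lra.
    by apply: eq_in_count => w wW /=; apply/idP/idP; lra.
  rewrite -[X in (X < _)%N]addn0 ltn_add2l -has_count.
  by apply/hasP; exists u => //; rewrite lexx.
have rn u : u \in W -> (r u < m + n)%N.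
  move=> uW'; case E: (o u < 1); first by have := rm _ uW'; rewrite E; lia.
  rewrite (rB _ uW' E) ltn_add2l /r' /n.
  have -> : count (fun w => ~~ (o w < 1)) W =
     (count (fun w => (i w < i u)%R) W + count (fun w => ~~ (o w < 1)%R && (o u <= o w)%R) W)%N.
    have [/andP[v1 v2] v3] := oI uW'.
    have v4 : 1 < o u by rewrite lt_neqAle eq_sym v3 leNgt E.
    rewrite -(count_predUI (fun w => i w < i u) (fun w => ~~ (o w < 1) && (o u <= o w))).
    rewrite [count (predI _ _) _](eq_in_count (a2 := pred0)) ?count_pred0 ?addn0; last first.
      by move=> w wW /=; apply/negbTE/negP; rewrite /i E; case: (ltP (o w) 1) => /=; lra.
    apply: eq_in_count => w wW /=; have [/andP[w1 w2] w3] := oI wW.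
    by rewrite /i E; case: (ltP (o w) 1) => wA /=; apply/idP/idP; lra.
  rewrite -[X in (X < _)%N]addn0 ltn_add2l -has_count.
  by apply/hasP; exists u => //; rewrite lexx E.
have step u : u \in W -> rotn m n (r u) = r (next W u).
  move=> uW'; have vW : next W u \in W by rewrite mem_next.
  rewrite /rotn rr' //; case E : (o (next W u) < 1).
    by rewrite (rA _ vW E) ltnNge leq_addr /= addKn.
  have := rn _ vW; rewrite (rB _ vW E) ltn_add2l => ->; exact: addnC.
have r_inj : {in W &, injective r}.
  move=> u v uW' vW' E; apply: o_inj => //.
  have lt x y : x \in W -> o x < o y -> (r x < r y)%N.
    move=> xW xy; rewrite /r.
    have -> : count (fun w => o w < o y) W =
       (count (fun w => (o w < o x)%R) W + count (fun w => (o x <= o w)%R && (o w < o y)%R) W)%N.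
      rewrite -(count_predUI (fun w => o w < o x) (fun w => (o x <= o w) && (o w < o y))).
      rewrite [count (predI _ _) _](eq_in_count (a2 := pred0)) ?count_pred0 ?addn0; last first.
        by move=> w wW /=; apply/negbTE/negP; lra.
      by apply: eq_in_count => w wW /=; apply/idP/idP; lra.
    rewrite -[X in (X < _)%N]addn0 ltn_add2l -has_count.
    by apply/hasP; exists x => //; rewrite lexx xy.
  by case: (ltgtP (o u) (o v)) => // h; [have := lt _ _ uW' h|have := lt _ _ vW' h]; rewrite E ltnn.
have [||||ms Hms] := @rotation_word F m n (map r W).
- by case: (W) W0.
- by rewrite map_inj_in_uniq.
- by apply/allP => _ /mapP[u uW' ->]; exact: rn.
- rewrite cycle_map; apply: cycle_from_next => // u uW' /=; apply/eqP; exact: step.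
exists ms => A B dA dB; rewrite -Hms // big_map; congr (\tr _).
by apply: eq_big_seq => u uW'; rewrite rm.
Qed.

End MonotoneCycle.

Section Bdpt.
Context {R : realType}.
Implicit Types p q r s a b c : R.

Lemma unlinked_sym p q r s : p != r -> p != s -> q != r -> q != s ->
  unlinked p q r s = unlinked r s p q.
Proof.
rewrite /unlinked => h1 h2 h3 h4.
have e (x y : R) : x != y -> (x < y) = ~~ (y < x).
  by move=> xy; rewrite -leNgt le_eqVlt (negbTE xy).
rewrite (e p r) // (e q r) // (e p s) // (e q s) //.
by case: (r < p); case: (r < q); case: (s < p); case: (s < q).
Qed.

Lemma unlinkedC p q r s : unlinked p q r s = unlinked q p r s.
Proof.
rewrite /unlinked.
by case: (p < r); case: (q < r); case: (p < s); case: (q < s).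
Qed.

Lemma unlinkedC' p q r s : unlinked p q r s = unlinked p q s r.
Proof.
rewrite /unlinked.
by case: (p < r); case: (q < r); case: (p < s); case: (q < s).
Qed.

Lemma unlinked_between p q r s : unlinked p q r s -> p < r < q -> p <= s <= q.
Proof.
rewrite /unlinked; case: (ltP p r) => h1; case: (ltP q r) => h2; case: (ltP p s) => h3;
  case: (ltP q s) => h4 //= _; lra.
Qed.

Lemma unlinked_outside p q r s : unlinked p q r s -> p < q -> r < p \/ q < r -> s <= p \/ q <= s.
Proof.
rewrite /unlinked; case: (ltP p r) => h1; case: (ltP q r) => h2; case: (ltP p s) => h3;
  case: (ltP q s) => h4 //= _; lra.
Qed.

Lemma bdpt_side ax dr a : 0 < a < 1 ->
  if ax then (if dr then 0 < bdpt ax dr a < 1 else 2 < bdpt ax dr a < 3)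
  else (if dr then 3 < bdpt ax dr a < 4 else 1 < bdpt ax dr a < 2).
Proof. by rewrite /bdpt; case: ax; case: dr; lra. Qed.

Lemma bdpt_inj ax dr a ax' dr' a' : 0 < a < 1 -> 0 < a' < 1 ->
  bdpt ax dr a = bdpt ax' dr' a' -> [/\ ax = ax', dr = dr' & a = a'].
Proof.
by rewrite /bdpt; case: ax; case: dr; case: ax'; case: dr' => ? ? ?; split=> //; lra.
Qed.

Lemma bdpt_between ax dr a b c ax' dr' c' :
  0 < a < 1 -> 0 < b < 1 -> 0 < c < 1 -> 0 < c' < 1 -> a < c < b \/ b < c < a ->
  unlinked (bdpt ax dr a) (bdpt ax dr b) (bdpt ax dr c) (bdpt ax' dr' c') ->
  [/\ ax' = ax, dr' = dr & a <= c' <= b \/ b <= c' <= a].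
Proof.
wlog ab : a b / bdpt ax dr a <= bdpt ax dr b.
  move=> H a0 b0 c0 c0' acb; case: (leP (bdpt ax dr a) (bdpt ax dr b)) => h; first exact: H.
  rewrite unlinkedC => /(H b a (ltW h))[] //; [tauto|move=> -> ->; split=> //; tauto].
move=> a0 b0 c0 c0' acb /unlinked_between -/(_ _); have -> : bdpt ax dr a < bdpt ax dr c < bdpt ax dr b.
  by move: ab; rewrite /bdpt; case: ax; case: dr; lra.
move=> /(_ isT); rewrite /bdpt; case: ax ab; case: dr; case: ax'; case: dr' => ab h; split=> //; rewrite /bdpt in ab; lra.
Qed.

Lemma bdpt_adjacent ax dr a b ax' dr' c : 0 < a < 1 -> 0 < b < 1 -> 0 < c < 1 ->
  (ax = ax' -> dr = dr' -> (c < a) && (c < b) || (a < c) && (b < c)) ->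
  (bdpt ax dr a < bdpt ax' dr' c) = (bdpt ax dr b < bdpt ax' dr' c).
Proof.
move=> /andP[a0 a1] /andP[b0 b1] /andP[c0 c1] H; apply: bdpt_lt_mono => //; try by apply/andP.
move=> e1 e2; have := H e1 e2; clear H => /orP[] /andP[h1 h2]; split; apply/idP/idP; lra.
Qed.

End Bdpt.

Section Pattern.
Context {R : realType}.

(* A crossing of the coordinate circle dual to X0 (first component true) or to
   Y0, its direction, and its position on that circle. *)
Definition crossing := (bool * bool * R)%type.
Implicit Types (u v w : crossing) (W : seq crossing).

Definition outp u : R := bdpt u.1.1 u.1.2 u.2.
Definition inp u : R := bdpt u.1.1 (~~ u.1.2) u.2.

Record good_pattern W : Prop := GoodPattern {
  gp_uniq : uniq W;
  gp_pos : {in W, forall u, 0 < u.2 < 1};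
  gp_inj : {in W &, forall u v, u.1.1 = v.1.1 -> u.2 = v.2 -> u = v};
  gp_unlinked : {in W &, forall u v, u != v ->
    unlinked (outp u) (inp (next W u)) (outp v) (inp (next W v))} }.

Lemma good_rot n W : good_pattern W -> good_pattern (rot n W).
Proof.
case=> uW pW iW nW; split; rewrite ?rot_uniq //.
- by move=> u; rewrite mem_rot; exact: pW.
- by move=> u v; rewrite !mem_rot; exact: iW.
- by move=> u v; rewrite !mem_rot !next_rot //; exact: nW.
Qed.

Definition same_side W u := (u.1.1 == (next W u).1.1) && (u.1.2 != (next W u).1.2).

Lemma next_del (u v w : crossing) (s : seq crossing) : uniq (u :: v :: s) -> w \in s ->
  [/\ next (u :: v :: s) w = u & next s w = next (u :: v :: s) v] \/
  next (u :: v :: s) w = next s w.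
Proof.
move=> us ws.
have wu : (w == u) = false.
  by apply/eqP => E; move: us; rewrite -E /= inE ws orbT.
have wv : (w == v) = false.
  by apply/eqP => E; move: us; rewrite -E /= ws !andbF.
have uv : (v == u) = false by move: us => /= /andP[]; rewrite inE eq_sym; case: (v == u).
case: s us ws => // x s us ws.
set k := index w (x :: s).
have E1 : next (u :: v :: x :: s) w = nth u (x :: s) k.+1.
  rewrite next_nth (_ : w \in _) ?inE; last by rewrite -in_cons ws !orbT.
  have -> : index w [:: u, v, x & s] = k.+2 by rewrite /= ![_ == w]eq_sym wu wv /k /= eq_sym.
  by [].
have E2 : next (u :: v :: x :: s) v = x.
  by rewrite next_nth !inE eqxx orbT /= [u == v]eq_sym uv eqxx.
have E3 : next (x :: s) w = nth x (x :: s) k.+1 by rewrite next_nth ws.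
rewrite E1 E2 E3; case: (ltnP k (size s)) => ks; [right|left; split].
- by apply: set_nth_default.
- by rewrite nth_default.
- by rewrite nth_default.
Qed.

End Pattern.

Section Reduction.
Context {R : realType}.
Implicit Types (u v w : crossing (R := R)) (W : seq (crossing (R := R))).

Definition letter (F : fieldType) (U V : 'M[F]_2) (l : bool * bool) : 'M[F]_2 :=
  if l.1 then (if l.2 then U else U^-1) else (if l.2 then V else V^-1).

Lemma letterV (F : fieldType) (U V : 'M[F]_2) a d : \det U = 1 -> \det V = 1 ->
  letter U V (a, d) * letter U V (a, ~~ d) = 1.
Proof.
by move=> dU dV; case: a; case: d; rewrite /letter /= ?mulrV ?mulVr ?SL2_unit.
Qed.

Definition word (F : fieldType) (U V : 'M[F]_2) W : 'M[F]_2 :=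
  \prod_(u <- W) letter U V u.1.

(* The chord of least gap among those with both ends on one side is innermost,
   so that no other crossing separates its ends. *)
Lemma innermost W : good_pattern W -> has (same_side W) W ->
  exists2 u, (u \in W) && same_side W u & forall w, w \in W -> w.1.1 = u.1.1 ->
    w != u -> w != next W u ->
    (w.2 < u.2) && (w.2 < (next W u).2) || (u.2 < w.2) && ((next W u).2 < w.2).
Proof.
move=> gW hs; have [uW pW iW nW] := gW.
have [u /andP[uI us] umin] := seq_min (fun u => `|u.2 - (next W u).2|) hs.
exists u; rewrite ?uI //= => w wI wu1 wu wv.
set v := next W u in umin wv *.
have vI : v \in W by rewrite mem_next.
move: (us); rewrite /same_side -/v => /andP[/eqP av dv].
have wu2 : w.2 != u.2 by apply: contra_neq wu => /(iW _ _ wI uI wu1).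
have wv2 : w.2 != v.2.
  by apply: contra_neq wv => E; apply: iW => //; rewrite wu1 av.
apply/negPn/negP => nout.
have btw : u.2 < w.2 < v.2 \/ v.2 < w.2 < u.2.
  move: nout wu2 wv2; case: (ltgtP w.2 u.2) => //=; case: (ltgtP w.2 v.2) => //=; tauto.
have side_u : outp u = bdpt u.1.1 u.1.2 u.2 by [].
have side_v : inp v = bdpt u.1.1 u.1.2 v.2.
  by rewrite /inp -av; case: (u.1.2) (v.1.2) dv => [] [].
have [pu pv pw] := And3 (pW _ uI) (pW _ vI) (pW _ wI).
have smaller (x : crossing) (c d : R) : x \in W -> same_side W x ->
   `|x.2 - (next W x).2| = `|c - d| -> u.2 < c < v.2 \/ v.2 < c < u.2 ->
   u.2 <= d <= v.2 \/ v.2 <= d <= u.2 -> False.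
  move=> xI xs; have := umin _ xI xs; rewrite -/v => + E; rewrite E; clear.
  move: (u.2) (v.2) => a b.
  by case: (ger0P (a - b)) => ?; case: (ger0P (c - d)) => ? ? [] /andP[? ?] [] /andP[? ?]; lra.
have [dw|dw] := eqVneq w.1.2 u.1.2.
  have := nW u w uI wI; rewrite eq_sym wu => /(_ isT).
  rewrite side_u -/v side_v {1}/outp wu1 dw /inp.
  have wnI : next W w \in W by rewrite mem_next.
  move=> /(bdpt_between pu pv pw (pW _ wnI) btw)[a1 d1 b1].
  apply: (smaller w w.2 (next W w).2 wI) => //.
  by rewrite /same_side wu1 a1 eqxx dw -d1; case: ((next W w).1.2).
pose x := prev W w; have xI : x \in W by rewrite mem_prev.
have nx : next W x = w by rewrite next_prev.
have xu : u != x by apply: contra_neq wv => E; rewrite /v E nx.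
have := nW u x uI xI xu; rewrite side_u -/v side_v nx unlinkedC'.
have -> : inp w = bdpt u.1.1 u.1.2 w.2.
  by rewrite /inp wu1; case: (u.1.2) (w.1.2) dw => [] [].
move=> /(bdpt_between pu pv pw (pW _ xI) btw)[a1 d1 b1].
apply: (smaller x w.2 x.2 xI) => //; last by rewrite nx distrC.
by rewrite /same_side nx a1 wu1 eqxx d1 eq_sym dw.
Qed.

Lemma reduce_pattern W : good_pattern W -> has (same_side W) W ->
  exists W', [/\ good_pattern W', (size W' < size W)%N &
    forall (F : fieldType) (U V : 'M[F]_2), \det U = 1 -> \det V = 1 ->
      \tr (word U V W) = \tr (word U V W')].
Proof.
move=> gW /(innermost gW)[u /andP[uI us] adj].
have [uW pW iW nW] := gW.
have [k [s rk]] : exists k s, rot k W = u :: s.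
  have [i s E] := rot_to uI; by exists i, s.
have gR := good_rot k gW; rewrite rk in gR.
have nR w : next (u :: s) w = next W w by rewrite -rk next_rot.
have mR w : (w \in u :: s) = (w \in W) by rewrite -rk mem_rot.
case: s rk gR nR mR => [|v s] rk gR nR mR.
  have E : next W u = u by rewrite -nR /= eqxx.
  by move: us; rewrite /same_side E !eqxx andbF.
have vE : next W u = v by rewrite -nR /= eqxx.
rewrite vE in adj; move: us; rewrite /same_side vE => /andP[/eqP uv duv].
have {gW uW pW iW nW}[uW pW iW nW] := gR.
have sI w : w \in s -> w \in u :: v :: s by move=> ws; rewrite !inE ws !orbT.
have nu w : w \in s -> w != u.
  by move=> ws; apply/eqP => E; move: uW; rewrite -E /= inE ws orbT.
have nv w : w \in s -> w != v.
  by move=> ws; apply/eqP => E; move: uW; rewrite -E /= ws !andbF.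
have uI' : u \in u :: v :: s by rewrite mem_head.
have vI' : v \in u :: v :: s by rewrite !inE eqxx orbT.
have us : uniq s by move: uW => /= /and3P[].
exists s; split; last first.
- move=> F U V dU dV; rewrite /word -(tr_rot _ k) rk !big_cons.
  have -> : v.1 = (u.1.1, ~~ u.1.2).
    by rewrite uv [v.1]surjective_pairing /=; congr pair; case: (u.1.2) (v.1.2) duv => [] [].
  by rewrite [u.1]surjective_pairing mulrA letterV // mul1r.
- by rewrite -(size_rot k W) rk /= ltnW.
have same (w : crossing) dr : w \in s -> (inp u < bdpt w.1.1 dr w.2) = (outp v < bdpt w.1.1 dr w.2).
  move=> ws; rewrite /inp /outp uv.
  have -> : v.1.2 = ~~ u.1.2 by case: (u.1.2) (v.1.2) duv => [] [].
  apply: bdpt_adjacent; [exact: pW|exact: pW|exact/pW/sI|move=> E _].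
  by apply: adj; [rewrite -mR sI|rewrite uv|exact: nu|exact: nv].
have sameo (w : crossing) : w \in s -> (inp u < outp w) = (outp v < outp w) by exact: same.
have samei (w : crossing) : w \in s -> (inp u < inp w) = (outp v < inp w) by exact: same.
split=> //.
- by move=> w /sI; exact: pW.
- by move=> w w' /sI wI /sI wI'; exact: iW.
have main w w' : w \in s -> w' \in s -> w != w' ->
    next (u :: v :: s) w = u -> next s w = next (u :: v :: s) v ->
    next (u :: v :: s) w' = next s w' ->
    unlinked (outp w) (inp (next s w)) (outp w') (inp (next s w')).
  move=> ws ws' ww' e1 e2 e3.
  have n's : next s w' \in s by rewrite mem_next.
  have := nW w w' (sI _ ws) (sI _ ws') ww'.
  have := nW v w' vI' (sI _ ws'); rewrite eq_sym nv // => /(_ isT).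
  rewrite e1 -e2 e3 /unlinked sameo // samei //.
  by case: (outp v < outp w'); case: (outp v < inp _); case: (inp (next s w) < outp w');
    case: (inp (next s w) < inp _); case: (outp w < outp w'); case: (outp w < inp _).
have distinct w w' : w \in s -> w' \in s -> w != w' ->
   [/\ outp w != outp w', outp w != inp (next s w'), inp (next s w) != outp w' & inp (next s w) != inp (next s w')].
  move=> ws ws' ww'.
  have m1 : next s w \in s by rewrite mem_next.
  have m2 : next s w' \in s by rewrite mem_next.
  have nn : next s w != next s w'.
    by apply: contra_neq ww'; apply: (can_inj (prev_next us)).
  have D (x y : crossing) (a b : bool) : x \in s -> y \in s ->
      bdpt x.1.1 a x.2 = bdpt y.1.1 b y.2 -> x = y /\ a = b.
    move=> xs ys E; have [e1 e2 e3] := bdpt_inj (pW _ (sI _ xs)) (pW _ (sI _ ys)) E.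
    by split=> //; apply: iW => //; exact: sI.
  split; apply/eqP => /D[] //.
  - by move=> E; rewrite E eqxx in ww'.
  - by move=> E; rewrite E; case: (_.1.2).
  - by move=> E; rewrite E; case: (_.1.2).
  - by move=> E; rewrite E eqxx in nn.
move=> w w' ws ws' ww'.
have [[e1 e2]|e] := next_del uW ws; have [[e1' e2']|e'] := next_del uW ws'.
- have : w = w' by apply: (can_inj (prev_next uW)); rewrite e1 e1'.
  by move/eqP; rewrite (negbTE ww').
- exact: main.
- have [d1 d2 d3 d4] := distinct _ _ ws ws' ww'.
  rewrite unlinked_sym //; apply: main => //; by rewrite eq_sym.
- by rewrite -e -e'; apply: nW; rewrite ?sI.
Qed.

End Reduction.

Lemma next4 (T : eqType) (W : seq T) (a b c d : T) : uniq W -> a \in W -> uniq [:: a; b; c; d] ->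
  next W a = b -> next W b = c -> next W c = d -> next W d = a -> exists k, rot k W = [:: a; b; c; d].
Proof.
move=> uW /rot_to[k p E] u4; rewrite -!(next_rot k uW) E => na nb nc nd.
exists k; have {}uW : uniq (a :: p) by rewrite -E rot_uniq.
move: u4; rewrite /= !inE !negb_or andbT => /and3P[/and3P[ab ac ad] /andP[bc bd] cd].
have ba : (b == a) = false by rewrite eq_sym; apply/negbTE.
have ca : (c == a) = false by rewrite eq_sym; apply/negbTE.
have da : (d == a) = false by rewrite eq_sym; apply/negbTE.
have cb : (c == b) = false by rewrite eq_sym; apply/negbTE.
have db : (d == b) = false by rewrite eq_sym; apply/negbTE.
have dc : (d == c) = false by rewrite eq_sym; apply/negbTE.
rewrite E {E}; case: p uW na nb nc nd => [|b' p] uW.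
  by rewrite /= eqxx => E; rewrite E eqxx in ab.
rewrite /= eqxx => E; rewrite {}E in uW *.
case: p uW => [|c' p] uW.
  by rewrite /= ba eqxx => E; rewrite E eqxx in ac.
rewrite /= ba eqxx => E; rewrite {}E in uW *.
case: p uW => [|d' p] uW.
  by rewrite /= ca cb eqxx => E; rewrite E eqxx in ad.
rewrite /= ca cb eqxx => E; rewrite {}E in uW *.
case: p uW => [|e' p] uW //.
rewrite /= da db dc eqxx => E; rewrite {}E in uW *.
by move: uW; rewrite /= !inE eqxx !orbT.
Qed.

Section Reduced.
Context {R : realType}.

Let lt13 (x y : R) : x < 1 -> 3 < y -> x < y. Proof. by move=> h1 h2; lra. Qed.

Variable W : seq (crossing (R := R)).
Hypothesis gW : good_pattern W.
Hypothesis red : ~~ has (same_side W) W.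
Implicit Types (u v w : crossing (R := R)) (e : crossing (R := R) * bool).

Let uW := gp_uniq gW.
Let pW := gp_pos gW.

Let redP u : u \in W -> (u.1.1 == (next W u).1.1) && (u.1.2 != (next W u).1.2) = false.
Proof. by move=> uI; apply/negbTE; move/hasPn: red; apply. Qed.

(* The two ends of the chords at a crossing: (u, true) is where the curve starts
   after u and (u, false) where it arrives before u. *)
Definition partner e := if e.2 then (next W e.1, false) else (prev W e.1, true).
Definition eside e : bool * bool := (e.1.1.1, if e.2 then e.1.1.2 else ~~ e.1.1.2).
Definition eval e : R := bdpt (eside e).1 (eside e).2 e.1.2.
Definition endat u (d : bool) := (u, u.1.2 == d).

Let eside_endat u d : eside (endat u d) = (u.1.1, d).
Proof. by rewrite /eside /endat /=; case: (u.1.2); case: d. Qed.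

Let partnerK e : partner (partner e) = e.
Proof. by case: e => u []; rewrite /partner /= ?prev_next ?next_prev. Qed.

Let partner_in e : e.1 \in W -> (partner e).1 \in W.
Proof. by case: e => u []; rewrite /partner /= ?mem_next ?mem_prev. Qed.

Let red_side e : e.1 \in W -> eside (partner e) != eside e.
Proof.
case: e => u b /= uI; apply/negP => /eqP; rewrite /eside /partner.
case: b => /= -[e1 e2].
  by have := redP uI; rewrite e1 eqxx -e2; case: (_.1.2).
have pI : prev W u \in W by rewrite mem_prev.
by have := redP pI; rewrite next_prev // e1 eqxx e2; case: (u.1.2).
Qed.

Let sidx (S : bool * bool) : nat := if S.1 then (if S.2 then 0 else 2) else (if S.2 then 3 else 1).

Let sidx_inj S S' : sidx S = sidx S' -> S = S'.
Proof. by case: S => [[] []]; case: S' => [[] []]. Qed.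

Let eval_idx e : e.1 \in W -> (sidx (eside e))%:R < eval e < (sidx (eside e))%:R + 1.
Proof.
move=> /pW p; have := bdpt_side (eside e).1 (eside e).2 p; rewrite /eval /sidx.
by case: ((eside e).1); case: ((eside e).2); lra.
Qed.

Let eval_lt e e' : e.1 \in W -> e'.1 \in W -> (sidx (eside e) < sidx (eside e'))%N -> eval e < eval e'.
Proof.
move=> /eval_idx h /eval_idx h'; rewrite -(ler_nat R) -natr1; lra.
Qed.

Let eval_inj e e' : e.1 \in W -> e'.1 \in W -> eval e = eval e' -> e = e'.
Proof.
move=> eI eI' /(bdpt_inj (pW eI) (pW eI'))[e1 e2 e3].
have E : e.1 = e'.1 by apply: (gp_inj gW).
rewrite [e]surjective_pairing [e']surjective_pairing E; congr pair.
by move: e2; rewrite /eside /= E; case: (e.2); case: (e'.2); case: (e'.1.1.2).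
Qed.

Let ends_unlinked e e' : e.1 \in W -> e'.1 \in W -> e' != e -> e' != partner e ->
  unlinked (eval e) (eval (partner e)) (eval e') (eval (partner e')).
Proof.
have evo u : eval (u, true) = outp u by [].
have evi u : eval (u, false) = inp u by [].
have main u v : u \in W -> v \in W -> u != v ->
  unlinked (eval (u, true)) (eval (next W u, false)) (eval (v, true)) (eval (next W v, false)).
  by move=> uI vI uv; rewrite !evo !evi; exact: (gp_unlinked gW).
case: e e' => u b [v b'] /= uI vI.
have uI' : prev W u \in W by rewrite mem_prev.
have vI' : prev W v \in W by rewrite mem_prev.
case: b; case: b'; rewrite /partner /= => n1 n2.
- by apply: main => //; apply: contra_neq n1 => ->.
- have := main u (prev W v) uI vI'; rewrite (next_prev uW) unlinkedC'; apply.
  by apply: contra_neq n2 => ->; rewrite (next_prev uW).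
- have := main (prev W u) v uI' vI; rewrite (next_prev uW) unlinkedC; apply.
  by apply: contra_neq n2 => ->.
- have := main (prev W u) (prev W v) uI' vI'; rewrite !(next_prev uW) unlinkedC unlinkedC'; apply.
  by apply: contra_neq n1 => /(can_inj (next_prev uW)) ->.
Qed.

Let corner e0 e1 e2 : e0.1 \in W -> e1.1 \in W -> e2.1 \in W ->
  eside e1 = eside e0 -> eside e2 = eside (partner e0) ->
  sidx (eside (partner e0)) = (sidx (eside e0)).+1 ->
  (forall e, e.1 \in W -> eside e = eside e0 -> eval e <= eval e1) ->
  (forall e, e.1 \in W -> eside e = eside (partner e0) -> eval e2 <= eval e) ->
  partner e1 = e2.
Proof.
move=> I0 I1 I2 s1 s2 sS max1 min2.
have [J0 J1 J2] := And3 (partner_in I0) (partner_in I1) (partner_in I2).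
have lt01 e : e.1 \in W -> eside e = eside e0 -> eval e < (sidx (eside e0)).+1%:R.
  by move=> eI es; have := eval_idx eI; rewrite es natr1 => /andP[].
have lt02 e : e.1 \in W -> eside e = eside (partner e0) -> (sidx (eside e0)).+1%:R < eval e.
  by move=> eI es; have := eval_idx eI; rewrite es sS => /andP[].
have [l0 l1] := (lt01 _ I0 erefl, lt01 _ I1 s1).
have [g0 g2] := (lt02 _ J0 erefl, lt02 _ I2 s2).
have btw e : e.1 \in W -> eval e0 <= eval e <= eval (partner e0) ->
    eside e = eside e0 \/ eside e = eside (partner e0).
  move=> eI /andP[b1 b2]; have /andP[h1 h2] := eval_idx eI.
  have /andP[h3 h4] := eval_idx I0; have /andP[h5 h6] := eval_idx J0.
  have k1 : (sidx (eside e0) < (sidx (eside e)).+1)%N.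
    by rewrite -(ltr_nat R) -natr1; lra.
  have k2 : (sidx (eside e) < (sidx (eside (partner e0))).+1)%N.
    by rewrite -(ltr_nat R) -natr1; lra.
  have [k|k] : sidx (eside e) = sidx (eside e0) \/ sidx (eside e) = sidx (eside (partner e0)).
      move: k1 k2; rewrite sS; clear -R; move: (sidx (eside e)) (sidx (eside e0)) => a b; lia.
    by left; apply: sidx_inj.
  by right; apply: sidx_inj.
have sA : eside (partner e1) = eside (partner e0).
  have [->//|n10] := eqVneq e1 e0.
  have n10' : e1 != partner e0.
    by apply/eqP => E; move: (red_side I0); rewrite -E s1 eqxx.
  have := ends_unlinked I0 I1 n10 n10' => /unlinked_between.
  have lt : eval e0 < eval e1.
    rewrite lt_neqAle max1 // andbT; apply: contra_neq n10 => E; exact/esym/eval_inj.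
  rewrite lt (lt_trans l1 g0) => /(_ isT) /(btw _ J1)[] // E.
  by move: (red_side I1); rewrite E s1 eqxx.
have sB : eside (partner e2) = eside e0.
  have [->|n20] := eqVneq e2 (partner e0); first by rewrite partnerK.
  have n20' : e2 != e0.
    by apply/eqP => E; move: (red_side I0); rewrite -s2 E eqxx.
  have := ends_unlinked I0 I2 n20' n20 => /unlinked_between.
  have lt : eval e2 < eval (partner e0).
    rewrite lt_neqAle min2 // andbT; apply: contra_neq n20 => E; exact/eval_inj.
  rewrite lt (lt_trans l0 g2) => /(_ isT) /(btw _ J2)[] // E.
  by move: (red_side I2); rewrite E s2 eqxx.
apply/eqP; case: (eqVneq (partner e1) e2) => // n12.
have n12' : e2 != e1.
  apply/eqP => E; have := eval_lt I0 J0; rewrite sS => /(_ (ltnSn _)).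
  by move: s1; rewrite -E s2 => E'; move: (red_side I0); rewrite E' eqxx.
have := ends_unlinked I1 I2 n12' (_ : e2 != partner e1); rewrite eq_sym => /(_ n12) /unlinked_between.
have lt : eval e2 < eval (partner e1).
  rewrite lt_neqAle min2 // andbT; apply: contra_neq n12 => E; exact/esym/eval_inj.
rewrite lt (lt_trans l1 g2) => /(_ isT) /andP[h _].
have E : partner e2 = e1.
  by apply: eval_inj => //; apply/eqP; rewrite eq_le h max1.
by move: n12; rewrite -E partnerK eqxx.
Qed.

Let isL e : e.1 \in W -> eval e < 1 -> eside e = (true, true).
Proof.
by move=> /eval_idx; rewrite /sidx; case: (eside e) => [[] []] //= /andP[h1 h2] h3; exfalso; lra.
Qed.

Let isB e : e.1 \in W -> 3 < eval e -> eside e = (false, true).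
Proof.
by move=> /eval_idx; rewrite /sidx; case: (eside e) => [[] []] //= /andP[h1 h2] h3; exfalso; lra.
Qed.

Let corner0 e0 e1 e2 : e0.1 \in W -> e1.1 \in W -> e2.1 \in W ->
  eside e1 = eside e0 -> eside e2 = eside (partner e0) ->
  eside e0 = (false, true) -> eside (partner e0) = (true, true) ->
  (forall e, e.1 \in W -> eside e = eside e0 -> eval e <= eval e1) ->
  (forall e, e.1 \in W -> eside e = eside (partner e0) -> eval e2 <= eval e) ->
  partner e1 = e2.
Proof.
move=> I0 I1 I2 s1 s2 sB sL; rewrite sB sL => max1 min2; rewrite sB in s1; rewrite sL in s2.
have [J0 J1 J2] := And3 (partner_in I0) (partner_in I1) (partner_in I2).
have gB e : e.1 \in W -> eside e = (false, true) -> 3 < eval e.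
  by move=> eI es; have := eval_idx eI; rewrite es => /andP[].
have lL e : e.1 \in W -> eside e = (true, true) -> eval e < 1.
  by move=> eI es; have := eval_idx eI; rewrite es /= add0r => /andP[].
have [g0 g1] := (gB _ I0 sB, gB _ I1 s1).
have [l0 l2] := (lL _ J0 sL, lL _ I2 s2).
have lg := lt13 l0 g0.
have sA : eside (partner e1) = (true, true).
  have [->//|n10] := eqVneq e1 e0.
  have n10' : e1 != partner e0 by apply/eqP => E; move: s1; rewrite E sL.
  have := ends_unlinked I0 I1 n10 n10'; rewrite unlinkedC => /unlinked_outside /(_ lg) H.
  have lt : eval e0 < eval e1.
    rewrite lt_neqAle max1 // andbT; apply: contra_neq n10 => E; exact/esym/eval_inj.
  have [h|h] := H (or_intror lt); first by apply: isL => //; exact: le_lt_trans h l0.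
  have E : eside (partner e1) = (false, true) by apply: isB => //; exact: lt_le_trans g0 h.
  by move: (red_side I1); rewrite E s1 eqxx.
have sB' : eside (partner e2) = (false, true).
  have [->|n20] := eqVneq e2 (partner e0); first by rewrite partnerK.
  have n20' : e2 != e0 by apply/eqP => E; move: s2; rewrite E sB.
  have := ends_unlinked I0 I2 n20' n20; rewrite unlinkedC => /unlinked_outside /(_ lg) H.
  have lt : eval e2 < eval (partner e0).
    rewrite lt_neqAle min2 // andbT; apply: contra_neq n20 => E; exact/eval_inj.
  have [h|h] := H (or_introl lt); last by apply: isB => //; exact: lt_le_trans g0 h.
  have E : eside (partner e2) = (true, true) by apply: isL => //; exact: le_lt_trans h l0.
  by move: (red_side I2); rewrite E s2 eqxx.
apply/eqP; case: (eqVneq (partner e1) e2) => // n12.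
have n12' : e2 != e1 by apply/eqP => E; move: s2; rewrite E s1.
have := ends_unlinked I1 I2 n12' (_ : e2 != partner e1); rewrite eq_sym => /(_ n12).
have l1 := lL _ J1 sA.
have lg1 := lt13 l1 g1.
rewrite unlinkedC => /unlinked_outside /(_ lg1) H.
have lt : eval e2 < eval (partner e1).
  rewrite lt_neqAle min2 // andbT; apply: contra_neq n12 => E; exact/esym/eval_inj.
have g2 := gB _ J2 sB'.
have [h|h] := H (or_introl lt); first by have := lt13 (le_lt_trans h l1) g2; rewrite ltxx.
have E : partner e2 = e1.
  by apply: eval_inj => //; apply/eqP; rewrite eq_le h max1.
by move: n12; rewrite -E partnerK eqxx.
Qed.

Let nw u v := [|| [&& u.1.1, u.1.2, ~~ v.1.1 & v.1.2] | [&& ~~ u.1.1, ~~ u.1.2, v.1.1 & ~~ v.1.2]].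
Let se u v := [|| [&& u.1.1, ~~ u.1.2, ~~ v.1.1 & ~~ v.1.2] | [&& ~~ u.1.1, u.1.2, v.1.1 & v.1.2]].
Let ne u v := [|| [&& ~~ u.1.1, ~~ u.1.2, v.1.1 & v.1.2] | [&& u.1.1, ~~ u.1.2, ~~ v.1.1 & v.1.2]].
Let sw u v := [|| [&& u.1.1, u.1.2, ~~ v.1.1 & ~~ v.1.2] | [&& ~~ u.1.1, u.1.2, v.1.1 & ~~ v.1.2]].

Let chords (c : crossing (R := R) -> crossing (R := R) -> bool) := count (fun u => c u (next W u)) W.

Let sum_count (P : pred (crossing (R := R))) : (\sum_(u <- W) P u = count P W)%N.
Proof. by rewrite -sum1_count [RHS]big_mkcond; apply: eq_bigr => u _; case: (P u). Qed.

Let corner_counts : chords nw = chords se /\ chords ne = chords sw.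
Proof.
pose at_ax a d u := (u.1.1 == a) && (u.1.2 == d).
have H1 : (chords nw + chords sw + (count (at_ax true false) W + count (at_ax true true) W) =
           chords ne + chords se + (count (at_ax true true) W + count (at_ax true false) W))%N.
  rewrite -{1}(count_next (at_ax true true) uW) -{2}(count_next (at_ax true false) uW).
  rewrite /chords -!sum_count -!big_split /=; apply: eq_big_seq => u uI.
  have := redP uI; rewrite /nw /sw /ne /se /at_ax.
  by case: (u.1.1); case: (u.1.2); case: ((next W u).1.1); case: ((next W u).1.2).
have H2 : (chords nw + chords ne + (count (at_ax false true) W + count (at_ax false false) W) =
           chords sw + chords se + (count (at_ax false false) W + count (at_ax false true) W))%N.
  rewrite -{1}(count_next (at_ax false false) uW) -{2}(count_next (at_ax false true) uW).
  rewrite /chords -!sum_count -!big_split /=; apply: eq_big_seq => u uI.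
  have := redP uI; rewrite /nw /sw /ne /se /at_ax.
  by case: (u.1.1); case: (u.1.2); case: ((next W u).1.1); case: ((next W u).1.2).
move: H1 H2; clear -R; move: (chords nw) (chords se) (chords ne) (chords sw) => a b c d.
move: (count _ _) (count _ _) (count _ _) (count _ _) => x y z t; lia.
Qed.

Let exch (S1 S2 : bool * bool) u : u \in W ->
  (eside (u, true) == S1) && (eside (next W u, false) == S2) ||
  (eside (u, true) == S2) && (eside (next W u, false) == S1) ->
  exists2 e, e.1 \in W & eside e = S1 /\ eside (partner e) = S2.
Proof.
move=> uI /orP[] /andP[/eqP h1 /eqP h2]; first by exists (u, true).
by exists (next W u, false); rewrite /= ?mem_next // /partner /= prev_next.
Qed.

Let chord_ex c : chords c != 0%N -> exists2 u, u \in W & c u (next W u).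
Proof. by rewrite -lt0n /chords -has_count => /hasP. Qed.

Let chord_no c u : chords c = 0%N -> u \in W -> c u (next W u) = false.
Proof.
move=> c0 uI; apply/negbTE/negP => h.
by have := has_count (fun u => c u (next W u)) W; rewrite -/(chords c) c0 ltnn => /hasP[]; exists u.
Qed.

Lemma reduced_peripheral (F : fieldType) (U V : 'M[F]_2) : \det U = 1 -> \det V = 1 ->
  chords nw != 0%N -> chords ne != 0%N -> \tr (word U V W) = \tr (U * V * U^-1 * V^-1).
Proof.
move=> dU dV cnw cne; have [E1 E2] := corner_counts.
have [u1 u1I /orP c1] := chord_ex cnw.
have [e1 e1I [s1 s1']] : exists2 e, e.1 \in W & eside e = (true, true) /\ eside (partner e) = (false, false).
  apply: (exch u1I); move: c1; rewrite /eside /=.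
  by case: (u1.1.1); case: (u1.1.2); case: ((next W u1).1.1); case: ((next W u1).1.2) => -[].
have [u2 u2I /orP c2] := chord_ex cne.
have [e2 e2I [s2 s2']] : exists2 e, e.1 \in W & eside e = (false, false) /\ eside (partner e) = (true, false).
  apply: (exch u2I); move: c2; rewrite /eside /=.
  by case: (u2.1.1); case: (u2.1.2); case: ((next W u2).1.1); case: ((next W u2).1.2) => -[].
have [u3 u3I /orP c3] : exists2 u, u \in W & se u (next W u) by apply: chord_ex; rewrite -E1.
have [e3 e3I [s3 s3']] : exists2 e, e.1 \in W & eside e = (true, false) /\ eside (partner e) = (false, true).
  apply: (exch u3I); move: c3; rewrite /eside /=.
  by case: (u3.1.1); case: (u3.1.2); case: ((next W u3).1.1); case: ((next W u3).1.2) => -[].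
have [u4 u4I /orP c4] : exists2 u, u \in W & sw u (next W u) by apply: chord_ex; rewrite -E2.
have [e4 e4I [s4 s4']] : exists2 e, e.1 \in W & eside e = (false, true) /\ eside (partner e) = (true, true).
  apply: (exch u4I); move: c4; rewrite /eside /=.
  by case: (u4.1.1); case: (u4.1.2); case: ((next W u4).1.1); case: ((next W u4).1.2) => -[].
have hX : has (fun u => u.1.1) W by apply/hasP; exists e1.1 => //; case: s1.
have hY : has (fun u => ~~ u.1.1) W by apply/hasP; exists e2.1 => //; case: s2 => ->.
have [ut /andP[utI utX] utm] := seq_max (fun u => u.2) hX.
have [ub /andP[ubI ubX] ubm] := seq_min (fun u => u.2) hX.
have [vr /andP[vrI vrY] vrm] := seq_max (fun u => u.2) hY.
have [vl /andP[vlI vlY] vlm] := seq_min (fun u => u.2) hY.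
have evE e a d : eside e = (a, d) -> eval e = bdpt a d e.1.2 by rewrite /eval => ->.
have axE e a d : eside e = (a, d) -> e.1.1.1 = a by case.
have P1 : partner (endat ut true) = endat vl false.
  apply: (corner e1I); rewrite ?eside_endat ?s1 ?s1' ?utX ?(negbTE vlY) // => e eI es.
    rewrite (evE _ _ _ es) (evE _ true true) ?eside_endat ?utX //=.
    by apply: utm => //; rewrite (axE _ _ _ es).
  rewrite (evE _ _ _ es) (evE _ false false) ?eside_endat ?(negbTE vlY) //= lerD2l.
  by apply: vlm => //; rewrite (axE _ _ _ es).
have P2 : partner (endat vr false) = endat ut false.
  apply: (corner e2I); rewrite ?eside_endat ?s2 ?s2' ?utX ?(negbTE vrY) // => e eI es.
    rewrite (evE _ _ _ es) (evE _ false false) ?eside_endat ?(negbTE vrY) //= lerD2l.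
    by apply: vrm => //; rewrite (axE _ _ _ es).
  rewrite (evE _ _ _ es) (evE _ true false) ?eside_endat ?utX //= lerD2l lerN2.
  by apply: utm => //; rewrite (axE _ _ _ es).
have P3 : partner (endat ub false) = endat vr true.
  apply: (corner e3I); rewrite ?eside_endat ?s3 ?s3' ?ubX ?(negbTE vrY) // => e eI es.
    rewrite (evE _ _ _ es) (evE _ true false) ?eside_endat ?ubX //= lerD2l lerN2.
    by apply: ubm => //; rewrite (axE _ _ _ es).
  rewrite (evE _ _ _ es) (evE _ false true) ?eside_endat ?(negbTE vrY) //= lerD2l lerN2.
  by apply: vrm => //; rewrite (axE _ _ _ es).
have P4 : partner (endat vl true) = endat ub true.
  apply: (corner0 e4I); rewrite ?eside_endat ?s4 ?s4' ?ubX ?(negbTE vlY) // => e eI es.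
    rewrite (evE _ _ _ es) (evE _ false true) ?eside_endat ?(negbTE vlY) //= lerD2l lerN2.
    by apply: vlm => //; rewrite (axE _ _ _ es).
  rewrite (evE _ _ _ es) (evE _ true true) ?eside_endat ?ubX //=.
  by apply: ubm => //; rewrite (axE _ _ _ es).
have fin a b c d : a \in W ->
    next W a = b -> next W b = c -> next W c = d -> next W d = a -> uniq [:: a; b; c; d] ->
    \tr (word U V W) = \tr (letter U V a.1 * letter U V b.1 * letter U V c.1 * letter U V d.1).
  move=> aI h1 h2 h3 h4 uq; have [k rk] := next4 uW aI uq h1 h2 h3 h4.
  by rewrite /word -(tr_rot _ k) rk !big_cons big_nil mulr1 !mulrA.
have ltr u a d : u.1.1 = a -> u.1.2 = d -> letter U V u.1 = letter U V (a, d).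
  by move=> <- <-; rewrite -surjective_pairing.
move: P1 P2 P3 P4; rewrite /endat !eqbF_neg !eqb_id; case dut : (ut.1.2).
  rewrite {1}/partner /= => -[n1] /esym dvl P2 P3.
  have {}dvl : vl.1.2 = true by move: dvl; case: (vl.1.2).
  rewrite dvl {1}/partner /= => -[n2] /esym dub.
  have {}dub : ub.1.2 = false by move: dub; case: (ub.1.2).
  move: P3; rewrite dub {1}/partner /= => -[n3] /esym dvr.
  have {}dvr : vr.1.2 = false by move: dvr; case: (vr.1.2).
  move: P2; rewrite dvr {1}/partner /= => -[n4].
  rewrite (fin ut vl ub vr) //.
  - by rewrite (ltr ut true true utX dut) (ltr vl false true (negbTE vlY) dvl) (ltr ub true false ubX dub)
       (ltr vr false false (negbTE vrY) dvr).
  - rewrite /= !inE !negb_or !andbT; apply/and3P; split; [apply/and3P; split|apply/andP; split|]; apply/eqP => E.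
    + by move: vlY; rewrite -E utX.
    + by move: dub; rewrite -E dut.
    + by move: vrY; rewrite -E utX.
    + by move: vlY; rewrite E ubX.
    + by move: dvr; rewrite -E dvl.
    + by move: vrY; rewrite -E ubX.
move=> P1 P2 P3 P4.
have := congr1 partner P2; rewrite partnerK [in RHS]/partner /= => -[n1 /esym dvr].
have {}dvr : vr.1.2 = true by move: dvr; case: (vr.1.2).
have := congr1 partner P3; rewrite partnerK dvr [in RHS]/partner /= => -[n2 /esym dub].
have {}dub : ub.1.2 = true by move: dub; case: (ub.1.2).
have := congr1 partner P4; rewrite partnerK dub [in RHS]/partner /= => -[n3 /esym dvl].
have {}dvl : vl.1.2 = false by move: dvl; case: (vl.1.2).
have := congr1 partner P1; rewrite partnerK dvl [in RHS]/partner /= => -[n4].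
rewrite -(tr_commV dU dV) (fin ut vr ub vl) //.
- by rewrite (ltr ut true false utX dut) (ltr vr false true (negbTE vrY) dvr) (ltr ub true true ubX dub)
       (ltr vl false false (negbTE vlY) dvl).
- rewrite /= !inE !negb_or !andbT; apply/and3P; split; [apply/and3P; split|apply/andP; split|]; apply/eqP => E.
  + by move: vrY; rewrite -E utX.
  + by move: dub; rewrite -E dut.
  + by move: vlY; rewrite -E utX.
  + by move: vrY; rewrite E ubX.
  + by move: dvl; rewrite -E dvr.
  + by move: vlY; rewrite -E ubX.
Qed.

Let key1 (p q r s : R) : unlinked p q r s -> p < r -> p < 2 -> r < 2 -> 2 < q -> 2 < s -> s <= q.
Proof.
rewrite /unlinked; case: (ltP p r) => // h1; case: (ltP q r) => h2; case: (ltP p s) => h3;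
  case: (ltP q s) => h4 //= _ _; lra.
Qed.

Let key2 (p q r s : R) : unlinked p q r s -> p < r -> 2 < p -> 2 < r -> q < 2 -> s < 2 -> s <= q.
Proof.
rewrite /unlinked; case: (ltP p r) => // h1; case: (ltP q r) => h2; case: (ltP p s) => h3;
  case: (ltP q s) => h4 //= _ _; lra.
Qed.

Let key3 (p q r s : R) : unlinked p q r s -> 1 < q < 3 -> 1 < s < 3 ->
  [\/ p < r < 1, 3 < p < r | 3 < p /\ r < 1] -> s <= q.
Proof.
rewrite /unlinked; case: (ltP p r) => h1; case: (ltP q r) => h2; case: (ltP p s) => h3;
  case: (ltP q s) => h4 //= _ h5 h6 [h7|h7|[h7 h8]]; lra.
Qed.

Let key4 (p q r s : R) : unlinked p q r s -> p < r -> 1 < p < 3 -> 1 < r < 3 ->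
  q < 1 \/ 3 < q -> s < 1 \/ 3 < s -> (q < 1 /\ 3 < s) \/ (s <= q /\ ((q < 1 /\ s < 1) \/ (3 < q /\ 3 < s))).
Proof.
rewrite /unlinked; case: (ltP p r) => // h1; case: (ltP q r) => h2; case: (ltP p s) => h3;
  case: (ltP q s) => h4 //= _ _ h5 h6 [h7|h7] [h8|h8]; 
  first [solve [left; split; lra] | solve [right; split; [lra|left; split; lra]]
        |solve [right; split; [lra|right; split; lra]]].
Qed.

Let inp_neq u v : u \in W -> v \in W -> u != v -> inp (next W v) != inp (next W u).
Proof.
move=> uI vI uv; apply: contra_neq uv => E.
have uI' : next W u \in W by rewrite mem_next.
have vI' : next W v \in W by rewrite mem_next.
have /(congr1 fst) /= E' : (next W v, false) = (next W u, false) by apply: eval_inj.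
by apply: (can_inj (prev_next uW)).
Qed.

Lemma reduced_falling (F : fieldType) : W != [::] -> chords nw = 0%N ->
  exists ms, forall U V : 'M[F]_2, \det U = 1 -> \det V = 1 ->
    \tr (word U V W) = \tr (act ms (U, V)).1.
Proof.
move=> W0 c0; have [E1 _] := corner_counts; have c1 : chords se = 0%N by rewrite -E1.
have cst : {in W &, forall u v, (u.1.1 == u.1.2) = (v.1.1 == v.1.2)}.
  apply: (next_const (f := fun u : crossing (R := R) => u.1.1 == u.1.2)) => // u uI.
  have := chord_no c0 uI; have := chord_no c1 uI; have := redP uI; rewrite /nw /se.
  by case: (u.1.1); case: (u.1.2); case: ((next W u).1.1); case: ((next W u).1.2).
clear c0 c1 E1; have [x xI] : exists x, x \in W by case: (W) W0 => // x s _; exists x; rewrite mem_head.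
have cx u : u \in W -> (u.1.1 == u.1.2) = (x.1.1 == x.1.2) by move=> uI; apply: cst.
case dx : (x.1.1 == x.1.2) cx => cx.
  pose o (u : crossing (R := R)) := if u.1.1 then u.2 else 1 + u.2.
  have dr u : u \in W -> u.1.2 = u.1.1 by move=> /cx /eqP ->.
  have oE u : u \in W -> o u = outp u.
    by move=> uI; rewrite /o /outp /bdpt dr //; case: (u.1.1).
  have iE u : u \in W -> (if o u < 1 then o u + 1 else o u - 1) = 4 - inp u.
    move=> uI; have := pW uI; rewrite /o /inp /bdpt dr //.
    by case: (u.1.1) => /=; case: ifP => h1 h2; lra.
  have rg u : u \in W -> 0 < outp u < 2 /\ 2 < inp u < 4.
    by move=> uI; have := pW uI; rewrite /outp /inp /bdpt dr //; case: (u.1.1) => /= h; split; lra.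
  have [|||ms Hms] := @monotone_cycle R _ W o uW W0 _ _ _ F.
  - move=> u uI; have := pW uI; rewrite /o; case: (u.1.1) => /andP[h1 h2].
      by split; [lra|rewrite lt_eqF].
    by split; [lra|rewrite gt_eqF //; lra].
  - move=> u v uI vI; rewrite !oE // => E.
    have /(congr1 fst) : (u, true) = (v, true) by apply: eval_inj.
    by [].
  - move=> u v uI vI; rewrite !iE ?mem_next // !oE // => uv.
    have nuv : u != v by apply/eqP => E; move: uv; rewrite E ltxx.
    have nI := mem_next W u; have nI' := mem_next W v.
    rewrite ltrD2l ltrN2 lt_neqAle inp_neq //=.
    have /andP[? ?] := (rg _ uI).1; have /andP[? ?] := (rg _ vI).1.
    have /andP[? ?] : 2 < inp (next W u) < 4 by apply: (rg _ _).2; rewrite mem_next.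
    have /andP[? ?] : 2 < inp (next W v) < 4 by apply: (rg _ _).2; rewrite mem_next.
    exact: key1 (gp_unlinked gW uI vI nuv) uv _ _ _ _.
  exists (Invert :: ms) => U V dU dV /=; rewrite -Hms ?SL2_invP // /word; congr (\tr _).
  apply: eq_big_seq => u uI; have := pW uI; rewrite /o /letter dr //.
  by case: (u.1.1) => /andP[h1 h2] /=; rewrite ?h2 // ltNge (_ : 1 <= _) //; lra.
pose o (u : crossing (R := R)) := if u.1.1 then 1 - u.2 else 2 - u.2.
have dr u : u \in W -> u.1.2 = ~~ u.1.1 by move=> /cx; case: (u.1.1); case: (u.1.2).
have oE u : u \in W -> o u = outp u - 2.
  by move=> uI; rewrite /o /outp /bdpt dr //; case: (u.1.1) => /=; lra.
have iE u : u \in W -> (if o u < 1 then o u + 1 else o u - 1) = 2 - inp u.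
  move=> uI; have := pW uI; rewrite /o /inp /bdpt dr //.
  by case: (u.1.1) => /=; case: ifP => h1 h2; lra.
have rg u : u \in W -> 2 < outp u < 4 /\ 0 < inp u < 2.
  by move=> uI; have := pW uI; rewrite /outp /inp /bdpt dr //; case: (u.1.1) => /= h; split; lra.
have [|||ms Hms] := @monotone_cycle R _ W o uW W0 _ _ _ F.
- move=> u uI; have := pW uI; rewrite /o; case: (u.1.1) => /andP[h1 h2].
    by split; [lra|rewrite lt_eqF //; lra].
  by split; [lra|rewrite gt_eqF //; lra].
- move=> u v uI vI; rewrite !oE // => /addIr E.
  have /(congr1 fst) : (u, true) = (v, true) by apply: eval_inj.
  by [].
- move=> u v uI vI; rewrite !iE ?mem_next // !oE // ltrD2r => uv.
  have nuv : u != v by apply/eqP => E; move: uv; rewrite E ltxx.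
  rewrite ltrD2l ltrN2 lt_neqAle inp_neq //=.
  have /andP[? ?] := (rg _ uI).1; have /andP[? ?] := (rg _ vI).1.
  have /andP[? ?] : 0 < inp (next W u) < 2 by apply: (rg _ _).2; rewrite mem_next.
  have /andP[? ?] : 0 < inp (next W v) < 2 by apply: (rg _ _).2; rewrite mem_next.
  exact: key2 (gp_unlinked gW uI vI nuv) uv _ _ _ _.
exists [:: Swap, Invert, Swap & ms] => U V dU dV /=; rewrite -Hms ?SL2_invP // /word; congr (\tr _).
apply: eq_big_seq => u uI; have := pW uI; rewrite /o /letter dr //.
case: (u.1.1) => /andP[h1 h2] /=; first by rewrite (_ : _ < 1) //; lra.
by rewrite ltNge (_ : 1 <= _) //; lra.
Qed.

Lemma reduced_rising (F : fieldType) : W != [::] -> chords ne = 0%N ->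
  exists ms, forall U V : 'M[F]_2, \det U = 1 -> \det V = 1 ->
    \tr (word U V W) = \tr (act ms (U, V)).1.
Proof.
move=> W0 c0; have [_ E1] := corner_counts; have c1 : chords sw = 0%N by rewrite -E1.
have cst : {in W &, forall u v, u.1.2 = v.1.2}.
  apply: (next_const (f := fun u : crossing (R := R) => u.1.2)) => // u uI.
  have := chord_no c0 uI; have := chord_no c1 uI; have := redP uI; rewrite /ne /sw.
  by case: (u.1.1); case: (u.1.2); case: ((next W u).1.1); case: ((next W u).1.2).
clear c0 c1 E1; have [x xI] : exists x, x \in W by case: (W) W0 => // x s _; exists x; rewrite mem_head.
have dr u : u \in W -> u.1.2 = x.1.2 by move=> uI; apply: cst.
case dx : (x.1.2) dr => dr.
  pose o (u : crossing (R := R)) := if u.1.1 then 1 + u.2 else 1 - u.2.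
  have iE u : u \in W -> (if o u < 1 then o u + 1 else o u - 1) = 3 - inp u.
    move=> uI; have := pW uI; rewrite /o /inp /bdpt dr //.
    by case: (u.1.1) => /=; case: ifP => h1 h2; lra.
  have rg u : u \in W -> 1 < inp u < 3.
    by move=> uI; have := pW uI; rewrite /inp /bdpt dr //; case: (u.1.1) => /= h; lra.
  have [|||ms Hms] := @monotone_cycle R _ W o uW W0 _ _ _ F.
  - move=> u uI; have := pW uI; rewrite /o; case: (u.1.1) => /andP[h1 h2].
      by split; [lra|rewrite gt_eqF //; lra].
    by split; [lra|rewrite lt_eqF //; lra].
  - move=> u v uI vI E; have h1 := pW uI; have h2 := pW vI.
    have [a1 a2] : u.1.1 = v.1.1 /\ u.2 = v.2.
      by move: E h1 h2; rewrite /o; case: (u.1.1); case: (v.1.1) => E /andP[? ?] /andP[? ?];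
        [by split=> //; lra|by exfalso; lra|by exfalso; lra|by split=> //; lra].
    exact: (gp_inj gW).
  - move=> u v uI vI uv; rewrite !iE ?mem_next //.
    have nuv : u != v by apply/eqP => E; move: uv; rewrite E ltxx.
    rewrite ltrD2l ltrN2 lt_neqAle inp_neq //=.
    apply: key3 (gp_unlinked gW uI vI nuv) _ _ _; try by apply: rg; rewrite mem_next.
    have h1 := pW uI; have h2 := pW vI; move: uv.
    rewrite /o /outp /bdpt !dr //; case: (u.1.1); case: (v.1.1) => uv.
    + by constructor 1; lra.
    + by exfalso; lra.
    + by constructor 3; lra.
    + by constructor 2; lra.
  exists (Swap :: ms) => U V dU dV /=; rewrite -Hms // /word; congr (\tr _).
  apply: eq_big_seq => u uI; have := pW uI; rewrite /o /letter dr //.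
  case: (u.1.1) => /andP[h1 h2] /=; last by rewrite (_ : _ < 1) //; lra.
  by rewrite ltNge (_ : 1 <= _) //; lra.
pose o (u : crossing (R := R)) := if u.1.1 then 2 - u.2 else u.2.
have oE u : u \in W -> o u = outp u - 1.
  by move=> uI; rewrite /o /outp /bdpt dr //; case: (u.1.1) => /=; lra.
have iE u : u \in W -> (if o u < 1 then o u + 1 else o u - 1) = if u.1.1 then 1 - u.2 else 1 + u.2.
  move=> uI; have := pW uI; rewrite /o.
  by case: (u.1.1) => /=; case: ifP => h1 h2; lra.
have rg u : u \in W -> 1 < outp u < 3.
  by move=> uI; have := pW uI; rewrite /outp /bdpt dr //; case: (u.1.1) => /= h; lra.
have rgi u : u \in W -> inp u < 1 \/ 3 < inp u.
  by move=> uI; have := pW uI; rewrite /inp /bdpt dr //; case: (u.1.1) => /= h; [left|right]; lra.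
have [|||ms Hms] := @monotone_cycle R _ W o uW W0 _ _ _ F.
- move=> u uI; have := pW uI; rewrite /o; case: (u.1.1) => /andP[h1 h2].
    by split; [lra|rewrite gt_eqF //; lra].
  by split; [lra|rewrite lt_eqF //; lra].
- move=> u v uI vI; rewrite !oE // => /addIr E.
  have /(congr1 fst) : (u, true) = (v, true) by apply: eval_inj.
  by [].
- move=> u v uI vI; rewrite !iE ?mem_next // !oE // ltrD2r => uv.
  have nuv : u != v by apply/eqP => E; move: uv; rewrite E ltxx.
  have nI : next W u \in W by rewrite mem_next.
  have nI' : next W v \in W by rewrite mem_next.
  have := inp_neq uI vI nuv.
  have := key4 (gp_unlinked gW uI vI nuv) uv (rg _ uI) (rg _ vI) (rgi _ nI) (rgi _ nI').
  have := pW nI; have := pW nI'; rewrite /inp /bdpt !dr //.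
  move: ((next W u).2) ((next W v).2) => a b.
  case: ((next W u).1.1); case: ((next W v).1.1) => /= /andP[? ?] /andP[? ?] [[? ?]|[? ?]] nab;
    try lra; rewrite lt_neqAle; apply/andP; split; try lra;
    apply/eqP => E; move/eqP: nab; apply; lra.
exists [:: Invert, Swap, Invert & ms] => U V dU dV /=; rewrite -Hms ?SL2_invP // /word; congr (\tr _).
apply: eq_big_seq => u uI; have := pW uI; rewrite /o /letter dr //.
case: (u.1.1) => /andP[h1 h2] /=; last by rewrite h2.
by rewrite ltNge (_ : 1 <= _) //; lra.
Qed.

Lemma reduced_word (F : fieldType) : W != [::] ->
  (forall U V : 'M[F]_2, \det U = 1 -> \det V = 1 -> \tr (word U V W) = \tr (U * V * U^-1 * V^-1)) \/
  exists ms, forall U V : 'M[F]_2, \det U = 1 -> \det V = 1 ->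
    \tr (word U V W) = \tr (act ms (U, V)).1.
Proof.
move=> W0; have [c1|c1] := eqVneq (chords nw) 0%N; first by right; apply: reduced_falling.
have [c2|c2] := eqVneq (chords ne) 0%N; first by right; apply: reduced_rising.
by left=> U V dU dV; apply: reduced_peripheral.
Qed.

End Reduced.

Theorem pattern_word (R : realType) (F : fieldType) (W : seq (crossing (R := R))) : good_pattern W ->
  [\/ forall U V : 'M[F]_2, \det U = 1 -> \det V = 1 -> \tr (word U V W) = 2,
      forall U V : 'M[F]_2, \det U = 1 -> \det V = 1 -> \tr (word U V W) = \tr (U * V * U^-1 * V^-1) |
      exists ms, forall U V : 'M[F]_2, \det U = 1 -> \det V = 1 ->
        \tr (word U V W) = \tr (act ms (U, V)).1].
Proof.
have [n] := ubnP (size W); elim: n W => // n IH W; rewrite ltnS => Wn gW.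
have [->|W0] := eqVneq W [::].
  by constructor 1 => U V _ _; rewrite /word big_nil mxtrace1.
have [hs|nhs] := boolP (has (same_side W) W); last first.
  by have [h|h] := reduced_word gW nhs F W0; [constructor 2|constructor 3].
have [W' [gW' sW' eW]] := reduce_pattern gW hs.
case: (IH W' (leq_trans sW' Wn) gW') => [h|h|[ms h]]; [constructor 1|constructor 2|constructor 3; exists ms];
  by move=> U V dU dV; rewrite eW // h.
Qed.

(** * Parallel transport on the punctured torus *)

Section Transport.
Context {R : realType}.
Implicit Types (g h : R -> R * R) (a b c t r : R) (p q z v : R * R).

Definition lattice p : bool := (p.1 \is a Num.int) && (p.2 \is a Num.int).
Definition offlat p : Prop := ~~ lattice p.
Definition lpath g := continuous g /\ forall t, offlat (g t).

(* Parallel transport of a flat connection on the punctured torus, along curves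
   in its cover R^2 minus Z^2. *)
Record transport (F : fieldType) (N : (R -> R * R) -> R -> R -> 'M[F]_2) : Prop := Transport {
  tp_det : forall g a b, lpath g -> \det (N g a b) = 1;
  tp_mul : forall g a b c, lpath g -> N g a b * N g b c = N g a c;
  tp_aff : forall g a b, lpath g -> N g a b = N (fun t => g (a + t * (b - a))) 0 1;
  tp_hom : forall G : R * R -> R * R, continuous G -> (forall p, offlat (G p)) ->
    (forall s, G (s, 0) = G (0, 0)) -> (forall s, G (s, 1) = G (0, 1)) ->
    N (fun t => G (0, t)) 0 1 = N (fun t => G (1, t)) 0 1;
  tp_shift : forall g a b v, lpath g -> lattice v ->
    N (fun t => ((g t).1 + v.1, (g t).2 + v.2)) a b = N g a b }.

Definition mix r p q : R * R := ((1 - r) * p.1 + r * q.1, (1 - r) * p.2 + r * q.2).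
Definition seg p q t : R * R := mix (kap t) p q.

Lemma mix0 p q : mix 0 p q = p.
Proof. by rewrite /mix subr0 !mul1r !mul0r !addr0 -surjective_pairing. Qed.
Lemma mix1 p q : mix 1 p q = q.
Proof. by rewrite /mix subrr !mul0r !mul1r !add0r -surjective_pairing. Qed.
Lemma mixxx r p : mix r p p = p.
Proof. by rewrite /mix -!mulrDl subrK !mul1r -surjective_pairing. Qed.
Lemma mixC r p q : mix r p q = mix (1 - r) q p.
Proof. by rewrite /mix; congr pair; ring. Qed.
Lemma seg0 p q : seg p q 0 = p. Proof. by rewrite /seg kap0 // mix0. Qed.
Lemma seg1 p q : seg p q 1 = q. Proof. by rewrite /seg kap1 // mix1. Qed.

Lemma ct_seg p q : continuous (seg p q).
Proof. by rewrite /seg /mix; ct. Qed.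

Lemma seg_lpath p q : (forall r, 0 <= r <= 1 -> offlat (mix r p q)) -> lpath (seg p q).
Proof. by move=> H; split; [exact: ct_seg|move=> t; apply: H; exact: kap_in]. Qed.

Section Derived.
Context {F : fieldType} {N : (R -> R * R) -> R -> R -> 'M[F]_2}.
Hypothesis tN : transport N.

Lemma tp_unit g a b : lpath g -> N g a b \is a GRing.unit.
Proof. by move=> lg; apply: SL2_unit; exact: (tp_det tN). Qed.

Lemma tp_id g a : lpath g -> N g a a = 1.
Proof.
move=> lg; apply: (mulrI (tp_unit a a lg)).
by rewrite (tp_mul tN) // mulr1.
Qed.

Lemma tp_rev g a b : lpath g -> N g b a = (N g a b)^-1.
Proof. by move=> lg; apply: inv_uniq; rewrite (tp_mul tN) // tp_id. Qed.

Lemma tp_kap g : lpath g -> N g 0 1 = N (fun t => g (kap t)) 0 1.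
Proof.
move=> [cg og].
pose G (p : R * R) := g ((1 - kap p.1) * p.2 + kap p.1 * kap p.2).
transitivity (N (fun t => G (0, t)) 0 1).
  by congr (N _ 0 1); apply: funext => t; rewrite /G /= kap0 // subr0 mul1r mul0r addr0.
rewrite (tp_hom tN).
- by congr (N _ 0 1); apply: funext => t; rewrite /G /= kap1 // subrr mul0r add0r mul1r.
- by rewrite /G; ct.
- by move=> p; exact: og.
- by move=> s; rewrite /G /= (kap0 (lexx 0)) !mulr0 addr0.
- by move=> s; rewrite /G /= (kap1 (lexx 1)) !mulr1 !subrK.
Qed.

Lemma lpath_comp g (f : R -> R) : continuous f -> lpath g -> lpath (fun t => g (f t)).
Proof. by move=> cf [cg og]; split=> [|t]; [ct|exact: og]. Qed.

Lemma tp_ext g h a b : a <= b -> lpath g -> lpath h -> (forall t, a <= t <= b -> g t = h t) ->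
  N g a b = N h a b.
Proof.
move=> ab lg lh gh.
have cl : continuous (fun t => a + t * (b - a)) by ct.
rewrite (tp_aff tN) // (tp_aff tN a b lh) tp_kap ?(tp_kap (lpath_comp cl lh)); last exact: lpath_comp.
congr (N _ 0 1); apply: funext => t; apply: gh; have := kap_in t; nra.
Qed.

Lemma tp_convex (K : R * R -> R * R) (f k : R -> R * R) a b a' b' :
  continuous K -> (forall p, offlat (K p)) -> continuous f -> continuous k ->
  f a = k a' -> f b = k b' -> N (fun t => K (f t)) a b = N (fun t => K (k t)) a' b'.
Proof.
move=> cK oK cf ck ha hb.
have lK (l : R -> R * R) : continuous l -> lpath (fun t => K (l t)).
  by move=> cl; split=> [|t]; [ct|exact: oK].
rewrite (tp_aff tN) ?(tp_aff tN a' b' (lK _ ck)); last exact: lK.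
have la : lpath (fun t => K (f (a + t * (b - a)))) by apply: lK; ct.
have lb : lpath (fun t => K (k (a' + t * (b' - a')))) by apply: lK; ct.
rewrite (tp_kap la) (tp_kap lb).
pose G (p : R * R) := K (mix (kap p.1) (f (a + kap p.2 * (b - a))) (k (a' + kap p.2 * (b' - a')))).
have -> : (fun t => K (f (a + kap t * (b - a)))) = fun t => G (0, t).
  by apply: funext => t; rewrite /G /= (kap0 (lexx 0)) mix0.
have -> : (fun t => K (k (a' + kap t * (b' - a')))) = fun t => G (1, t).
  by apply: funext => t; rewrite /G /= (kap1 (lexx 1)) mix1.
apply: (tp_hom tN) => //.
- rewrite /G /mix; ct.
- by move=> p; exact: oK.
- by move=> s; rewrite /G /= (kap0 (lexx 0)) !mul0r !addr0 ha !mixxx.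
- by move=> s; rewrite /G /= (kap1 (lexx 1)) !mul1r ![_ + (_ - _)]addrC !subrK hb !mixxx.
Qed.

Lemma tp_const p : offlat p -> N (fun _ => p) 0 1 = 1.
Proof.
move=> op; have lp : lpath (fun _ : R => p) by split=> [|//]; exact: ct_cst.
rewrite -(tp_id 0 lp).
by apply: (@tp_convex (fun _ => p) (fun _ => p) (fun _ => p)) => //; exact: ct_cst.
Qed.

Lemma tp_square (K : R * R -> R * R) : continuous K -> (forall p, offlat (K p)) ->
  N (fun t => K (t, 0)) 0 1 =
  N (fun t => K (0, t)) 0 1 * N (fun t => K (t, 1)) 0 1 * (N (fun t => K (1, t)) 0 1)^-1.
Proof.
move=> cK oK.
have lK (l : R -> R * R) : continuous l -> lpath (fun t => K (l t)).
  by move=> cl; split=> [|t]; [ct|exact: oK].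
have c3 : continuous (fun t : R => (kap (t - 1), kap t - kap (t - 2))) by ct.
have z t : t <= 0 -> kap t = 0 by exact: kap0.
have o t : 1 <= t -> kap t = 1 by exact: kap1.
have e0 : (kap (0 - 1), kap 0 - kap (0 - 2)) = (0, 0) :> R * R.
  by rewrite (z (0 - 1)) ?(z (0 - 2)) ?(z 0) ?subr0 //; lra.
have e1 : (kap (1 - 1), kap 1 - kap (1 - 2)) = (0, 1) :> R * R.
  by rewrite (z (1 - 1)) ?(z (1 - 2)) ?(o 1) ?subr0 //; lra.
have e2 : (kap (2 - 1), kap 2 - kap (2 - 2)) = (1, 1) :> R * R.
  by rewrite (o (2 - 1)) ?(z (2 - 2)) ?(o 2) ?subr0 //; lra.
have e3 : (kap (3 - 1), kap 3 - kap (3 - 2)) = (1, 0) :> R * R.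
  by rewrite (o (3 - 1)) ?(o (3 - 2)) ?(o 3) ?subrr //; lra.
have c1 (x : R) : continuous (fun t : R => (t, x)) by ct.
have c2 (x : R) : continuous (fun t : R => (x, t)) by ct.
rewrite (@tp_convex K (fun t => (t, 0)) (fun t => (kap (t - 1), kap t - kap (t - 2))) 0 1 0 3) //.
rewrite -(tp_mul tN 0 2 3 (lK _ c3)) -(tp_mul tN 0 1 2 (lK _ c3)).
rewrite -tp_rev; last exact: lK.
congr (_ * _ * _); apply: tp_convex => //.
Qed.

Lemma seg_rev p q t : seg p q (1 - t) = seg q p t.
Proof.
rewrite /seg /mix; have -> : kap (1 - t) = 1 - kap t.
  case: (leP t 0) => t0; first by rewrite kap1 ?kap0 ?subr0 //; lra.
  case: (leP t 1) => t1; first by rewrite !kap_id //; lra.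
  by rewrite kap0 ?kap1 ?subrr //; lra.
by congr pair; ring.
Qed.

Lemma tp_seg_rev p q : lpath (seg p q) -> N (seg q p) 0 1 = (N (seg p q) 0 1)^-1.
Proof.
move=> lp; rewrite -tp_rev // (tp_aff tN 1 0 lp); congr (N _ 0 1); apply: funext => t.
by rewrite -seg_rev; congr seg; ring.
Qed.

Lemma tp_star g a b z : a <= b -> lpath g ->
  (forall t r, a <= t <= b -> 0 <= r <= 1 -> offlat (mix r z (g t))) ->
  N (seg z (g a)) 0 1 * N g a b = N (seg z (g b)) 0 1.
Proof.
move=> ab lg st; have [cg og] := lg.
pose K (p : R * R) := mix (kap p.2) (g (a + kap p.1 * (b - a))) z.
have cK : continuous K by rewrite /K /mix; ct.
have inab t : a <= a + kap t * (b - a) <= b by have := kap_in t; nra.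
have oK p : offlat (K p).
  by rewrite /K mixC; apply: st => //; have := kap_in p.2; lra.
have aaa : a <= a <= b by rewrite lexx.
have bbb : a <= b <= b by rewrite lexx andbT.
have ls t : a <= t <= b -> lpath (seg z (g t)) by move=> tab; apply: seg_lpath => r; apply: st.
have E1 : N g a b = N (fun t => K (t, 0)) 0 1.
  rewrite (tp_aff tN) // tp_kap; last by apply: lpath_comp => //; ct.
  by congr (N _ 0 1); apply: funext => t; rewrite /K /= (kap0 (lexx 0)) mix0.
have E2 : N (fun t => K (0, t)) 0 1 = (N (seg z (g a)) 0 1)^-1.
  rewrite -tp_seg_rev; last exact: ls.
  by congr (N _ 0 1); apply: funext => t; rewrite /K /= (kap0 (lexx 0)) mul0r addr0.
have E3 : N (fun t => K (1, t)) 0 1 = (N (seg z (g b)) 0 1)^-1.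
  rewrite -tp_seg_rev; last exact: ls.
  by congr (N _ 0 1); apply: funext => t; rewrite /K /= (kap1 (lexx 1)) mul1r addrC subrK.
have E4 : N (fun t => K (t, 1)) 0 1 = 1.
  rewrite -(@tp_const z); last by have := st a 0 aaa; rewrite mix0; apply; rewrite lexx ler01.
  by congr (N _ 0 1); apply: funext => t; rewrite /K /= (kap1 (lexx 1)) mix1.
rewrite E1 tp_square // E2 E3 E4 mulr1 invrK mulrA divrr ?mul1r //.
by apply: tp_unit; exact: ls.
Qed.

Lemma tp_triangle p q z : (forall t r, 0 <= t <= 1 -> 0 <= r <= 1 -> offlat (mix r z (mix t p q))) ->
  N (seg z p) 0 1 * N (seg p q) 0 1 = N (seg z q) 0 1.
Proof.
move=> H; have := @tp_star (seg p q) 0 1 z ler01; rewrite seg0 seg1; apply.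
  apply: seg_lpath => r r01; have := H r 1 r01; rewrite mix1; apply; by rewrite lexx ler01.
by move=> t r t01 r01; apply: H => //; exact: kap_in.
Qed.

Lemma tp_seg_shift p q v : lattice v -> lpath (seg p q) ->
  N (seg (p.1 + v.1, p.2 + v.2) (q.1 + v.1, q.2 + v.2)) 0 1 = N (seg p q) 0 1.
Proof.
move=> lv lp; rewrite -[RHS](tp_shift tN _ _ lp lv); congr (N _ 0 1); apply: funext => t.
by rewrite /seg /mix /=; congr pair; ring.
Qed.

End Derived.
End Transport.

Section TorusPoint.
Context {R : realType}.
Implicit Types (x y t r : R) (p q z v : R * R).

Definition circ x : R * R := (cos (2 * pi * x), sin (2 * pi * x)).
Definition torus_pt p : (R * R) * (R * R) := (circ p.1, circ p.2).

Lemma ct_circ : continuous circ.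
Proof.
have c (f : R -> R) : continuous f -> continuous (fun x => f (2 * pi * x)).
  by move=> cf; apply: (ct_comp cf); ct.
by apply: ct_pair; apply: c; [exact: continuous_cos|exact: continuous_sin].
Qed.

Lemma ct_torus_pt (T : topologicalType) (f : T -> R * R) : continuous f -> continuous (fun u => torus_pt (f u)).
Proof.
move=> cf; apply: ct_pair; apply: (ct_comp ct_circ); ct.
Qed.

Lemma circ_int x (n : int) : circ (x + n%:~R) = circ x.
Proof.
have S y : circ (y + 1) = circ y.
  rewrite /circ; have -> : 2 * pi * (y + 1) = 2 * pi * y + pi *+ 2 by rewrite -mulr_natl; ring.
  by rewrite cosD2pi sinD2pi.
have P (k : nat) y : circ (y + k%:R) = circ y.
  elim: k y => [|k IH] y; first by rewrite addr0.
  by rewrite -natr1 addrA S IH.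
case: n => k; first exact: P.
by rewrite NegzE mulrNz -[LHS](P k.+1) -pmulrn subrK.
Qed.

Lemma circ1 x : circ x = (1, 0) -> x \is a Num.int.
Proof.
rewrite -[x](subrK (Num.floor x)%:~R) circ_int rpredDr ?intr_int //.
have /andP[f0 f1] := floor_itv x.
set y := x - _ => -[cy _].
have y0 : 0 <= y by rewrite subr_ge0.
have y1 : y < 1 by move: f1; rewrite intrD /y; lra.
have p0 : 0 < pi :> R := pi_gt0 R.
have i0 : (0 : R) \in `[0, pi] by rewrite in_itv /= lexx ltW.
case: (leP y (1 / 2)) => y2.
  have : 2 * pi * y = 0.
    by apply: cos_inj; rewrite ?cy ?cos0 // in_itv /=; nra.
  by move/eqP; rewrite !mulf_eq0 pnatr_eq0 (gt_eqF p0) /= => /eqP ->; rewrite rpred0.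
have : 2 * pi * (1 - y) = 0.
  apply: cos_inj => //; first by rewrite in_itv /=; nra.
  rewrite cos0 -[RHS]cy -cosN.
  have -> : - (2 * pi * (1 - y)) = 2 * pi * (y + (-1)%:~R) by rewrite mulrNz; ring.
  by have [-> _] := circ_int y (-1).
by move/eqP; rewrite !mulf_eq0 pnatr_eq0 (gt_eqF p0) /= subr_eq0 => /eqP E; rewrite -E ltxx in y1.
Qed.

Lemma circ_eq x y : circ x = circ y -> x - y \is a Num.int.
Proof.
move=> [ec es]; apply: circ1; rewrite /circ mulrBr cosB sinB ec es -!expr2 cos2Dsin2.
by rewrite mulrC subrr.
Qed.

Lemma circ_lattice x y : x - y \is a Num.int -> circ x = circ y.
Proof. by move=> /intrP[n E]; rewrite -(circ_int y n) -E addrC subrK. Qed.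

Lemma circ_circle x : circle R (circ x).
Proof. by rewrite /circle /= cos2Dsin2. Qed.

Lemma torus_pt_eq p q : torus_pt p = torus_pt q <-> lattice (p.1 - q.1, p.2 - q.2).
Proof.
split=> [|/andP[/= h1 h2]]; last by rewrite /torus_pt (circ_lattice h1) (circ_lattice h2).
rewrite /torus_pt => E; have e1 := congr1 fst E; have e2 := congr1 snd E.
by rewrite /lattice /= !circ_eq.
Qed.

Lemma torus_pt_shift p v : lattice v -> torus_pt (p.1 + v.1, p.2 + v.2) = torus_pt p.
Proof.
by move=> lv; apply/torus_pt_eq; rewrite /lattice /= ![_ + _ - _]addrAC !subrr !add0r.
Qed.

Lemma circ0 : circ 0 = (1, 0).
Proof. by rewrite /circ mulr0 cos0 sin0. Qed.

Lemma torus_pt_puncture p : torus_pt p = puncture R <-> lattice p.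
Proof.
have -> : puncture R = torus_pt (0, 0) by rewrite /torus_pt /= circ0.
by rewrite torus_pt_eq /= !subr0 -surjective_pairing.
Qed.

Lemma ptorus_torus_pt p : offlat p -> ptorus R (torus_pt p).
Proof.
move=> op; split; first by split; exact: circ_circle.
by move/torus_pt_puncture; apply/negP.
Qed.

Lemma circ_half x : circ (1 / 2 + x) = (- cos (2 * pi * x), - sin (2 * pi * x)).
Proof.
rewrite /circ; have -> : 2 * pi * (1 / 2 + x) = 2 * pi * x + pi by field.
by rewrite cosDpi sinDpi.
Qed.

Definition cell_centre p : R * R := ((Num.floor p.1)%:~R + 1 / 2, (Num.floor p.2)%:~R + 1 / 2).
Definition zz : R * R := (1 / 2, 1 / 2).

Lemma torus_pt_zz : torus_pt zz = basepoint R.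
Proof. by rewrite /torus_pt /zz /= -[1 / 2]addr0 circ_half mulr0 cos0 sin0 oppr0. Qed.

Lemma torus_pt_cell_centre p : torus_pt (cell_centre p) = basepoint R.
Proof.
rewrite -torus_pt_zz; apply/torus_pt_eq; rewrite /cell_centre /zz /=.
by rewrite !addrK /lattice /= !intr_int.
Qed.

Lemma cell_centre_base p : torus_pt p = basepoint R -> cell_centre p = p.
Proof.
rewrite -torus_pt_zz => /torus_pt_eq /andP[/= /intrP[m hm] /intrP[n hn]].
have f (x : R) (k : int) : x - 1 / 2 = k%:~R -> (Num.floor x)%:~R + 1 / 2 = x.
  move=> h; rewrite (@floor_def _ _ k) ?intrD; first by lra.
  by apply/andP; split; lra.
by rewrite /cell_centre (f _ _ hm) (f _ _ hn) -surjective_pairing.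
Qed.

Lemma mix_cell_centre p r : offlat p -> 0 <= r <= 1 -> offlat (mix r (cell_centre p) p).
Proof.
move=> op r01; apply/negP => /andP[/= /intrP[m hm] /intrP[n hn]].
have key (x : R) (k : int) : (1 - r) * ((Num.floor x)%:~R + 1 / 2) + r * x = k%:~R -> x = (Num.floor x)%:~R.
  have /andP[f0 f1] := floor_itv x; rewrite intrD in f1 => h.
  have k1 : (Num.floor x < k + 1)%R by rewrite -(ltr_int R) intrD; nra.
  have k2 : (k < Num.floor x + 1)%R by rewrite -(ltr_int R) intrD; nra.
  have E : k = Num.floor x by lia.
  rewrite E in h; nra.
move: op; rewrite /offlat /lattice.
by rewrite (key _ _ hm) (key _ _ hn) !intr_int.
Qed.

Lemma mix_cell_centreC p r : offlat p -> 0 <= r <= 1 -> offlat (mix r p (cell_centre p)).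
Proof. by move=> op r01; rewrite mixC; apply: mix_cell_centre => //; lra. Qed.

Lemma cell_centre_shift p v : lattice v -> cell_centre (p.1 + v.1, p.2 + v.2) = ((cell_centre p).1 + v.1, (cell_centre p).2 + v.2).
Proof.
move=> /andP[h1 h2]; rewrite /cell_centre /= !floorDrz // !intrD !(floorK h1) !(floorK h2).
by congr pair; ring.
Qed.

Lemma loop_torus_pt (h : R -> R * R) : continuous h -> (forall t, offlat (h t)) ->
  torus_pt (h 0) = basepoint R -> torus_pt (h 1) = basepoint R -> is_loop (fun t => torus_pt (h t)).
Proof.
move=> ch oh h0 h1; split=> //; split; last by rewrite h0 h1.
  by apply: continuous_subspaceT; exact: ct_torus_pt.
by move=> t _; exact: ptorus_torus_pt.
Qed.

Lemma loop_homotopic_torus_pt (H : R * R -> R * R) (c d : curve R) : continuous H -> (forall p, offlat (H p)) ->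
  (forall s, torus_pt (H (s, 0)) = basepoint R) -> (forall s, torus_pt (H (s, 1)) = basepoint R) ->
  (forall t, 0 <= t <= 1 -> c t = torus_pt (H (0, t))) -> (forall t, 0 <= t <= 1 -> d t = torus_pt (H (1, t))) ->
  loop_homotopic c d.
Proof.
move=> cH oH H0 H1 hc hd; exists (fun p => torus_pt (H p)); split; last by move=> s _; split.
split.
- by apply: continuous_subspaceT; exact: ct_torus_pt.
- by move=> s t _ _; exact: ptorus_torus_pt.
- by move=> t; rewrite in_itv /= => /hc.
- by move=> t; rewrite in_itv /= => /hd.
Qed.

End TorusPoint.

Ltac kz x := rewrite (@kap0 _ x); last by lra.
Ltac ko x := rewrite (@kap1 _ x); last by lra.

Arguments cell_centre : simpl never.

Section Holonomy.
Context {R : realType}.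
Variable rho : representation R.
Implicit Types (g h : R -> R * R) (a b c t r s : R) (p q z v : R * R).

(* The path [g] on [a, b], preceded and followed by the segments that join its
   ends to the centres of their squares; each of the three parts takes unit time. *)
Definition hat g a b t : R * R :=
  let p := g a in let q := g b in let m := g (a + kap (t - 1) * (b - a)) in
  ((cell_centre p).1 + kap t * (p.1 - (cell_centre p).1) + (m.1 - p.1) + kap (t - 2) * ((cell_centre q).1 - q.1),
   (cell_centre p).2 + kap t * (p.2 - (cell_centre p).2) + (m.2 - p.2) + kap (t - 2) * ((cell_centre q).2 - q.2)).

Definition holonomy g a b : 'M[R[i]]_2 := rho (fun t => torus_pt (hat g a b (3 * t))).

Lemma hat_cases g a b t :
  [\/ t <= 1 /\ hat g a b t = mix (kap t) (cell_centre (g a)) (g a),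
      1 <= t <= 2 /\ hat g a b t = g (a + kap (t - 1) * (b - a)) |
      2 <= t /\ hat g a b t = mix (kap (t - 2)) (g b) (cell_centre (g b))].
Proof.
rewrite /hat /mix; case: (leP t 1) => t1.
  constructor 1; split=> //; rewrite [kap (t - 1)]kap0 ?[kap (t - 2)]kap0; [|lra|lra].
  by rewrite mul0r addr0; congr pair; ring.
rewrite (kap1 (ltW t1)); case: (leP t 2) => t2.
  constructor 2; split; first by rewrite ltW.
  rewrite [kap (t - 2)]kap0; last lra.
  by rewrite [RHS]surjective_pairing; congr pair; ring.
constructor 3; split; first exact: ltW.
rewrite [kap (t - 1)]kap1; last by lra.
rewrite (_ : a + 1 * (b - a) = b); last by ring.
by congr pair; ring.
Qed.

Lemma hat_offlat g a b t : lpath g -> offlat (hat g a b t).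
Proof.
move=> [cg og]; case: (hat_cases g a b t) => [] [_ ->].
- by apply: mix_cell_centre => //; exact: kap_in.
- exact: og.
- by apply: mix_cell_centreC => //; exact: kap_in.
Qed.

Lemma hat_start g a b t : t <= 0 -> hat g a b t = cell_centre (g a).
Proof.
move=> t0; case: (hat_cases g a b t) => [] [tt ->]; [|by exfalso; lra|by exfalso; lra].
by rewrite kap0 // mix0.
Qed.

Lemma hat_end g a b t : 3 <= t -> hat g a b t = cell_centre (g b).
Proof.
move=> t3; case: (hat_cases g a b t) => [] [tt ->]; [by exfalso; lra|by exfalso; lra|].
by rewrite kap1 ?mix1 //; lra.
Qed.

Lemma ct_hat g a b : continuous g -> continuous (hat g a b).
Proof. by move=> cg; rewrite /hat; ct. Qed.

Lemma loop_hat g a b : lpath g -> is_loop (fun t => torus_pt (hat g a b (3 * t))).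
Proof.
move=> lg; have ch := @ct_hat g a b lg.1; apply: (@loop_torus_pt _ (fun t => hat g a b (3 * t))).
- by apply: (@ct_comp _ _ _ (hat g a b) (fun t => 3 * t) ch); ct.
- by move=> t; apply: hat_offlat.
- by rewrite mulr0 hat_start // torus_pt_cell_centre.
- by rewrite mulr1 hat_end // torus_pt_cell_centre.
Qed.

Lemma rho_torus_pt (H : R * R -> R * R) (c d : curve R) : continuous H -> (forall p, offlat (H p)) ->
  (forall s, torus_pt (H (s, 0)) = basepoint R) -> (forall s, torus_pt (H (s, 1)) = basepoint R) ->
  (forall t, 0 <= t <= 1 -> c t = torus_pt (H (0, t))) -> (forall t, 0 <= t <= 1 -> d t = torus_pt (H (1, t))) ->
  is_loop c -> is_loop d -> rho c = rho d.
Proof.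
move=> cH oH H0 H1 hc hd lc ld; apply: rep_homotopic => //.
exact: loop_homotopic_torus_pt cH oH H0 H1 hc hd.
Qed.

Lemma kap_mono t r : t <= r -> kap t <= kap r.
Proof.
move=> tr; have := kap_in t; have := kap_in r.
case: (leP r 0) => r0; first by rewrite !kap0 //; lra.
case: (leP 1 t) => t1; first by rewrite !kap1 //; lra.
case: (leP t 0) => t0; first by rewrite (kap0 t0) => /andP[].
case: (leP 1 r) => r1; first by rewrite (kap1 r1) => _ /andP[].
by rewrite !kap_id //; lra.
Qed.

Lemma holonomy_mul g a b c : lpath g -> holonomy g a b * holonomy g b c = holonomy g a c.
Proof.
move=> lg; have [cg og] := lg.
rewrite /holonomy -[_ * _]/(_ *m _) -rep_concat; try exact: loop_hat.
have lh x y := loop_hat x y lg.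
pose p := g a; pose q := g b; pose z := g c.
have [P eP] : {P | P = cell_centre (g a)} by exists (cell_centre (g a)).
have [Q eQ] : {P | P = cell_centre (g b)} by exists (cell_centre (g b)).
have [Z eZ] : {P | P = cell_centre (g c)} by exists (cell_centre (g c)).
have cP : torus_pt P = basepoint R by rewrite eP torus_pt_cell_centre.
have cZ : torus_pt Z = basepoint R by rewrite eZ torus_pt_cell_centre.
have mixP r : 0 <= r <= 1 -> offlat (mix r P p) by rewrite eP; apply: mix_cell_centre; exact: og.
have mixQ r : 0 <= r <= 1 -> offlat (mix r q Q) by rewrite eQ; apply: mix_cell_centreC; exact: og.
have mixZ r : 0 <= r <= 1 -> offlat (mix r z Z) by rewrite eZ; apply: mix_cell_centreC; exact: og.
pose m1 t := g (a + kap (6 * t - 1) * (b - a)).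
pose m2 t := g (b + kap (6 * t - 4) * (c - b)).
(* The excursion from g b to the centre of its square and back is contracted. *)
pose H (u : R * R) : R * R :=
  let t := u.2 in let e := (1 - kap u.1) * (kap (6 * t - 2) - kap (6 * t - 3)) in
  (P.1 + kap (6 * t) * (p.1 - P.1) + ((m1 t).1 - p.1)
     + e * (Q.1 - q.1) + ((m2 t).1 - q.1) + kap (6 * t - 5) * (Z.1 - z.1),
   P.2 + kap (6 * t) * (p.2 - P.2) + ((m1 t).2 - p.2)
     + e * (Q.2 - q.2) + ((m2 t).2 - q.2) + kap (6 * t - 5) * (Z.2 - z.2)).
have k0 t : t <= 0 -> kap t = 0 by exact: kap0.
have k1 t : 1 <= t -> kap t = 1 by exact: kap1.
have ma : g (a + 0 * (b - a)) = p by rewrite mul0r addr0.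
have mb : g (a + 1 * (b - a)) = q by rewrite mul1r subrKC.
have mb' : g (b + 0 * (c - b)) = q by rewrite mul0r addr0.
have mc : g (b + 1 * (c - b)) = z by rewrite mul1r subrKC.
have oH u : offlat (H u).
  case: u => s t; rewrite /H /m1 /m2 /=.
  have := kap_in s; move: (kap s) => w w01.
  case: (leP (6 * t) 1) => t1.
    kz (6 * t - 1). kz (6 * t - 2). kz (6 * t - 3). kz (6 * t - 4). kz (6 * t - 5).
    rewrite ma mb' !subrr !mulr0 !mul0r !addr0.
    have := mixP _ (kap_in (6 * t)); rewrite /mix -/p; congr offlat; congr pair; ring.
  ko (6 * t).
  case: (leP (6 * t) 2) => t2.
    kz (6 * t - 2). kz (6 * t - 3). kz (6 * t - 4). kz (6 * t - 5).
    rewrite mb' !subrr !mulr0 !mul0r !mul1r !addr0.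
    have := og (a + kap (6 * t - 1) * (b - a)); congr offlat; rewrite [LHS]surjective_pairing; congr pair; ring.
  ko (6 * t - 1). rewrite mb.
  case: (leP (6 * t) 4) => t4.
    kz (6 * t - 4). kz (6 * t - 5). rewrite mb'.
    set e := (1 - w) * _; have e01 : 0 <= e <= 1.
      rewrite /e; have := kap_in (6 * t - 2); have := kap_in (6 * t - 3).
      have := @kap_mono (6 * t - 3) (6 * t - 2); have -> : 6 * t - 3 <= 6 * t - 2 by lra.
      by move=> /(_ isT); nra.
    have := mixQ _ e01; rewrite /mix -/q; congr offlat; congr pair; ring.
  ko (6 * t - 2). ko (6 * t - 3).
  case: (leP (6 * t) 5) => t5.
    kz (6 * t - 5).
    have := og (b + kap (6 * t - 4) * (c - b)); congr offlat; rewrite [LHS]surjective_pairing; congr pair; ring.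
  ko (6 * t - 4). rewrite mc.
  have := mixZ _ (kap_in (6 * t - 5)); rewrite /mix -/z; congr offlat; congr pair; ring.
have cH : continuous H by rewrite /H /m1 /m2; ct.
have H0 s : H (s, 0) = P.
  rewrite /H /m1 /m2 /=. kz (6 * 0 : R). kz (6 * 0 - 1 : R). kz (6 * 0 - 2 : R). kz (6 * 0 - 3 : R).
  kz (6 * 0 - 4 : R). kz (6 * 0 - 5 : R). rewrite ma mb'.
  by rewrite [RHS]surjective_pairing; congr pair; ring.
have H1 s : H (s, 1) = Z.
  rewrite /H /m1 /m2 /=. ko (6 * 1 : R). ko (6 * 1 - 1 : R). ko (6 * 1 - 2 : R). ko (6 * 1 - 3 : R).
  ko (6 * 1 - 4 : R). ko (6 * 1 - 5 : R). rewrite mb mc.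
  by rewrite [RHS]surjective_pairing; congr pair; ring.
have lH1 : is_loop (fun t => torus_pt (H (1, t))).
  apply: (@loop_torus_pt _ (fun t => H (1, t))) => //; [by ct|by rewrite H0|by rewrite H1].
transitivity (rho (fun t => torus_pt (H (1, t)))).
  apply: (@rho_torus_pt H) => //.
  - by move=> s; rewrite H0.
  - by move=> s; rewrite H1.
  - move=> t t01; rewrite /concat /H /hat -eP -eQ -eZ /m1 /m2 /= (k0 0) // subr0 mul1r.
    case: (leP t 2^-1) => t2; congr torus_pt.
      have -> : 3 * (2 * t) = 6 * t by ring.
      kz (6 * t - 3). kz (6 * t - 4). kz (6 * t - 5). rewrite mb'.
      by rewrite -/p -/q; congr pair; ring.
    have -> : 3 * (2 * t - 1) = 6 * t - 3 by ring.
    have -> : 6 * t - 3 - 1 = 6 * t - 4 by ring.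
    have -> : 6 * t - 3 - 2 = 6 * t - 5 by ring.
    ko (6 * t). ko (6 * t - 1). ko (6 * t - 2). rewrite mb.
    by rewrite -/q -/z; congr pair; ring.
  - exact: is_loop_concat.
(* The time parameter is then deformed linearly to one that skips the stop at b. *)
pose tau (u : R * R) := (1 - kap u.1) * (kap (6 * u.2 - 1) * (b - a) + kap (6 * u.2 - 4) * (c - b))
   + kap u.1 * (kap ((6 * u.2 - 1) / 4) * (c - a)).
pose K (u : R * R) : R * R := let t := u.2 in
  (P.1 + kap (6 * t) * (p.1 - P.1) + ((g (a + tau u)).1 - p.1)
     + kap (6 * t - 5) * (Z.1 - z.1),
   P.2 + kap (6 * t) * (p.2 - P.2) + ((g (a + tau u)).2 - p.2)
     + kap (6 * t - 5) * (Z.2 - z.2)).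
have tau0 s t : 6 * t <= 1 -> tau (s, t) = 0.
  move=> t1; rewrite /tau /=. kz (6 * t - 1). kz (6 * t - 4). kz ((6 * t - 1) / 4). ring.
have tau1 s t : 5 <= 6 * t -> tau (s, t) = c - a.
  move=> t1; rewrite /tau /=. ko (6 * t - 1). ko (6 * t - 4). ko ((6 * t - 1) / 4). ring.
have gc : g (a + (c - a)) = z by rewrite subrKC.
have oK u : offlat (K u).
  case: u => s t; rewrite /K /=.
  case: (leP (6 * t) 1) => t1.
    rewrite tau0 // addr0. kz (6 * t - 5). rewrite -/p.
    have := mixP _ (kap_in (6 * t)); rewrite /mix -/p; congr offlat; congr pair; ring.
  ko (6 * t).
  case: (leP (6 * t) 5) => t5.
    kz (6 * t - 5).
    have := og (a + tau (s, t)); congr offlat; rewrite [LHS]surjective_pairing; congr pair; ring.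
  rewrite tau1 ?gc; last by lra.
  have := mixZ _ (kap_in (6 * t - 5)); rewrite /mix -/z; congr offlat; congr pair; ring.
have cK : continuous K by rewrite /K /tau; ct.
have K0 s : K (s, 0) = P.
  rewrite /K /= tau0; last by lra. kz (6 * 0 : R). kz (6 * 0 - 5 : R). rewrite ?addr0 -/p.
  by rewrite [RHS]surjective_pairing; congr pair; ring.
have K1 s : K (s, 1) = Z.
  rewrite /K /= tau1; last by lra. ko (6 * 1 : R). ko (6 * 1 - 5 : R). rewrite gc.
  by rewrite [RHS]surjective_pairing; congr pair; ring.
have lK1 : is_loop (fun t => torus_pt (K (1, t))).
  apply: (@loop_torus_pt _ (fun t => K (1, t))) => //; [by ct|by rewrite K0|by rewrite K1].
transitivity (rho (fun t => torus_pt (K (1, t)))).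
  apply: (@rho_torus_pt K) => //.
  - by move=> s; rewrite K0.
  - by move=> s; rewrite K1.
  - move=> t t01; congr torus_pt; rewrite /H /K /tau /m1 /m2 /= (k0 0) // (k1 1) // subrr subr0 !mul0r !mul1r !addr0.
    case: (leP (6 * t) 4) => t4.
      kz (6 * t - 4). rewrite mb' ?mul0r ?addr0. by congr pair; ring.
    ko (6 * t - 1). rewrite mb.
    have -> : a + (1 * (b - a) + kap (6 * t - 4) * (c - b)) = b + kap (6 * t - 4) * (c - b) by ring.
    by congr pair; ring.
pose u0 t := kap (6 * t) + kap ((6 * t - 1) / 4) + kap (6 * t - 5).
pose J (u : R * R) : R * R := hat g a c ((1 - kap u.1) * u0 u.2 + kap u.1 * (3 * u.2)).
have ch := @ct_hat g a c cg.
have cJ : continuous J.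
  apply: (@ct_comp _ _ _ (hat g a c) (fun u : R * R => (1 - kap u.1) * u0 u.2 + kap u.1 * (3 * u.2)) ch).
  by rewrite /u0; ct.
have u00 : u0 0 = 0.
  rewrite /u0. kz (6 * 0 : R). kz ((6 * 0 - 1) / 4 : R). kz (6 * 0 - 5 : R). ring.
have u01 : u0 1 = 3.
  rewrite /u0. ko (6 * 1 : R). ko ((6 * 1 - 1) / 4 : R). ko (6 * 1 - 5 : R). ring.
apply: (@rho_torus_pt J) => //.
- by move=> v; apply: hat_offlat.
- by move=> s; rewrite /J /= u00 !mulr0 addr0 hat_start // torus_pt_cell_centre.
- by move=> s; rewrite /J /= u01 mulr1 -mulrDl subrK mul1r hat_end // torus_pt_cell_centre.
- move=> t t01; rewrite /J /= (k0 0) // subr0 mul1r mul0r addr0; congr torus_pt.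
  rewrite /K /hat -eP -eZ /tau /= (k1 1) // subrr mul0r add0r mul1r -/p -/z.
  have [e1 e2 e3] : [/\ kap (u0 t) = kap (6 * t), kap (u0 t - 1) = kap ((6 * t - 1) / 4)
      & kap (u0 t - 2) = kap (6 * t - 5)].
    rewrite /u0; have := kap_in (6 * t); have := kap_in ((6 * t - 1) / 4); have := kap_in (6 * t - 5).
    case: (leP (6 * t) 1) => t1.
      kz ((6 * t - 1) / 4). kz (6 * t - 5). move=> _ _ h.
      by rewrite !addr0; split; [exact: kap_id|rewrite kap0 //; lra|rewrite kap0 //; lra].
    ko (6 * t).
    case: (leP (6 * t) 5) => t5.
      kz (6 * t - 5). move=> _ h _.
      move: h; set m := kap ((6 * t - 1) / 4) => h; rewrite addr0.
      have -> : 1 + m - 1 = m by ring.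
      by split; [rewrite kap1 //; lra|exact: kap_id|rewrite kap0 //; lra].
    ko ((6 * t - 1) / 4). move=> h _ _.
    split; [by rewrite k1 //; lra|by rewrite k1 //; lra|].
    have -> : 1 + 1 + kap (6 * t - 5) - 2 = kap (6 * t - 5) by ring.
    exact: kap_id (kap_in _).
  by rewrite e1 e2 e3.
- by move=> t _; rewrite /J /= (k1 1) // subrr mul0r add0r mul1r.
Qed.

Lemma holonomy_transport : transport holonomy.
Proof.
split.
- by move=> g a b lg; apply: rep_det; exact: loop_hat.
- exact: holonomy_mul.
- move=> g a b lg; rewrite /holonomy; congr (rho _); apply: funext => t; congr torus_pt; rewrite /hat.
  by rewrite !mul0r !mul1r addr0 subr0 mulr1 add0r subrKC.
- move=> G cG oG G0 G1.
  pose H (u : R * R) := hat (fun t => G (u.1, t)) 0 1 (3 * u.2).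
  have lG s : lpath (fun t => G (s, t)) by split; [ct|].
  apply: (@rho_torus_pt H).
  + pose p := G (0, 0); pose q := G (0, 1).
    have -> : H = fun u => ((cell_centre p).1 + kap (3 * u.2) * (p.1 - (cell_centre p).1)
        + ((G (u.1, 0 + kap (3 * u.2 - 1) * (1 - 0))).1 - p.1) + kap (3 * u.2 - 2) * ((cell_centre q).1 - q.1),
       (cell_centre p).2 + kap (3 * u.2) * (p.2 - (cell_centre p).2)
        + ((G (u.1, 0 + kap (3 * u.2 - 1) * (1 - 0))).2 - p.2) + kap (3 * u.2 - 2) * ((cell_centre q).2 - q.2)).
      by apply: funext => u; rewrite /H /hat G0 G1.
    by ct.
  + by move=> u; exact: (hat_offlat 0 1 (3 * u.2) (lG u.1)).
  + by move=> s; rewrite /H /= mulr0 hat_start // torus_pt_cell_centre.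
  + by move=> s; rewrite /H /= mulr1 hat_end // torus_pt_cell_centre.
  + by [].
  + by [].
  + exact: loop_hat.
  + exact: loop_hat.
- move=> g a b v lg lv; rewrite /holonomy; congr (rho _); apply: funext => t.
  rewrite -[RHS](torus_pt_shift _ lv); congr torus_pt; rewrite /hat; cbv beta zeta.
  rewrite !cell_centre_shift //; cbn [fst snd].
  by congr pair; ring.
Qed.

Lemma rho_lift (d : curve R) g : is_loop d -> lpath g ->
  (forall t, 0 <= t <= 1 -> torus_pt (g t) = d t) -> rho d = holonomy g 0 1.
Proof.
move=> ld lg gd; have [cg og] := lg.
have e01 : 0 <= (0 : R) <= 1 by rewrite lexx ler01.
have e11 : 0 <= (1 : R) <= 1 by rewrite lexx ler01.
have w0 : torus_pt (g 0) = basepoint R by rewrite gd //; case: ld.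
have w1 : torus_pt (g 1) = basepoint R by rewrite gd //; case: ld => -[_ _ <-].
pose H (u : R * R) := g ((1 - kap u.1) * u.2 + kap u.1 * kap (3 * u.2 - 1)).
apply: (@rho_torus_pt H) => //.
- by rewrite /H; ct.
- by move=> u; apply: og.
- by move=> s; rewrite /H /= [kap (3 * 0 - 1)]kap0 ?mulr0 ?addr0 //; lra.
- by move=> s; rewrite /H /= [kap (3 * 1 - 1)]kap1 ?mulr1 ?subrK //; lra.
- by move=> t t01; rewrite /H /= [kap 0]kap0 // subr0 mul1r mul0r addr0 gd.
- move=> t t01; rewrite /H /= [kap 1]kap1 // subrr mul0r add0r mul1r; congr torus_pt.
  case: (hat_cases g 0 1 (3 * t)) => -[tt ->].
  + by rewrite (cell_centre_base w0) mixxx [kap (3 * t - 1)]kap0 //; lra.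
  + by rewrite add0r subr0 mulr1.
  + by rewrite (cell_centre_base w1) mixxx [kap (3 * t - 1)]kap1 //; lra.
- exact: loop_hat.
Qed.

End Holonomy.

(** * Crossings of a curve with the lattice lines *)

Section Cells.
Context {R : realType}.
Implicit Types (p q z : R * R) (s : int * int) (l : bool * bool).

(* The letter (ax, dr) stands for leaving a cell through its right, left, top or
   bottom side; [hgt l s p] is the signed distance of p beyond that side of s. *)
Definition dv l : int * int :=
  if l.1 then (if l.2 then (1, 0) else (-1, 0)) else (if l.2 then (0, 1) else (0, -1)).

Definition sadd s s' : int * int := (s.1 + s'.1, s.2 + s'.2).

Definition hgt l s p : R :=
  if l.1 then (if l.2 then p.1 - s.1%:~R - 1 else s.1%:~R - p.1)
  else (if l.2 then p.2 - s.2%:~R - 1 else s.2%:~R - p.2).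

Definition oppl l : bool * bool := (l.1, ~~ l.2).

Definition mid s : R * R := (s.1%:~R + 1 / 2, s.2%:~R + 1 / 2).

Definition margin (d : R) p := forall m n : R, m \is a Num.int -> n \is a Num.int ->
  [\/ d <= p.1 - m, p.1 - m <= - d, d <= p.2 - n | p.2 - n <= - d].

Lemma hgt_opp l s p : hgt (oppl l) s p = - hgt l s p - 1.
Proof. by rewrite /hgt /oppl /=; case: l => [[] []] /=; rewrite ?intrD; ring. Qed.

Lemma hgt_dv l s p : hgt l (sadd s (dv l)) p = hgt l s p - 1.
Proof. by rewrite /hgt /dv /sadd; case: l => [[] []] /=; rewrite ?intrD ?mulrNz; ring. Qed.

Lemma hgt_dv_other l l' s p : l'.1 != l.1 -> hgt l' (sadd s (dv l)) p = hgt l' s p.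
Proof. by rewrite /hgt /dv /sadd; case: l => [[] []]; case: l' => [[] []] //= _; rewrite ?addr0. Qed.

Lemma hgt_shift l s s' p : hgt l (sadd s s') (p.1 + s'.1%:~R, p.2 + s'.2%:~R) = hgt l s p.
Proof. by rewrite /hgt /sadd; case: l => [[] []] /=; rewrite ?intrD; ring. Qed.

Lemma ct_hgt l s : continuous (hgt l s).
Proof. by rewrite /hgt; case: l => [[] []] /=; ct. Qed.

Lemma letter_cases l l' : [\/ l' = l, l' = oppl l | l'.1 != l.1].
Proof.
by case: l => [[] []]; case: l' => [[] []]; rewrite /oppl /=;
  try (by constructor 1); try (by constructor 2); constructor 3.
Qed.

Lemma int_strict (m k : int) (x : R) : m%:~R < x < (m + 1)%:~R -> x = k%:~R -> False.
Proof. by move=> /andP[h1 h2] E; move: h1 h2; rewrite E !ltr_int; lia. Qed.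

Lemma conv_strict (a b r x y : R) : 0 <= r <= 1 -> a < x < b -> a < y < b ->
  a < (1 - r) * x + r * y < b.
Proof. by move=> /andP[r0 r1] /andP[x0 x1] /andP[y0 y1]; case: (leP x y) => xy; apply/andP; split; nra. Qed.

Section Margin.
Variables (e d : R).
Hypotheses (e0 : 0 < e) (e4 : e < 1 / 4) (ed : e < d).

Lemma margin_cross l l' s s' p : margin d p -> l'.1 != l.1 -> - e <= hgt l s p <= e ->
  - e <= hgt l' s' p <= e -> False.
Proof.
have [e0' e4' ed'] : [/\ 0 < e, e < 1 / 4 & e < d] by [].
have abs (x y : R) : - e <= x <= e -> - e <= y <= e -> [\/ d <= x, x <= - d, d <= y | y <= - d] -> False.
  by move=> /andP[h1 h2] /andP[h3 h4] [] h; lra.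
have m i j a b : margin d p -> - e <= p.1 - (i%:~R + a%:R) <= e -> - e <= p.2 - (j%:~R + b%:R) <= e -> False.
  move=> mp /andP[h1 h2] /andP[h3 h4].
  have ii (k : int) (c : nat) : k%:~R + c%:R \is a @Num.int R by rewrite rpredD ?intr_int ?rpred_nat.
  by apply: (abs (p.1 - (i%:~R + a%:R)) (p.2 - (j%:~R + b%:R))); rewrite ?h1 ?h3 //; exact: mp.
move=> mp; rewrite /hgt; case: l => [[] []]; case: l' => [[] []] //= _ h1 h2.
- by apply: (m s.1 s'.2 1%N 1%N mp); lra.
- by apply: (m s.1 s'.2 1%N 0%N mp); lra.
- by apply: (m s.1 s'.2 0%N 1%N mp); lra.
- by apply: (m s.1 s'.2 0%N 0%N mp); lra.
- by apply: (m s'.1 s.2 1%N 1%N mp); lra.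
- by apply: (m s'.1 s.2 0%N 1%N mp); lra.
- by apply: (m s'.1 s.2 1%N 0%N mp); lra.
- by apply: (m s'.1 s.2 0%N 0%N mp); lra.
Qed.

Lemma margin_other l l' s p : margin d p -> l'.1 != l.1 -> - e <= hgt l s p <= e ->
  hgt l' s p <= e -> hgt l' s p < - e.
Proof.
have [e0' e4' ed'] : [/\ 0 < e, e < 1 / 4 & e < d] by [].
move=> mp ll h1 h2; rewrite ltNge; apply/negP => h3.
by apply: (margin_cross mp ll h1 (s' := s)); rewrite h3.
Qed.

Definition inbox s p := forall l, hgt l s p <= e.
Definition core s p := forall l, hgt l s p <= - e.

Lemma core_inbox s p : core s p -> inbox s p.
Proof. by move=> cp l; have h := cp l; have e0' := e0; lra. Qed.

Lemma cross_core l s p : margin d p -> hgt l s p = e -> inbox s p -> core (sadd s (dv l)) p.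
Proof.
have [e0' e4' ed'] : [/\ 0 < e, e < 1 / 4 & e < d] by [].
move=> mp hp ip l'; case: (letter_cases l l') => [->|->|ll].
- by rewrite hgt_dv; lra.
- by rewrite hgt_opp hgt_dv; lra.
- rewrite hgt_dv_other //; apply: ltW; apply: (margin_other mp ll) => //.
  by rewrite hp lexx andbT; lra.
Qed.

Lemma box_star s p r : margin d p -> inbox s p -> 0 <= r <= 1 -> offlat (mix r (mid s) p).
Proof.
have [e0' e4' ed'] : [/\ 0 < e, e < 1 / 4 & e < d] by [].
move=> mp ip r01; apply/negP => /andP[/= /intrP[m hm] /intrP[n hn]].
have := ip (true, true); have := ip (true, false); have := ip (false, true); have := ip (false, false).
rewrite /hgt /= => h4 h3 h2 h1.
have out (x : R) (i j : int) : i%:~R - x <= e -> x - i%:~R - 1 <= e ->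
    (1 - r) * (i%:~R + 1 / 2) + r * x = j%:~R -> exists2 y : R, y \is a Num.int & - e <= x - y <= e.
  move=> a1 a2 E; case: (leP x i%:~R) => xk.
    by exists i%:~R; [exact: intr_int|lra].
  case: (leP (i%:~R + 1) x) => xk1; first by exists (i%:~R + 1); [rewrite rpredD ?intr_int ?rpred1|lra].
  exfalso; apply: (@int_strict i j _ _ E); rewrite intrD; apply/andP; split; nra.
have [i Ii /andP[i1 i2]] := out _ _ _ h2 h1 hm.
have [j Ij /andP[j1 j2]] := out _ _ _ h4 h3 hn.
by case: (mp i j Ii Ij) => h; lra.
Qed.

Lemma cross_trans l s p : margin d p -> - e <= hgt l s p <= e -> inbox s p ->
  if l.1 then s.2%:~R < p.2 < s.2%:~R + 1 else s.1%:~R < p.1 < s.1%:~R + 1.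
Proof.
have [e0' e4' ed'] : [/\ 0 < e, e < 1 / 4 & e < d] by [].
move=> mp hp ip; case E : l.1.
  have := margin_other mp (_ : (false, true).1 != l.1) hp (ip (false, true)).
  have := margin_other mp (_ : (false, false).1 != l.1) hp (ip (false, false)).
  rewrite E /hgt /= => /(_ isT) h1 /(_ isT) h2; lra.
have := margin_other mp (_ : (true, true).1 != l.1) hp (ip (true, true)).
have := margin_other mp (_ : (true, false).1 != l.1) hp (ip (true, false)).
rewrite E /hgt /= => /(_ isT) h1 /(_ isT) h2; lra.
Qed.

Lemma cross_triangle l s p t r : margin d p -> hgt l s p = e -> inbox s p -> 0 <= t <= 1 -> 0 <= r <= 1 ->
  offlat (mix r (mid s) (mix t (mid (sadd s (dv l))) p)).
Proof.
have [e0' e4' ed'] : [/\ 0 < e, e < 1 / 4 & e < d] by [].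
move=> mp hp ip t01 r01; have hh : - e <= hgt l s p <= e by rewrite hp lexx andbT; lra.
have H := cross_trans mp hh ip; apply/negP => /andP[/= /intrP[m hm] /intrP[n hn]].
move: H hm hn; clear hh hp; rewrite /dv /sadd; case: l => [[] []] /= /andP[a b]; rewrite ?intrD ?addr0 ?mulrNz => hm hn.
- by apply: (@int_strict s.2 n _ _ hn); rewrite !intrD; do 2?apply: conv_strict; lra.
- by apply: (@int_strict s.2 n _ _ hn); rewrite !intrD; do 2?apply: conv_strict; lra.
- by apply: (@int_strict s.1 m _ _ hm); rewrite !intrD; do 2?apply: conv_strict; lra.
- by apply: (@int_strict s.1 m _ _ hm); rewrite !intrD; do 2?apply: conv_strict; lra.
Qed.

End Margin.
End Cells.

Section Chains.
Context {R : realType}.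
Implicit Types (p q z : R * R) (s : int * int) (l : bool * bool) (a b t : R).

Definition top s p : R := Num.max (Num.max (hgt (true, true) s p) (hgt (true, false) s p))
  (Num.max (hgt (false, true) s p) (hgt (false, false) s p)).

Lemma le_top l s p : hgt l s p <= top s p.
Proof. by rewrite /top !le_max; case: l => [[] []]; rewrite lexx ?orbT. Qed.

Lemma top_ex s p : exists l, top s p = hgt l s p.
Proof.
have m2 (x y : R) : Num.max x y = x \/ Num.max x y = y by rewrite /Num.max; case: ifP; [right|left].
rewrite /top; case: (m2 (Num.max (hgt (true, true) s p) (hgt (true, false) s p))
  (Num.max (hgt (false, true) s p) (hgt (false, false) s p))) => ->.
  by case: (m2 (hgt (true, true) s p) (hgt (true, false) s p)) => ->; [exists (true, true)|exists (true, false)].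
by case: (m2 (hgt (false, true) s p) (hgt (false, false) s p)) => ->; [exists (false, true)|exists (false, false)].
Qed.

Lemma top_lt s p c : (forall l, hgt l s p < c) <-> top s p < c.
Proof.
split=> [H|H l]; first by have [l ->] := top_ex s p.
exact: le_lt_trans (le_top l s p) H.
Qed.

Lemma ct_top s : continuous (top s).
Proof. by rewrite /top; apply: ct_max; apply: ct_max; exact: ct_hgt. Qed.

Section Curve.
Variables (g : R -> R * R) (e d : R).
Hypotheses (lg : lpath g) (e0 : 0 < e) (e4 : e < 1 / 4) (ed : e < d).
Hypothesis mg : forall t, margin d (g t).

Let ct_top_g s : continuous (fun t => top s (g t)).
Proof. by apply: (@ct_comp _ _ _ (top s) g); [exact: ct_top|case: lg]. Qed.

Let ct_hgt_g l s : continuous (fun t => hgt l s (g t)).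
Proof. by apply: (@ct_comp _ _ _ (hgt l s) g); [exact: ct_hgt|case: lg]. Qed.

Definition stays s a b := forall x, a <= x <= b -> forall l, hgt l s (g x) < e.

Definition step l s t t' := [/\ t < t', forall x, t <= x < t' -> forall l', hgt l' s (g x) < e,
  hgt l s (g t') = e & inbox e s (g t')].

Lemma exit_or_stay s a b : a <= b -> (forall l, hgt l s (g a) < e) ->
  stays s a b \/ exists l t, [/\ a < t, t <= b & step l s a t].
Proof.
move=> ab /top_lt ha; case: (pselect (exists2 x, a <= x <= b & e <= top s (g x))) => [[x /andP[ax xb] hx]|H]; last first.
  left=> x xab; apply/top_lt; rewrite ltNge; apply/negP => h; apply: H; by exists x.
have [t /andP[ta tx] [ht H]] := first_time (@ct_top_g s) ax ha hx.
right; have [l hl] := top_ex s (g t); exists l, t; split=> //; first exact: le_trans tx xb.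
split=> //; [by move=> y hy; apply/top_lt; exact: H|by rewrite -hl|].
by move=> l'; rewrite -ht; exact: le_top.
Qed.

Lemma step_core l s t t' : step l s t t' -> core e (sadd s (dv l)) (g t').
Proof. by move=> [_ _ h1 h2]; apply: (cross_core e0 e4 ed). Qed.

Lemma core_lt s p : core e s p -> forall l, hgt l s p < e.
Proof. by move=> h l; have := h l; have e0' := e0; lra. Qed.

Lemma step_time : exists2 n, 0 < n & forall l s t t', 0 <= t <= 4 -> core e s (g t) ->
  step l s t t' -> t + n <= t'.
Proof.
have [cg _] := lg.
have K : compact [set` `[(0 : R), 4]] by exact: segment_compact.
have c1 : continuous (fun t => (g t).1) by ct.
have c2 : continuous (fun t => (g t).2) by ct.
have [n1 n10 H1] := unif_cont K c1 e0; have [n2 n20 H2] := unif_cont K c2 e0.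
exists (Num.min n1 n2); first by rewrite lt_min n10.
move=> l s t t' t04 cs [tt _ hl _]; rewrite leNgt; apply/negP => h.
have cl := cs l; have e0' := e0.
have bl (n : R) : t' < t + n -> ball t n t' by rewrite /ball /= => ?; rewrite ltr_distlC; lra.
have [h1 h2] : t' < t + n1 /\ t' < t + n2.
  by move: h; rewrite -!ltrBlDl lt_min => /andP[].
have K4 : [set` `[(0 : R), 4]] t by rewrite /= in_itv /=.
have := H1 t t' K4 (bl _ h1); have := H2 t t' K4 (bl _ h2).
move: cl hl; rewrite /hgt !ltr_norml; case: l => [[] []] /= cl hl /andP[a1 a2] /andP[a3 a4]; lra.
Qed.

Fixpoint chain t s (es : seq (bool * bool * R)) b s' : Prop := match es with
  | [::] => [/\ t <= b, s' = s & stays s t b]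
  | u :: es' => [/\ step u.1 s t u.2 , core e s (g t) & chain u.2 (sadd s (dv u.1)) es' b s'] end.

Lemma chain_ex t s b : 0 <= t -> t <= b -> b <= 4 -> core e s (g t) -> exists es s', chain t s es b s'.
Proof.
have [n n0 H] := step_time; move=> t0 tb b4.
have [m hm] : exists m : nat, b - t < m%:R * n.
  exists (Num.bound ((b - t) / n)); rewrite -ltr_pdivrMr //; apply: archi_boundP.
  by rewrite divr_ge0 ?subr_ge0 // ltW.
elim: m t s t0 tb hm => [|m IH] t s t0 tb hm cs.
  by exfalso; move: hm; rewrite mul0r; lra.
case: (exit_or_stay tb (core_lt cs)) => [st|[l [t' [tt tb' st]]]]; first by exists [::], s.
have t04 : 0 <= t <= 4 by lra.
have h := H l s t t' t04 cs st.
have hm' : b - t' < m%:R * n by move: hm; rewrite -natr1 mulrDl mul1r; lra.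
have [|es [s' hs]] := IH t' (sadd s (dv l)) _ tb' hm' (step_core st); first lra.
by exists ((l, t') :: es), s'.
Qed.

Section Word.
Context {F : fieldType} {N : (R -> R * R) -> R -> R -> 'M[F]_2}.
Hypothesis tN : transport N.

Definition gen l := N (seg (mid (0, 0)) (mid (dv l))) 0 1.

Lemma mid_seg_lpath s l : lpath (seg (mid s) (mid (sadd s (dv l)) : R * R)).
Proof.
apply: seg_lpath => r r01; apply/negP => /andP[/= /intrP[m hm] /intrP[n hn]].
have half (i j : int) : i%:~R + 1 / 2 = j%:~R :> R -> False.
  move=> h; apply: (@int_strict R i j (i%:~R + 1 / 2)) => //; rewrite intrD; lra.
move: hm hn; rewrite /sadd /dv; case: l => [[] []] /=; rewrite !intrD ?addr0 => hm hn.
- by apply: (@half s.2 n); lra.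
- by apply: (@half s.2 n); lra.
- by apply: (@half s.1 m); lra.
- by apply: (@half s.1 m); lra.
Qed.

Lemma lattice_int s : lattice (s.1%:~R, s.2%:~R : R).
Proof. by rewrite /lattice /= !intr_int. Qed.

Lemma sadd0 s : sadd (0, 0) s = s.
Proof. by rewrite /sadd /= !add0r -surjective_pairing. Qed.

Lemma seg_gen s l : N (seg (mid s) (mid (sadd s (dv l)))) 0 1 = gen l.
Proof.
rewrite /gen -[in RHS](sadd0 (dv l)) -[RHS](tp_seg_shift tN (lattice_int s) (mid_seg_lpath (0, 0) l)).
by congr (N (seg _ _) 0 1); rewrite /mid /sadd /= ?intrD; congr pair; ring.
Qed.

Lemma gen_letter l : gen l = letter (gen (true, true)) (gen (false, true)) l.
Proof.
case: l => [[] []] //; rewrite /letter /=.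
- have := seg_gen (dv (true, false)) (true, true); rewrite /sadd /= => <-.
  by rewrite -tp_seg_rev //; have := mid_seg_lpath (dv (true, false)) (true, true).
- have := seg_gen (dv (false, false)) (false, true); rewrite /sadd /= => <-.
  by rewrite -tp_seg_rev //; have := mid_seg_lpath (dv (false, false)) (false, true).
Qed.

Lemma chain_word t s es b s' : chain t s es b s' ->
  N (seg (mid s) (g t)) 0 1 * N g t b =
  (\prod_(u <- es) letter (gen (true, true)) (gen (false, true)) u.1) * N (seg (mid s') (g b)) 0 1.
Proof.
elim: es t s => [|[l t'] es IH] t s /=.
  move=> [tb -> st]; rewrite big_nil mul1r; apply: (tp_star tN) => // x r hx hr.
  by apply: (box_star e0 e4 ed (mg x)) => // l; apply: ltW; exact: st.
move=> [[tt st hl ib] cs /IH ch]; rewrite big_cons -mulrA -ch -(tp_mul tN t t' b lg) mulrA.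
rewrite (tp_star tN (ltW tt) lg); last first.
  move=> x r /andP[x1 x2] hr; apply: (box_star e0 e4 ed (mg x)) => // l'.
  move: x2; rewrite le_eqVlt => /orP[/eqP ->|x2]; first exact: ib.
  by apply: ltW; apply: st; rewrite x1.
rewrite mulrA; congr (_ * _); rewrite -gen_letter -(seg_gen s l).
by rewrite (tp_triangle tN) // => x r hx hr; apply: (cross_triangle e0 e4 ed (mg t')).
Qed.
End Word.

(* Lowering the threshold from e to e' makes consecutive crossing intervals disjoint. *)
Lemma stays_below s a b : a <= b -> stays s a b ->
  exists2 M, M < e & forall x, a <= x <= b -> forall l, hgt l s (g x) <= M.
Proof.
move=> ab st; have [c + hc] := EVT_max ab (continuous_subspaceT (@ct_top_g s)).
rewrite in_itv /= => cab; exists (top s (g c)); first by apply/top_lt; exact: st.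
by move=> x xab l; apply: le_trans (le_top l s (g x)) _; apply: hc; rewrite in_itv.
Qed.

Definition crossing_interval e' t l s t' u0 t1 := [/\ t < u0, u0 < t1, t1 < t',
  hgt l s (g u0) = - e' & hgt l s (g t1) = e'] /\
  (forall x, t <= x <= t1 -> forall l', hgt l' s (g x) <= e') /\
  (forall x, u0 <= x <= t' -> - e' <= hgt l s (g x)) .

Lemma step_thresholds l s t t' : core e s (g t) -> step l s t t' ->
  exists2 M, M < e & forall e', 0 < e' -> M < e' < e -> exists u0 t1, crossing_interval e' t l s t' u0 t1.
Proof.
have e0' := e0; move=> cs [tt st hl ib]; have cl := cs l.
have h1 : hgt l s (g t) <= - (e / 2) by lra.
have h2 : - (e / 2) < hgt l s (g t') by lra.
have [c /andP[c1 c2] [hc hc']] := last_time (@ct_hgt_g l s) (ltW tt) h1 h2.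
have [|M Me HM] := @stays_below s t c c1.
  by move=> x /andP[x1 x2]; apply: st; rewrite x1 (le_lt_trans x2).
exists (Num.max M (e / 2)); first by rewrite gt_max Me; lra.
move=> e' e'0 /andP[]; rewrite gt_max => /andP[Me' ee'] e'e.
have [||u0 /andP[s1 s2] [hs hs']] := last_time (@ct_hgt_g l s) (ltW tt) (_ : _ <= - e') _; [lra|lra|].
have [||t1 /andP[t2 t3] [ht ht']] := first_time (@ct_hgt_g l s) (ltW s2) (_ : _ < e') _; [lra|lra|].
have u0c : u0 <= c by rewrite leNgt; apply/negP => h; have := hc' u0; rewrite h (ltW s2) hs => /(_ isT); lra.
have u0t : t < u0.
  by move: s1; rewrite le_eqVlt => /orP[/eqP E|//]; exfalso; move: cl; rewrite E hs; lra.
have t1t : t1 < t'.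
  by move: t3; rewrite le_eqVlt => /orP[/eqP E|//]; exfalso; move: ht; rewrite E hl; lra.
have low x : u0 <= x <= t' -> - e' <= hgt l s (g x).
  move=> /andP[x1 x2]; move: x1; rewrite le_eqVlt => /orP[/eqP <-|x1]; first by rewrite hs.
  by apply: ltW; apply: hs'; rewrite x1.
exists u0, t1; split=> //; split=> // x /andP[x1 x2] l'.
case: (leP x u0) => xs.
  by apply: le_trans (ltW Me'); apply: HM; rewrite x1 (le_trans xs).
have lx := low x; have xx : u0 <= x <= t' by lra.
have {lx} lx := lx xx.
have hx : hgt l s (g x) <= e'.
  move: x2; rewrite le_eqVlt => /orP[/eqP ->|x2]; first by rewrite ht.
  by apply: ltW; apply: ht'; rewrite (ltW xs).
case: (letter_cases l l') => [->//|->|ll]; first by rewrite hgt_opp; lra.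
have hx' : - e <= hgt l s (g x) <= e by lra.
have i' : hgt l' s (g x) <= e by apply: ltW; apply: st; lra.
by have := margin_other e0 e4 ed (mg x) ll hx' i'; lra.
Qed.

End Curve.
End Chains.

Record ev (R : realType) := Ev { ev_l : bool * bool; ev_s : int * int; ev_a : R; ev_b : R }.

Section Noncrossing.
Context {R : realType}.
Variables (g : R -> R * R) (e d : R) (E : nat -> ev R) (K : nat).
Hypotheses (cg : continuous g) (e0 : 0 < e) (e4 : e < 1 / 4) (ed : e < d).
Hypothesis mg : forall t, margin d (g t).
Implicit Types (u w : ev R) (k j : nat) (t : R).

Definition crosses u := [/\ ev_a u < ev_b u, hgt (ev_l u) (ev_s u) (g (ev_a u)) = - e,
  hgt (ev_l u) (ev_s u) (g (ev_b u)) = e &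
  forall t, ev_a u <= t <= ev_b u -> - e <= hgt (ev_l u) (ev_s u) (g t) /\ inbox e (ev_s u) (g t)].

Definition link a b s u := [/\ b < ev_a u, ev_s u = s &
  forall t, a <= t <= ev_b u -> inbox e s (g t)].

Definition link2 u w := link (ev_a u) (ev_b u) (sadd (ev_s u) (dv (ev_l u))) w.

Definition across u (p : R * R) : R :=
  if (ev_l u).2 then hgt (ev_l u) (ev_s u) p else - hgt (ev_l u) (ev_s u) p.
Definition along u (p : R * R) : R :=
  if (ev_l u).1 then p.2 - (ev_s u).2%:~R else p.1 - (ev_s u).1%:~R.
Definition side_time (b : bool) u := if b == (ev_l u).2 then ev_a u else ev_b u.
Definition side_pos b u := along u (g (side_time b u)).

Hypothesis (crE : forall k, (k <= K)%N -> crosses (E k)).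
Hypothesis (lkE : forall k, (k < K)%N -> link2 (E k) (E k.+1)).
Variable v : int * int.
Hypothesis EK : E K = Ev (ev_l (E 0)) (sadd (ev_s (E 0)) v) (ev_a (E 0) + 1) (ev_b (E 0) + 1).
Hypothesis per : forall t, ev_a (E 0) <= t <= ev_b (E 0) -> g (t + 1) = ((g t).1 + v.1%:~R, (g t).2 + v.2%:~R).
Hypothesis simple : forall t t', ev_a (E 0) <= t -> t <= t' -> t' <= ev_b (E K) ->
  lattice ((g t').1 - (g t).1, (g t').2 - (g t).2) -> t' = t \/ t' = t + 1.

Lemma along_in u t : crosses u -> ev_a u <= t <= ev_b u -> 0 < along u (g t) < 1.
Proof.
move=> [_ _ _ H] /H[h1 h2].
have hh : - e <= hgt (ev_l u) (ev_s u) (g t) <= e by rewrite h1 h2.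
have := cross_trans e0 e4 ed (mg t) hh h2; rewrite /along.
by case: (ev_l u).1 => /andP[h h']; lra.
Qed.

Lemma ab k : (k <= K)%N -> ev_a (E k) < ev_b (E k).
Proof. by move/crE => []. Qed.

Lemma ba k : (k < K)%N -> ev_b (E k) < ev_a (E k.+1).
Proof. by move/lkE => []. Qed.

Lemma ba_lt j k : (j < k)%N -> (k <= K)%N -> ev_b (E j) < ev_a (E k).
Proof.
elim: k => // k IH; rewrite ltnS leq_eqVlt => /orP[/eqP ->|jk] kK; first exact: ba.
by apply: lt_trans (IH jk (ltnW kK)) _; apply: lt_trans (ab (ltnW kK)) (ba kK).
Qed.

Lemma ev_a_ge0 k : (k <= K)%N -> ev_a (E 0) <= ev_a (E k).
Proof.
case: k => // k kK; apply: ltW; apply: lt_trans (ba_lt (ltn0Sn k) kK); exact: ab.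
Qed.

Lemma ev_b_leK k : (k <= K)%N -> ev_b (E k) <= ev_b (E K).
Proof.
rewrite leq_eqVlt => /orP[/eqP ->//|kK]; apply: ltW; apply: lt_trans (ba_lt kK (leqnn K)) (ab (leqnn K)).
Qed.

Lemma along_int u w p q : (ev_l u).1 = (ev_l w).1 -> across u p = across w q -> along u p = along w q ->
  lattice (p.1 - q.1, p.2 - q.2).
Proof.
rewrite /across /along /hgt /lattice /=; case: (ev_l u) => [[] []]; case: (ev_l w) => [[] []] //= _ h1 h2.
all: apply/andP; split; apply/intrP.
- exists ((ev_s u).1 - (ev_s w).1); rewrite intrD mulrNz; lra.
- exists ((ev_s u).2 - (ev_s w).2); rewrite intrD mulrNz; lra.
- exists ((ev_s u).1 + 1 - (ev_s w).1); rewrite !intrD mulrNz; lra.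
- exists ((ev_s u).2 - (ev_s w).2); rewrite intrD mulrNz; lra.
- exists ((ev_s u).1 - 1 - (ev_s w).1); rewrite !intrD !mulrNz; lra.
- exists ((ev_s u).2 - (ev_s w).2); rewrite intrD mulrNz; lra.
- exists ((ev_s u).1 - (ev_s w).1); rewrite intrD mulrNz; lra.
- exists ((ev_s u).2 - (ev_s w).2); rewrite intrD mulrNz; lra.
- exists ((ev_s u).1 - (ev_s w).1); rewrite intrD mulrNz; lra.
- exists ((ev_s u).2 - (ev_s w).2); rewrite intrD mulrNz; lra.
- exists ((ev_s u).1 - (ev_s w).1); rewrite !intrD mulrNz; lra.
- exists ((ev_s u).2 + 1 - (ev_s w).2); rewrite !intrD mulrNz; lra.
- exists ((ev_s u).1 - (ev_s w).1); rewrite !intrD !mulrNz; lra.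
- exists ((ev_s u).2 - 1 - (ev_s w).2); rewrite !intrD !mulrNz; lra.
- exists ((ev_s u).1 - (ev_s w).1); rewrite intrD mulrNz; lra.
- exists ((ev_s u).2 - (ev_s w).2); rewrite intrD mulrNz; lra.
Qed.

Lemma side_time_in b u : crosses u -> ev_a u <= side_time b u <= ev_b u.
Proof. by case=> h _ _ _; rewrite /side_time; case: ifP; rewrite lexx (ltW h). Qed.

Lemma side_across b u : crosses u -> across u (g (side_time b u)) = if b then - e else e.
Proof.
by case=> _ h1 h2 _; rewrite /across /side_time; case: b; case: (ev_l u).2 => /=; rewrite ?h1 ?h2 ?opprK.
Qed.

Lemma side_pos_in b u : crosses u -> 0 < side_pos b u < 1.
Proof. by move=> cu; apply: along_in => //; exact: side_time_in. Qed.

Lemma strips_disjoint j k t t' : (j < k < K)%N -> (ev_l (E j)).1 = (ev_l (E k)).1 ->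
  ev_a (E j) <= t <= ev_b (E j) -> ev_a (E k) <= t' <= ev_b (E k) ->
  across (E j) (g t) = across (E k) (g t') -> along (E j) (g t) <> along (E k) (g t').
Proof.
move=> /andP[jk kK] ll /andP[t1 t2] /andP[t3 t4] h1 h2.
have j0 := ev_a_ge0 (ltnW (ltn_trans jk kK)); have kk := ev_b_leK (ltnW kK).
have b1 := ba_lt jk (ltnW kK); have b2 := ba kK; have b3 := ba_lt kK (leqnn K).
have lat := along_int (esym ll) (esym h1) (esym h2).
have EKa : ev_a (E K) = ev_a (E 0) + 1 by rewrite EK.
have tt : t <= t' by lra.
case: (simple _ tt _ lat) => [||h|h]; [lra|lra| |]; clear - h b1 b2 b3 EKa t1 t2 t3 t4 j0; lra.
Qed.

Lemma side_pos_neq b j k : (j < k < K)%N -> (ev_l (E j)).1 = (ev_l (E k)).1 ->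
  side_pos b (E j) <> side_pos b (E k).
Proof.
move=> jkK ll; have /andP[jk kK] := jkK.
have cj := crE (ltnW (ltn_trans jk kK)); have ck := crE (ltnW kK).
by apply: strips_disjoint => //; [exact: side_time_in|exact: side_time_in|rewrite !side_across].
Qed.

Lemma side_order_lt j k : (j < k < K)%N -> (ev_l (E j)).1 = (ev_l (E k)).1 ->
  (side_pos true (E j) < side_pos true (E k)) = (side_pos false (E j) < side_pos false (E k)).
Proof.
move=> jkK ll; have /andP[jk kK] := jkK.
have cj := crE (ltnW (ltn_trans jk kK)); have ck := crE (ltnW kK).
have nt := @side_pos_neq true _ _ jkK ll; have nf := @side_pos_neq false _ _ jkK ll.
pose F u t := (across u (g t), along u (g t)).
have cF u : continuous (F u).
  rewrite /F /across /along /hgt; case: (ev_l u) => [[] []] /=; ct.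
have inF u : crosses u -> forall t, ev_a u <= t <= ev_b u ->
    [/\ - e <= (F u t).1 <= - e + 2 * e, 0 <= (F u t).2 <= 0 + 1 & F u t <> (- e, 0)].
  move=> cu t ht; have /andP[a1 a2] := along_in cu ht; have [_ _ _ H] := cu.
  have [h1 h2] := H _ ht; have := h2 (ev_l u); rewrite /F /= /across => h3; split.
  - by case: (ev_l u).2; lra.
  - lra.
  - by case=> _ h; move: a1; rewrite h ltxx.
have e0' := e0.
have sideF b u : crosses u -> on_side true b (side_pos b u)
    (((F u (side_time b u)).1 - - e) / (2 * e), ((F u (side_time b u)).2 - 0) / 1).
  move=> cu; rewrite /F /on_side /= side_across // subr0 divr1; case: b; congr pair.
    by rewrite subrr mul0r.
  have -> : e - - e = 2 * e by ring.
  by rewrite divff // mulf_neq0 ?pnatr_eq0 // gt_eqF.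
have tm u : (ev_a u = side_time (ev_l u).2 u) * (ev_b u = side_time (~~ (ev_l u).2) u).
  by rewrite /side_time eqxx; case: (ev_l u).2.
have dis t t' : ev_a (E j) <= t <= ev_b (E j) -> ev_a (E k) <= t' <= ev_b (E k) -> F (E j) t <> F (E k) t'.
  by move=> h h' [h1 h2]; exact: (strips_disjoint jkK ll h h').
have := @box_crossing R (- e) 0 (2 * e) 1 _ _ _ _ (F (E j)) (F (E k)) true (ev_l (E j)).2 (side_pos (ev_l (E j)).2 (E j))
  true (~~ (ev_l (E j)).2) (side_pos (~~ (ev_l (E j)).2) (E j))
  true (ev_l (E k)).2 (side_pos (ev_l (E k)).2 (E k))
  true (~~ (ev_l (E k)).2) (side_pos (~~ (ev_l (E k)).2) (E k))
  _ ltr01 (ltW (ab (ltnW (ltn_trans jk kK)))) (ltW (ab (ltnW kK))) (@cF _) (@cF _) (inF _ cj) (inF _ ck) dis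
  (side_pos_in _ cj) (side_pos_in _ cj) (side_pos_in _ ck) (side_pos_in _ ck).
rewrite !tm => /(_ _ (sideF _ _ cj) (sideF _ _ cj) (sideF _ _ ck) (sideF _ _ ck)).
have e2 : 0 < 2 * e by lra.
move=> /(_ e2) un.
have {}un : unlinked (bdpt true true (side_pos true (E j))) (bdpt true false (side_pos false (E j)))
    (bdpt true true (side_pos true (E k))) (bdpt true false (side_pos false (E k))).
  by move: un; case: (ev_l (E j)).2; case: (ev_l (E k)).2 => //=; rewrite 1?unlinkedC // 1?unlinkedC' // 1?unlinkedC.
have p1 := side_pos_in true cj; have p2 := side_pos_in false cj.
have p3 := side_pos_in true ck; have p4 := side_pos_in false ck.
move: un nt nf; rewrite /unlinked /bdpt.
move: (side_pos true (E j)) (side_pos false (E j)) (side_pos true (E k)) (side_pos false (E k)) p1 p2 p3 p4 => x1 x2 x3 x4 p1 p2 p3 p4.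
have -> : x1 < 3 - x4 by lra.
have -> : 3 - x2 < x3 = false by apply/negbTE; rewrite -leNgt; lra.
rewrite ltrD2l ltrN2 => + n1 n2.
by case: (ltgtP x1 x3) => // h; case: (ltgtP x2 x4).
Qed.

Lemma side_order b j k : (j <= K)%N -> (k <= K)%N -> (ev_l (E j)).1 = (ev_l (E k)).1 ->
  (side_pos b (E j) < side_pos b (E k)) = (side_pos true (E j) < side_pos true (E k)).
Proof.
have K0 b' : side_pos b' (E K) = side_pos b' (E 0).
  rewrite EK /side_pos /side_time /along /=.
  have in1 : ev_a (E 0) <= ev_a (E 0) <= ev_b (E 0) by rewrite lexx ltW // ab.
  have in2 : ev_a (E 0) <= ev_b (E 0) <= ev_b (E 0) by rewrite lexx ltW // ab.
  by case: (ev_l (E 0)).1; case: ifP => _; rewrite per //= intrD; ring.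
have lK : ev_l (E K) = ev_l (E 0) by rewrite EK.
case: b => // ; wlog jK : j / (j < K)%N.
  move=> H; rewrite [(j <= K)%N]leq_eqVlt => /orP[/eqP ->|jK]; last by apply: H => //; exact: ltnW.
  have [K0'|Kp] := posnP K; last by rewrite !K0 lK; apply: H.
  by rewrite K0' leqn0 => /eqP -> _; rewrite !ltxx.
wlog kK : k / (k < K)%N.
  move=> H jK'; rewrite [(k <= K)%N]leq_eqVlt => /orP[/eqP ->|kK]; last by apply: H => //; exact: ltnW.
  by rewrite !K0 lK; apply: H => //; exact: leq_ltn_trans jK.
move=> _ _ ll; case: (ltngtP j k) => [jk|kj|->]; last by rewrite !ltxx.
  by rewrite side_order_lt // jk.
have kjK : (k < j < K)%N by rewrite kj.
have nt := @side_pos_neq true _ _ kjK (esym ll); have nf := @side_pos_neq false _ _ kjK (esym ll).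
have := side_order_lt kjK (esym ll).
by case: (ltgtP (side_pos true (E k))) nt => //; case: (ltgtP (side_pos false (E k))) nf.
Qed.

Definition mark k : crossing := (ev_l (E k), side_pos true (E k)).

Lemma mark_K : mark K = mark 0.
Proof.
have := side_order true (leqnn K) (leq0n K); rewrite /mark {1 2}EK /= => _.
congr pair; first by rewrite EK.
rewrite EK /side_pos /side_time /along /=.
have in1 : ev_a (E 0) <= ev_a (E 0) <= ev_b (E 0) by rewrite lexx ltW // ab.
have in2 : ev_a (E 0) <= ev_b (E 0) <= ev_b (E 0) by rewrite lexx ltW // ab.
by case: (ev_l (E 0)).1; case: ifP => _; rewrite per //= intrD; ring.
Qed.

Lemma mark_neq j k : (j < K)%N -> (k < K)%N -> j != k -> (ev_l (E j)).1 = (ev_l (E k)).1 ->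
  side_pos true (E j) <> side_pos true (E k).
Proof.
move=> jK kK jk ll; case: (ltngtP j k) jk => // h _; first by apply: side_pos_neq; rewrite // h.
by move/esym; apply: side_pos_neq => //; rewrite h.
Qed.

Definition arc k t : R * R := ((g t).1 - (ev_s (E k.+1)).1%:~R, (g t).2 - (ev_s (E k.+1)).2%:~R).

Lemma dv_neq0 s l : sadd s (dv l) <> s.
Proof. by clear; rewrite /sadd /dv; case: s => x y; case: l => [[] []] /= [h1 h2]; lia. Qed.

Lemma arcs_disjoint j k t t' : (j < k < K)%N -> ev_a (E j) <= t <= ev_b (E j.+1) ->
  ev_a (E k) <= t' <= ev_b (E k.+1) -> arc j t <> arc k t'.
Proof.
move=> /andP[jk kK] /andP[t1 t2] /andP[t3 t4] [h1 h2].
have EKa : ev_a (E K) = ev_a (E 0) + 1 by rewrite EK.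
have EKb : ev_b (E K) = ev_b (E 0) + 1 by rewrite EK.
have jK : (j < K)%N by exact: ltn_trans kK.
have a0 := ev_a_ge0 (ltnW jK); have a1 := ev_a_ge0 (ltnW kK).
have b0 := ev_b_leK jK; have b1 := ev_b_leK kK.
have [x hx] : exists x, x = sadd (ev_s (E k.+1)) (- (ev_s (E j.+1)).1, - (ev_s (E j.+1)).2) by exists (sadd (ev_s (E k.+1)) (- (ev_s (E j.+1)).1, - (ev_s (E j.+1)).2)).
have d1 : (g t').1 - (g t).1 = x.1%:~R by rewrite hx /= intrD mulrNz; lra.
have d2 : (g t').2 - (g t).2 = x.2%:~R by rewrite hx /= intrD mulrNz; lra.
have lat : lattice ((g t').1 - (g t).1, (g t').2 - (g t).2) by rewrite /lattice /= d1 d2 !intr_int.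
have lat' : lattice ((g t).1 - (g t').1, (g t).2 - (g t').2).
  by rewrite /lattice /= -(opprB (g t').1) -(opprB (g t').2) d1 d2 !rpredN !intr_int.
have eqs y z : x = (y, z) -> ev_s (E k.+1) = sadd (ev_s (E j.+1)) (y, z).
  rewrite hx /sadd /= => -[<- <-]; case: (ev_s (E k.+1)) => p q /=; congr pair; ring.
have same : t' = t -> False.
  move=> tt; have x0 : x = (0, 0).
    by move: d1 d2; rewrite tt !subrr; case: (x) => p q /= /esym/eqP; rewrite intr_eq0 => /eqP -> /esym/eqP; rewrite intr_eq0 => /eqP ->.
  have := eqs _ _ x0; rewrite /sadd !addr0 -surjective_pairing.
  move: (jk); rewrite leq_eqVlt => /orP[/eqP jk'|jk'].
    by have [_ -> _] := lkE kK; rewrite -jk'; exact: dv_neq0.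
  have := ba_lt jk' (ltnW kK) => h _; lra.
case: (leP t t') => tt.
  case: (simple _ tt _ lat) => [||//|E1]; [lra|lra|].
  move: (kK); rewrite leq_eqVlt => /orP[/eqP kK'|kK'].
    have j0 : j = 0%N.
      case: (posnP j) => // jp; have := ba_lt jp (ltnW jK).
      by move=> h; exfalso; move: t4; rewrite kK' EKb E1; lra.
    have tin : ev_a (E 0) <= t <= ev_b (E 0).
      move: t1 t4; rewrite j0 kK' EKb E1 => ? ?; lra.
    have xv : x = (v.1, v.2).
      move: d1 d2; rewrite E1 (per tin) /=; case: (x) => p q /= /eqP; rewrite addrAC subrr add0r eqr_int => /eqP -> /eqP.
      by rewrite addrAC subrr add0r eqr_int => /eqP ->.
    have := eqs _ _ xv; rewrite kK' EK j0 /= -surjective_pairing.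
    have := lkE (leq_ltn_trans (leq0n j) jK) => -[_ -> _]; rewrite /sadd /= => -[] /addIr h3 /addIr h4.
    apply: (@dv_neq0 (ev_s (E 0)) (ev_l (E 0))); rewrite /sadd -h3 -h4; exact: esym (surjective_pairing _).
  have h := ba_lt kK' (leqnn K); lra.
case: (simple _ (ltW tt) _ lat') => [||h|E1]; [lra|lra|by apply: same; rewrite h|].
have h := ba_lt (leq_ltn_trans (leq0n j) jk) (ltnW kK); lra.
Qed.

Lemma arc_in k t : (k < K)%N -> ev_a (E k) <= t <= ev_b (E k.+1) ->
  [/\ - e <= (arc k t).1 <= - e + (1 + 2 * e), - e <= (arc k t).2 <= - e + (1 + 2 * e) & arc k t <> (- e, - e)].
Proof.
move=> kK ht; have [_ hs /(_ _ ht) ib] := lkE kK; rewrite -hs in ib.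
have h1 := ib (true, true); have h2 := ib (true, false); have h3 := ib (false, true); have h4 := ib (false, false).
move: h1 h2 h3 h4; rewrite /hgt /arc /= => h1 h2 h3 h4; have ed' := ed; have e0' := e0; split; [lra|lra|].
move=> [x1 x2]; have := mg t (intr_int R (ev_s (E k.+1)).1) (intr_int R (ev_s (E k.+1)).2).
by rewrite x1 x2 => -[] h; lra.
Qed.

Let nrm (x : R) := (x + e) / (1 + 2 * e).

Let nrm_lt x y : (nrm x < nrm y) = (x < y).
Proof. by have e0' := e0; rewrite /nrm ltr_pM2r ?ltrD2r // invr_gt0; lra. Qed.

Let nrm_in x : 0 < x < 1 -> 0 < nrm x < 1.
Proof.
have e0' := e0; have p : 0 < 1 + 2 * e by lra.
by move=> /andP[h1 h2]; rewrite /nrm divr_gt0 ?ltr_pdivrMr //=; lra.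
Qed.

Lemma side0 (x c : R) : x = 0 -> x / c = 0. Proof. by move=> ->; rewrite mul0r. Qed.
Lemma side1 (x c : R) : c != 0 -> x = c -> x / c = 1. Proof. by move=> c0 ->; rewrite divff. Qed.
Lemma side_eq (x y c : R) : x = y -> x / c = y / c. Proof. by move=> ->. Qed.

Lemma arc_start k : (k < K)%N -> on_side (ev_l (E k)).1 (ev_l (E k)).2 (nrm (side_pos (ev_l (E k)).2 (E k)))
  (((arc k (ev_a (E k))).1 - - e) / (1 + 2 * e), ((arc k (ev_a (E k))).2 - - e) / (1 + 2 * e)).
Proof.
move=> kK; have [_ h _ _] := crE (ltnW kK); have [_ hs _] := lkE kK.
have e0' := e0; have p : 1 + 2 * e != 0 by rewrite gt_eqF //; lra.
rewrite /on_side /nrm /side_pos /side_time eqxx /along /arc hs /sadd /dv; move: h; rewrite /hgt.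
case: (ev_l (E k)) => [[] []] /= h; congr pair; rewrite ?intrD ?addr0 ?opprK //;
  rewrite ?mulrNz; first [apply: side0; lra | apply: side1; [exact: p|lra] | apply: side_eq; lra].
Qed.

Lemma arc_end k : (k < K)%N -> on_side (ev_l (E k.+1)).1 (~~ (ev_l (E k.+1)).2)
    (nrm (side_pos (~~ (ev_l (E k.+1)).2) (E k.+1)))
  (((arc k (ev_b (E k.+1))).1 - - e) / (1 + 2 * e), ((arc k (ev_b (E k.+1))).2 - - e) / (1 + 2 * e)).
Proof.
move=> kK; have [_ _ h _] := crE kK.
have e0' := e0; have p : 1 + 2 * e != 0 by rewrite gt_eqF //; lra.
rewrite /on_side /nrm /side_pos /side_time /along /arc; move: h; rewrite /hgt.
case: (ev_l (E k.+1)) => [[] []] /= h; congr pair; rewrite ?intrD ?addr0 ?opprK //;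
  rewrite ?mulrNz; first [apply: side0; lra | apply: side1; [exact: p|lra] | apply: side_eq; lra].
Qed.

Lemma ct_arc k : continuous (arc k).
Proof. by rewrite /arc; have cg' := cg; ct. Qed.

Lemma unlinked_lt (p q r s p' q' r' s' : R) : (p < r) = (p' < r') -> (q < r) = (q' < r') ->
  (p < s) = (p' < s') -> (q < s) = (q' < s') -> unlinked p q r s = unlinked p' q' r' s'.
Proof. by rewrite /unlinked => -> -> -> ->. Qed.

Lemma arcs_unlinked j k : (j < K)%N -> (k < K)%N -> j != k ->
  unlinked (outp (mark j)) (inp (mark j.+1)) (outp (mark k)) (inp (mark k.+1)).
Proof.
move=> jK kK jk; have e0' := e0; have p : 0 < 1 + 2 * e by lra.
have dis t t' : ev_a (E j) <= t <= ev_b (E j.+1) -> ev_a (E k) <= t' <= ev_b (E k.+1) -> arc j t <> arc k t'.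
  move=> ht ht'; case: (ltngtP j k) jk => // jk _; first by apply: arcs_disjoint; rewrite // jk.
  by move/esym; apply: arcs_disjoint; rewrite // jk.
have le k' : (k' < K)%N -> ev_a (E k') <= ev_b (E k'.+1).
  by move=> h; apply: ltW; apply: lt_trans (ab (ltnW h)) (lt_trans (ba h) (ab h)).
have pos b k' : (k' <= K)%N -> 0 < side_pos b (E k') < 1 by move=> h; exact: side_pos_in (crE h).
have := @box_crossing R (- e) (- e) (1 + 2 * e) (1 + 2 * e) _ _ _ _ (arc j) (arc k) _ _ _ _ _ _ _ _ _ _ _ _
  p p (le _ jK) (le _ kK) (@ct_arc j) (@ct_arc k) (fun t => @arc_in j t jK) (fun t => @arc_in k t kK)
  dis
  (nrm_in (pos _ _ (ltnW jK))) (nrm_in (pos _ _ jK)) (nrm_in (pos _ _ (ltnW kK))) (nrm_in (pos _ _ kK))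
  (arc_start jK) (arc_end jK) (arc_start kK) (arc_end kK).
have cmp b b' j' k' : (j' <= K)%N -> (k' <= K)%N ->
    (bdpt (ev_l (E j')).1 b (nrm (side_pos b (E j'))) < bdpt (ev_l (E k')).1 b' (nrm (side_pos b' (E k')))) =
    (bdpt (ev_l (E j')).1 b (side_pos true (E j')) < bdpt (ev_l (E k')).1 b' (side_pos true (E k'))).
  move=> hj hk; apply: bdpt_lt_mono; try exact: nrm_in (pos _ _ _); try exact: pos.
  by move=> ll <-; rewrite !nrm_lt !side_order.
by rewrite /outp /inp /mark /=; congr is_true; apply: unlinked_lt; rewrite cmp // ltnW.
Qed.

Definition marks := [seq mark k | k <- iota 0 K].

Lemma mark_inj : {in iota 0 K &, injective mark}.
Proof.
move=> j k; rewrite !mem_iota /= add0n => jK kK [ll h].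
by apply/eqP/negP => /negP jk; apply: (mark_neq jK kK jk) => //; rewrite ll.
Qed.

Lemma next_mark k : (k < K)%N -> next marks (mark k) = mark k.+1.
Proof.
move=> kK; have kin : k \in iota 0 K by rewrite mem_iota.
rewrite next_nth map_f // /marks.
have -> : index (mark k) (map mark (iota 0 K)) = k.
  have nk : nth 0%N (iota 0 K) k = k by rewrite nth_iota.
  have {2}-> : k = index k (iota 0 K) by rewrite -{2}nk index_uniq ?size_iota ?iota_uniq.
  elim: (iota 0 K) kin (mark_inj) => //= x s IH; rewrite inE => kin inj.
  case: (eqVneq x k) => [->|xk]; first by rewrite eqxx.
  have ks : k \in s by move: kin; rewrite eq_sym (negbTE xk).
  case: eqP => [/inj|_]; first by rewrite !inE eqxx ks orbT => /(_ isT isT) E1; rewrite E1 eqxx in xk.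
  by congr S; apply: IH => // y z ys zs; apply: inj; rewrite inE ?ys ?zs orbT.
case EK' : K kK => [//|K'] kK /=.
move: kK; rewrite ltnS leq_eqVlt => /orP[/eqP ->|kK].
  by rewrite nth_default ?size_map ?size_iota // -EK' mark_K.
by rewrite (nth_map 0%N) ?size_iota // nth_iota.
Qed.

Theorem marks_good : good_pattern marks.
Proof.
split.
- by rewrite map_inj_in_uniq ?iota_uniq //; exact: mark_inj.
- by move=> u /mapP[k]; rewrite mem_iota => /andP[_ kK] ->; apply: side_pos_in (crE (ltnW _)).
- move=> u w /mapP[j + ->] /mapP[k + ->]; rewrite !mem_iota /= add0n => jK kK ll h.
  by case: (eqVneq j k) => [->//|jk]; case: (mark_neq jK kK jk ll h).
- move=> u w /mapP[j + ->] /mapP[k + ->]; rewrite !mem_iota /= add0n => jK kK uw.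
  rewrite !next_mark //; apply: arcs_unlinked => //.
  by apply: contra_neq uw => ->.
Qed.

End Noncrossing.

Fixpoint fine (R : realType) (g : R -> R * R) (e p0 p1 : R) (s : int * int) (fs : seq (ev R)) (b : R)
    (s' : int * int) : Prop := match fs with
  | [::] => [/\ p1 <= b, s' = s & forall t, p0 <= t <= b -> inbox e s (g t)]
  | u :: fs' => [/\ link g e p0 p1 s u, crosses g e u &
      fine g e (ev_a u) (ev_b u) (sadd (ev_s u) (dv (ev_l u))) fs' b s'] end.

Section Events.
Context {R : realType}.
Variables (g : R -> R * R) (e d : R).
Hypotheses (lg : lpath g) (e0 : 0 < e) (e4 : e < 1 / 4) (ed : e < d).
Hypothesis mg : forall t, margin d (g t).
Implicit Types (s : int * int) (l : bool * bool) (t : R).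

Lemma chain_fine es t s b s' : chain g e t s es b s' -> exists2 M, M < e & forall e', 0 < e' -> M < e' < e ->
  forall p0 p1, p1 <= t -> p0 <= t -> (forall x, p0 <= x <= t -> inbox e' s (g x)) ->
  exists2 fs, fine g e' p0 p1 s fs b s' & map (@ev_l R) fs = map fst es.
Proof.
elim: es t s => [|[l t'] es IH] t s /=.
  move=> [tb -> st]; have [M Me HM] := stays_below lg tb st.
  exists M => // e' e'0 /andP[Me' e'e] p0 p1 h1 h2 H; exists [::] => //=; split=> //; first exact: le_trans tb.
  move=> x /andP[x1 x2]; case: (leP x t) => xt; first by apply: H; rewrite x1.
  by move=> l; apply: le_trans (ltW Me'); apply: HM; rewrite (ltW xt).
move=> [st cs ch]; have [M1 M1e H1] := step_thresholds lg e0 e4 ed mg cs st.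
have [M2 M2e H2] := IH _ _ ch; exists (Num.max M1 M2); first by rewrite gt_max M1e.
move=> e' e'0; rewrite gt_max => /andP[/andP[M1e' M2e'] e'e] p0 p1 pt1 pt0 H.
have [|s0 [t1 [[ts st1 tt' hs ht] [bx low]]]] := H1 e' e'0; first by rewrite M1e'.
have [tlt opn hl ib] := st.
have [||x hx|fs ffs mfs] := H2 e' e'0 _ s0 t1 (ltW tt'); [by rewrite M2e'|lra| |].
  move=> l'; have hx' : - e' <= hgt l s (g x) by apply: low.
  have ib' : inbox e s (g x).
    have /andP[x1 x2] := hx; move: x2; rewrite le_eqVlt => /orP[/eqP ->//|x2] k.
    by apply: ltW; apply: opn; rewrite x2 andbT (ltW (lt_le_trans ts x1)).
  have il := ib' l; have il' := ib' l'; have e4' := e4.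
  case: (letter_cases l l') => [->|->|ll]; [by rewrite hgt_dv; lra|by rewrite hgt_opp hgt_dv; lra|].
  rewrite hgt_dv_other //; have hh : - e <= hgt l s (g x) <= e by lra.
  by have := margin_other e0 e4 ed (mg x) ll hh il'; lra.
exists (Ev l s s0 t1 :: fs); last by rewrite /= mfs.
split=> //=.
  split=> //=; first exact: le_lt_trans ts.
  move=> x /andP[x1 x2]; case: (leP x t) => xt; first by apply: H; rewrite x1.
  by move=> l'; apply: bx; rewrite (ltW xt).
split=> //= x /andP[x1 x2]; split; first by apply: low; rewrite x1 (le_trans x2 (ltW tt')).
by move=> l'; apply: bx; rewrite x2 (le_trans (ltW ts) x1).
Qed.

Lemma fine_nth u1 fs e' p0 p1 s b s' : fine g e' p0 p1 s fs b s' ->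
  b < ev_a u1 -> ev_s u1 = s' -> (forall t, b <= t <= ev_b u1 -> inbox e' s' (g t)) -> crosses g e' u1 ->
  [/\ link g e' p0 p1 s (nth u1 fs 0), (forall k, (k <= size fs)%N -> crosses g e' (nth u1 fs k)) &
    forall k, (k < size fs)%N -> link2 g e' (nth u1 fs k) (nth u1 fs k.+1)].
Proof.
move=> + b1 s1 ib c1; elim: fs p0 p1 s => [|u fs IH] p0 p1 s /=.
  move=> [pb ss H]; split=> [|k|//]; last by rewrite nth_nil.
  split; [exact: le_lt_trans b1|by rewrite s1|].
  move=> t /andP[h1 h2]; case: (leP t b) => tb; first by apply: H; rewrite h1.
  by rewrite -ss; apply: ib; rewrite (ltW tb).
move=> [lu cu /IH[h1 h2 h3]]; split=> // -[|k] //=; [exact: h2|exact: h3].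
Qed.

Lemma fine_le fs e' p0 p1 s b s' : fine g e' p0 p1 s fs b s' -> p1 <= b.
Proof.
elim: fs p0 p1 s => [|u fs IH] p0 p1 s /=; first by case.
by move=> [[h1 _ _] [h2 _ _ _] /IH]; lra.
Qed.

Lemma chain_end es t s b s' : chain g e t s es b s' -> forall l, hgt l s' (g b) < e.
Proof.
elim: es t s => [|u es IH] t s /=; last by case=> _ _ /IH.
by move=> [tb -> st]; apply: st; rewrite tb lexx.
Qed.

Lemma core_unique s s' p : core e s p -> (forall l, hgt l s' p < e) -> s' = s.
Proof.
move=> c i; have := (c (true, true), c (true, false), c (false, true), c (false, false)).
have := (i (true, true), i (true, false), i (false, true), i (false, false)); have e0' := e0.
rewrite /hgt /= => -[[[i1 i2] i3] i4] [[[c1 c2] c3] c4].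
have int_eq (m n : int) : (m%:~R : R) < (n + 1)%:~R -> (n%:~R : R) < (m + 1)%:~R -> m = n.
  by rewrite !ltr_int; clear; lia.
have e1 : s'.1 = s.1 by apply: int_eq; rewrite intrD; lra.
have e2 : s'.2 = s.2 by apply: int_eq; rewrite intrD; lra.
by rewrite (surjective_pairing s') e1 e2 -surjective_pairing.
Qed.
End Events.

Section Pattern.
Context {R : realType}.
Implicit Types (t a : R).

Lemma good_nil : good_pattern ([::] : seq (@crossing R)).
Proof. by split. Qed.

Lemma tp_period (F : fieldType) (N : (R -> R * R) -> R -> R -> 'M[F]_2) g (v : int * int) a :
  transport N -> lpath g -> 0 <= a ->
  (forall t, 0 <= t <= a -> g (t + 1) = ((g t).1 + v.1%:~R, (g t).2 + v.2%:~R)) ->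
  \tr (N g a (a + 1)) = \tr (N g 0 1).
Proof.
move=> tN lg a0 per.
have sh : N g 1 (a + 1) = N g 0 a.
  have lh : lpath (fun t => g (t + 1)) by apply: lpath_comp => //; ct.
  have -> : N g 1 (a + 1) = N (fun t => g (t + 1)) 0 a.
    rewrite (tp_aff tN _ _ lg) (tp_aff tN 0 a lh); congr (N _ 0 1); apply: funext => t; congr g; ring.
  have lv : lattice (v.1%:~R, v.2%:~R : R) by rewrite /lattice /= !intr_int.
  rewrite -(tp_shift tN 0 a lg lv); apply: (tp_ext tN a0 lh) => //.
  split=> [|t]; first by have [cg _] := lg; ct.
  by have [_ og] := lg; have := og t; rewrite /offlat /lattice /= !rpredDr ?intr_int.
by rewrite -(tp_mul tN a 1 (a + 1) lg) sh trC (tp_mul tN).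
Qed.

Lemma double_step (e x w k : R) : e < 1 / 4 -> x - k - 1 < e -> k - x < e ->
  x + w + w - k - 1 < e -> k - (x + w + w) < e -> - 2 < x + w + w - x < 2.
Proof. by move=> *; lra. Qed.

Theorem simple_pattern g (d : R) (v : int * int) : lpath g -> 0 < d -> (forall t, margin d (g t)) ->
  (forall t, 0 <= t <= 3 -> g (t + 1) = ((g t).1 + v.1%:~R, (g t).2 + v.2%:~R)) ->
  (forall t t', 0 <= t -> t <= t' -> t' <= 4 -> t' < t + 2 ->
    lattice ((g t').1 - (g t).1, (g t').2 - (g t).2) -> t' = t \/ t' = t + 1) ->
  exists2 W : seq (@crossing R), good_pattern W & forall (F : fieldType) (N : (R -> R * R) -> R -> R -> 'M[F]_2), transport N ->
    \tr (N g 0 1) = \tr (word (@gen R F N (true, true)) (@gen R F N (false, true)) W).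
Proof.
move=> lg d0 mg per simple.
pose e := Num.min (d / 2) (1 / 8).
have e0 : 0 < e by rewrite lt_min; lra.
have [ed1 ed2] : e <= d / 2 /\ e <= 1 / 8 by rewrite !ge_min !lexx orbT.
have e4 : e < 1 / 4 by lra.
have ed : e < d by lra.
clearbody e; clear ed1 ed2.
pose s := (Num.floor (g 0).1, Num.floor (g 0).2).
have hs l : hgt l s (g 0) < e.
  have /andP[f1 f2] := floor_itv (g 0).1; have /andP[f3 f4] := floor_itv (g 0).2.
  by move: f1 f2 f3 f4; rewrite /hgt /s !intrD; case: l => [[] []] /=; lra.
clearbody s.
have perl t l s' : 0 <= t <= 3 -> hgt l (sadd s' v) (g (t + 1)) = hgt l s' (g t).
  by move=> /per ->; exact: hgt_shift.
have lv : lattice (v.1%:~R, v.2%:~R : R) by rewrite /lattice /= !intr_int.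
have trivial a s' : 0 <= a <= 3 -> stays g e s' a (a + 1) -> v = (0, 0) ->
    forall (F : fieldType) (N : (R -> R * R) -> R -> R -> 'M[F]_2), transport N -> \tr (N g 0 1) = 2.
  move=> /andP[a0 a3] st v0 F N tN; rewrite -(tp_period tN lg a0 (v := v)); last by move=> t ht; apply: per; lra.
  have a1 : a <= a + 1 by lra.
  have ls : forall t, a <= t <= a + 1 -> lpath (seg (mid s') (g t)).
    by move=> t ht; apply: seg_lpath => r hr; apply: (box_star e0 e4 ed (mg t)) => // l; apply: ltW; exact: st.
  have st' t r : a <= t <= a + 1 -> 0 <= r <= 1 -> offlat (mix r (mid s') (g t)).
    by move=> ht hr; apply: (box_star e0 e4 ed (mg t)) => // l; apply: ltW; exact: st.
  have := tp_star tN a1 lg st'.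
  rewrite per ?a0 // v0 /= !addr0 -surjective_pairing => h.
  have ha : a <= a <= a + 1 by rewrite lexx.
  have u := tp_unit tN 0 1 (ls a ha).
  have -> : N g a (a + 1) = 1 by apply: (mulrI u); rewrite h mulr1.
  by rewrite mxtrace1.
have triv_end a s' : 0 <= a <= 3 -> stays g e s' a (a + 1) -> v = (0, 0) ->
    exists2 W : seq (@crossing R), good_pattern W & forall (F : fieldType) (N : (R -> R * R) -> R -> R -> 'M[F]_2),
    transport N -> \tr (N g 0 1) = \tr (word (@gen R F N (true, true)) (@gen R F N (false, true)) W).
  move=> h1 h2 h3; exists [::]; first exact: good_nil.
  by move=> F N tN; rewrite (trivial a s') // /word big_nil mxtrace1.
have t02 : (0 : R) <= 2 by lra.
case: (exit_or_stay lg t02 hs) => [st|[l0 [a [a0 a2 st0]]]].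
  apply: (triv_end 0 s); first lra.
    by move=> x hx; apply: st; lra.
  have i0 : 0 <= (0 : R) <= 2 by lra.
  have i2 : 0 <= (1 + 1 : R) <= 2 by lra.
  have q : forall l, hgt l s (g (1 + 1)) < e by move=> l; exact: st.
  have [p0 p1] : 0 <= (0 : R) <= 3 /\ 0 <= (1 : R) <= 3 by split; lra.
  have g1 := per 0 p0; rewrite add0r in g1.
  move: q; rewrite (per 1 p1) g1.
  have st' l := st 0 i0 l.
  rewrite /hgt => q.
  have := (q (true, true), q (true, false), q (false, true), q (false, false)).
  have := (st' (true, true), st' (true, false), st' (false, true), st' (false, false)).
  rewrite /hgt /= => -[[[i1' i2'] i3] i4] [[[c1 c2] c3] c4].
  have z (k : int) (x : R) : - 2 < x + k%:~R + k%:~R - x < 2 -> k = 0.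
    have -> : x + k%:~R + k%:~R - x = (k + k)%:~R :> R by rewrite intrD; ring.
    have -> : 2 = (2%:Z)%:~R :> R by [].
    by rewrite -mulrNz !ltr_int; clear; lia.
  rewrite (surjective_pairing v); congr pair.
    exact: z (double_step e4 i1' i2' c1 c2).
  exact: z (double_step e4 i3 i4 c3 c4).
have ca := step_core e0 e4 ed mg st0.
set s0 := sadd s (dv l0) in ca.
have [||es [s1 ch]] := @chain_ex R g e d lg e0 e4 ed mg a s0 (a + 1) (ltW a0) _ _ ca; [lra|lra|].
have cb : core e (sadd s0 v) (g (a + 1)) by move=> l; rewrite perl //; lra.
have s1E := core_unique e0 cb (chain_end ch).
case: es ch => [|u0 es] ch.
  apply: (triv_end a s0); first lra.
    by have [] := ch.
  have [_ E1 _] := ch; move: s1E; rewrite E1 /s0 /sadd; clear.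
  by case: (v) (s) => x y [p q]; case: (dv l0) => z w /= [h1 h2]; congr pair; lia.
rewrite {}s1E {s1} in ch.
have [M Me HM] := chain_fine lg e0 e4 ed mg ch.
pose e' := Num.max ((M + e) / 2) (e / 2).
have e'0 : 0 < e' by rewrite lt_max; apply/orP; right; lra.
have e'e : e' < e by rewrite gt_max; apply/andP; split; lra.
have Me' : M < e' by rewrite lt_max; apply/orP; left; lra.
have e'4 : e' < 1 / 4 by lra.
have e'd : e' < d by lra.
clearbody e'.
have [||fs ffs mfs] := HM e' e'0 _ a a (lexx a) (lexx a); first by rewrite Me'.
  move=> x /andP[x1 x2] l; have -> : x = a by apply/eqP; rewrite eq_le x1 x2.
  by have := ca l; lra.
case: fs ffs mfs => [|u fs] ffs mfs //.
pose u1 := Ev (ev_l u) (sadd (ev_s u) v) (ev_a u + 1) (ev_b u + 1).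
have [[ua us ui] cu ftl] := ffs; have ub := fine_le ftl.
have [uab hu1 hu2 hu3] := cu.
have box1 t : a + 1 <= t <= ev_b u1 -> inbox e' (sadd s0 v) (g t).
  move=> /= /andP[t1 t2] l; have -> : t = t - 1 + 1 by rewrite subrK.
  by rewrite perl; [apply: ui|]; lra.
have cu1 : crosses g e' u1.
  rewrite /u1; split=> /=; [lra|by rewrite perl //; lra|by rewrite perl //; lra|].
  move=> t ht; have -> : t = t - 1 + 1 by rewrite subrK.
  have ht' : ev_a u <= t - 1 <= ev_b u by lra.
  have [h1 h2] := hu3 _ ht'.
  by split=> [|l]; rewrite perl; [exact: h1|lra|exact: h2|lra].
have au1 : a + 1 < ev_a u1 by rewrite /=; lra.
have su1 : ev_s u1 = sadd s0 v by rewrite /= us.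
have [_ cr lk] := fine_nth ffs au1 su1 box1 cu1.
pose E k := nth u1 (u :: fs) k; pose K := (size fs).+1.
have EK : E K = Ev (ev_l (E 0)) (sadd (ev_s (E 0)) v) (ev_a (E 0) + 1) (ev_b (E 0) + 1) by rewrite /E nth_default.
have perE t : ev_a (E 0) <= t <= ev_b (E 0) -> g (t + 1) = ((g t).1 + v.1%:~R, (g t).2 + v.2%:~R).
  by rewrite /E /= => ht; apply: per; lra.
have simE t t' : ev_a (E 0) <= t -> t <= t' -> t' <= ev_b (E K) ->
    lattice ((g t').1 - (g t).1, (g t').2 - (g t).2) -> t' = t \/ t' = t + 1.
  have [r1 r2 r3] : [/\ 0 <= ev_a u, ev_b u + 1 <= 4 & ev_b u + 1 < ev_a u + 2] by split; lra.
  rewrite EK /E /= => h1 h2 h3; apply: simple => //; first exact: le_trans r1 h1.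
    exact: le_trans h3 r2.
  by apply: lt_le_trans (le_lt_trans h3 r3) _; rewrite lerD2r.
exists (marks g E K); first by apply: (marks_good (proj1 lg) e'0 e'4 e'd mg cr lk EK perE simE).
move=> F N tN; rewrite -(tp_period tN lg (ltW a0) (v := v)); last by move=> t ht; apply: per; lra.
have := chain_word lg e0 e4 ed mg tN ch.
have ls : lpath (seg (mid s0) (g a)).
  by apply: seg_lpath => r hr; apply: (box_star e0 e4 ed (mg a)) => //; exact: core_inbox.
have -> : seg (mid (sadd s0 v)) (g (a + 1)) = seg ((mid s0).1 + v.1%:~R, (mid s0).2 + v.2%:~R) ((g a).1 + v.1%:~R, (g a).2 + v.2%:~R).
  by rewrite per; [congr seg; rewrite /mid /sadd /= !intrD; congr pair; ring|lra].
rewrite (tp_seg_shift tN lv ls) => hw.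
have dS := tp_det tN 0 1 ls; have uS := tp_unit tN 0 1 ls.
rewrite -(tr_conj _ dS) hw mulrK //; congr (\tr _).
rewrite /word /marks big_map.
have -> : \prod_(k <- iota 0 K) letter (@gen R F N (true, true)) (@gen R F N (false, true)) (mark g E k).1 =
    \prod_(l <- map (@ev_l R) (u :: fs)) letter (@gen R F N (true, true)) (@gen R F N (false, true)) l.
  by rewrite -[in RHS](mkseq_nth u1 (u :: fs)) /mkseq -map_comp big_map.
by rewrite mfs big_map.
Qed.
End Pattern.

(** * Lifts of curves and homotopies *)

Section Lifting.
Context {R : realType}.
Implicit Types (u w p : R * R) (x t : R).

Definition turn u w : R := atan ((u.1 * w.2 - u.2 * w.1) / (u.1 * w.1 + u.2 * w.2)) / (2 * pi).

Lemma circ_turn u w x : circle R w -> circ x = u -> 0 < u.1 * w.1 + u.2 * w.2 ->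
  circ (x + turn u w) = w.
Proof.
rewrite /circle /= => cw; case: u => u1 u2 [c s]; rewrite /turn /=; case: w cw => w1 w2 /= cw.
have cu : u1 ^+ 2 + u2 ^+ 2 = 1 by rewrite -c -s cos2Dsin2.
set D := u1 * w1 + _; set C := u1 * w2 - _ => D0.
have DC : D ^+ 2 + C ^+ 2 = 1 by rewrite -[1]mulr1 -{1}cu -cw /D /C; ring.
have D0' : D != 0 by rewrite gt_eqF.
have ca : cos (atan (C / D)) = D.
  rewrite cos_atan; have -> : 1 + (C / D) ^+ 2 = (D^-1) ^+ 2.
    rewrite expr_div_n exprVn -{1}(divff (_ : D ^+ 2 != 0)) ?expf_neq0 // -mulrDl DC mul1r.
    by [].
  by rewrite sqrtr_sqr ger0_norm ?invr_ge0 ?ltW // invrK.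
have sa : sin (atan (C / D)) = C.
  have := atanK (C / D); rewrite /tan ca => /(congr1 ( *%R^~ D)).
  by rewrite /= !divfK.
have pi0 : (2 * pi : R) != 0 by rewrite mulf_neq0 ?pnatr_eq0 // gt_eqF // pi_gt0.
rewrite /circ mulrDr (mulrC _ (_ / _)) divfK // cosD sinD ca sa c s /C /D; congr pair.
  have -> : u1 * (u1 * w1 + u2 * w2) - u2 * (u1 * w2 - u2 * w1) = (u1 ^+ 2 + u2 ^+ 2) * w1 by ring.
  by rewrite cu mul1r.
have -> : u2 * (u1 * w1 + u2 * w2) + u1 * (u1 * w2 - u2 * w1) = (u1 ^+ 2 + u2 ^+ 2) * w2 by ring.
by rewrite cu mul1r.
Qed.

Lemma circ_onto w : circle R w -> exists x, circ x = w.
Proof.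
move=> cw; have cw' : w.1 ^+ 2 + w.2 ^+ 2 = 1 by [].
have h1 : circ (1 / 2 : R) = (-1, 0).
  by have := circ_half (0 : R); rewrite addr0 mulr0 cos0 sin0 oppr0.
have h2 : circ (1 / 4 : R) = (0, 1).
  rewrite /circ; have -> : 2 * pi * (1 / 4) = pi / 2 :> R by field.
  by rewrite cos_pihalf sin_pihalf.
have h3 : circ (- (1 / 4) : R) = (0, -1).
  by move: h2; rewrite /circ mulrN cosN sinN => -[-> ->].
have go u x : circ x = u -> 0 < u.1 * w.1 + u.2 * w.2 -> exists x, circ x = w.
  by move=> h1' h2'; exists (x + turn u w); exact: circ_turn.
case: (ltgtP w.1 0) => w1.
- by apply: (go _ _ h1); rewrite /= mulN1r mul0r addr0 oppr_gt0.
- by apply: (go _ _ (@circ0 R)); rewrite /= mul1r mul0r addr0.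
case: (ltgtP w.2 0) => w2.
- by apply: (go _ _ h3); rewrite /= mulN1r mul0r add0r oppr_gt0.
- by apply: (go _ _ h2); rewrite /= mul1r mul0r add0r.
by exfalso; move: cw'; rewrite w1 w2 expr0n /= addr0 => /eqP; rewrite eq_sym oner_eq0.
Qed.

Lemma ct_atan (T : topologicalType) (f : T -> R) : continuous f -> continuous (fun y => atan (f y)).
Proof. by move=> cf; apply: (ct_comp (h := atan)) => // y; exact: continuous_atan. Qed.

Lemma ct_turn (T : topologicalType) (f h : T -> R * R) : continuous f -> continuous h ->
  (forall y, 0 < (f y).1 * (h y).1 + (f y).2 * (h y).2) -> continuous (fun y => turn (f y) (h y)).
Proof.
move=> cf ch pos; rewrite /turn.
have c1 : continuous (fun y => (f y).1) by ct.
have c2 : continuous (fun y => (f y).2) by ct.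
have c3 : continuous (fun y => (h y).1) by ct.
have c4 : continuous (fun y => (h y).2) by ct.
apply: ct_mul; last exact: ct_cst.
apply: ct_atan; apply: ct_mul; first by apply: ct_add; [exact: ct_mul|apply: ct_opp; exact: ct_mul].
apply: ct_inv; first by move=> y; rewrite gt_eqF.
by apply: ct_add; exact: ct_mul.
Qed.

Definition clamp2 p : R * R := (kap p.1, kap p.2).

(* The lift is obtained by following the ray from the origin. *)
Lemma circle_lift (P : R * R -> R * R) : continuous P -> (forall p, circle R (P p)) ->
  exists2 f : R * R -> R, continuous f & forall p, circ (f p) = P (clamp2 p).
Proof.
move=> cP oP; have c1 : continuous (fun p => (P p).1) by ct.
have c2 : continuous (fun p => (P p).2) by ct.
have h0 : 0 < 1 / 2 :> R by lra.
have [d1 d10 H1] := unif_cont (@unit_square_compact R) c1 h0.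
have [d2 d20 H2] := unif_cont (@unit_square_compact R) c2 h0.
pose d := Num.min d1 d2; have d0 : 0 < d by rewrite lt_min d10.
pose n := (Num.bound d^-1).+1.
have nd : 1 / n%:R < d.
  rewrite ltr_pdivrMr ?ltr0n // mulrC -ltr_pdivrMr // div1r.
  by apply: lt_trans (archi_boundP (ltW _)) _; rewrite ?invr_gt0 // ltr_nat.
have [x0 hx0] := circ_onto (oP (0, 0)).
pose Q (k : nat) p := P (k%:R / n%:R * kap p.1, k%:R / n%:R * kap p.2).
have cQ k : continuous (Q k) by apply: (ct_comp cP); ct.
have pos k p : (k < n)%N -> 0 < (Q k p).1 * (Q k.+1 p).1 + (Q k p).2 * (Q k.+1 p).2.
  move=> kn; have n0 : 0 < n%:R :> R by rewrite ltr0n.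
  have kle j : (j <= n)%N -> 0 <= (j%:R / n%:R : R) <= 1.
    by move=> jn; rewrite divr_ge0 ?ler0n //= ler_pdivrMr // mul1r ler_nat.
  have hk := kle k (ltnW kn); have k1 := kap_in p.1; have k2 := kap_in p.2.
  have step : k.+1%:R / n%:R = k%:R / n%:R + 1 / n%:R :> R by rewrite -natr1 mulrDl.
  have n1 : 0 <= 1 / n%:R :> R by rewrite divr_ge0.
  have inK : ([set` `[(0:R), 1]] `*` [set` `[(0:R), 1]]) (k%:R / n%:R * kap p.1, k%:R / n%:R * kap p.2).
    by split; rewrite /= in_itv /=; nra.
  have bl dd : d <= dd -> ball (k%:R / n%:R * kap p.1, k%:R / n%:R * kap p.2) dd
      (k.+1%:R / n%:R * kap p.1, k.+1%:R / n%:R * kap p.2).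
    move=> hd; split; rewrite /ball /= step mulrDl opprD addrA subrr sub0r normrN ger0_norm; nra.
  have := H1 _ _ inK (bl d1 _); have := H2 _ _ inK (bl d2 _).
  rewrite !ge_min !lexx orbT => /(_ isT) a2 /(_ isT) a1.
  have oa : (Q k p).1 ^+ 2 + (Q k p).2 ^+ 2 = 1 := oP _.
  have ob : (Q k.+1 p).1 ^+ 2 + (Q k.+1 p).2 ^+ 2 = 1 := oP _.
  move: a1 a2 oa ob; rewrite -!/(Q _ _); move: (Q k p) (Q k.+1 p) => [x y] [z w] /=.
  rewrite !ltr_norml => /andP[a1 a2] /andP[a3 a4] oa ob; nra.
pose f (m : nat) p : R := x0 + \sum_(k <- iota 0 m) turn (Q k p) (Q k.+1 p).
have fS m p : f m.+1 p = f m p + turn (Q m p) (Q m.+1 p).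
  by rewrite /f -[in iota _ _]addn1 iotaD big_cat /= big_seq1 add0n addrA.
have hf m p : (m <= n)%N -> circ (f m p) = Q m p.
  elim: m => [|m IH] mn; first by rewrite /f /= big_nil addr0 hx0 /Q !mul0r.
  have -> : f m.+1 p = f m p + turn (Q m p) (Q m.+1 p).
    exact: fS.
  by apply: circ_turn; [exact: oP|exact: IH (ltnW mn)|exact: pos].
exists (f n); last by move=> p; rewrite hf // /Q divff ?pnatr_eq0 // !mul1r.
have cf m : (m <= n)%N -> continuous (f m).
  elim: m => [|m IH] mn.
    have -> : f 0%N = fun _ => x0 by apply: funext => p; rewrite /f big_nil addr0.
    exact: ct_cst.
  have -> : f m.+1 = fun p => f m p + turn (Q m p) (Q m.+1 p).
    by apply: funext => p; exact: fS.
  apply: ct_add; first exact: IH (ltnW mn).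
  by apply: ct_turn; [exact: cQ|exact: cQ|move=> p; exact: pos].
exact: cf.
Qed.
End Lifting.

Section CurveLifts.
Context {R : realType}.
Implicit Types (p : R * R) (t s : R) (c d : curve R).

Lemma ct_clamp2 : continuous (@clamp2 R).
Proof. by rewrite /clamp2; ct. Qed.

Lemma torus_lift (P : R * R -> (R * R) * (R * R)) : continuous P -> (forall p, ptorus R (P p)) ->
  exists2 G : R * R -> R * R, continuous G & forall p, torus_pt (G p) = P (clamp2 p) /\ offlat (G p).
Proof.
move=> cP oP.
have c1 : continuous (fun p => (P p).1) by ct.
have c2 : continuous (fun p => (P p).2) by ct.
have o1 p : circle R (P p).1 by case: (oP p) => -[].
have o2 p : circle R (P p).2 by case: (oP p) => -[].
have [f cf hf] := circle_lift c1 o1; have [h ch hh] := circle_lift c2 o2.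
exists (fun p => (f p, h p)); first by ct.
have E p : torus_pt (f p, h p) = P (clamp2 p).
  by rewrite /torus_pt /= hf hh -surjective_pairing.
move=> p; split=> //; apply/negP => /torus_pt_puncture; rewrite E => hp.
by case: (oP (clamp2 p)) => _; apply.
Qed.

Definition lift_of c (g : R -> R * R) := lpath g /\ forall t, 0 <= t <= 1 -> torus_pt (g t) = c t.

Lemma int_const (f : R -> R) a b : continuous f -> a <= b -> (forall t, a <= t <= b -> f t \is a Num.int) -> f a = f b.
Proof.
move=> cf ab fi.
have half x : x \is a @Num.int R -> x + 1 / 2 \isn't a Num.int.
  move=> /intrP[m ->]; apply/negP => /intrP[k hk].
  by apply: (@int_strict R m k _ _ hk); rewrite intrD; lra.
have haa : a <= a <= b by rewrite lexx.
have hbb : a <= b <= b by rewrite lexx andbT.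
have fia := fi a haa; have fib := fi b hbb.
have gap x y : x \is a @Num.int R -> y \is a Num.int -> x < y -> x + 1 / 2 <= y.
  move=> /intrP[m ->] /intrP[k ->]; rewrite ltr_int => mk.
  have : ((m + 1)%:~R : R) <= k%:~R by rewrite ler_int; lia.
  by rewrite intrD; lra.
case: (ltgtP (f a) (f b)) => // h.
  have h1 := gap _ _ fia fib h.
  have [|x xab hx] := ivt (v := f a + 1 / 2) cf ab; first by left; rewrite h1; lra.
  by have := half _ fia; rewrite -hx fi.
have h1 := gap _ _ fib fia h.
have [|x xab hx] := ivt (v := f b + 1 / 2) cf ab; first by right; rewrite h1; lra.
by have := half _ fib; rewrite -hx fi.
Qed.
Lemma within_ct (T U V : topologicalType) (A : set U) (phi : T -> U) (f : U -> V) :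
  continuous phi -> (forall x, A (phi x)) -> {within A, continuous f} -> continuous (fun x => f (phi x)).
Proof.
move=> cp Ap cf; apply/continuous_subspace_setT.
by apply: (within_comp (A := setT) cp _ cf) => x _.
Qed.

Lemma kap01 t : t \in `[0, 1] -> kap t = t.
Proof. by rewrite in_itv /= => ?; exact: kap_id. Qed.

Lemma kap_itv t : kap t \in `[(0 : R), 1].
Proof. by rewrite in_itv /=; exact: kap_in. Qed.

Lemma curve_lift c : closed_curve c -> exists2 g, lift_of c g & forall t, g t = g (kap t).
Proof.
move=> [cc oc _].
have cP : continuous (fun p : R * R => c (kap p.2)).
  have ck : continuous (fun p : R * R => kap p.2) by ct.
  by apply: (within_ct ck _ cc) => p; exact: kap_itv.
have [|G cG hG] := torus_lift cP; first by move=> p; apply: oc; exact: kap_itv.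
exists (fun t => G (0, kap t)); last by move=> t; rewrite [kap (kap t)]kap01 // kap_itv.
split; first by split=> [|t]; [ct|by case: (hG (0, kap t))].
move=> t t01; have [-> _] := hG (0, kap t); rewrite /clamp2 /= !(kap_id (kap_in _)) kap_id //.
Qed.

Lemma lpath_shift g v : lpath g -> lattice v -> lpath (fun t => ((g t).1 + v.1, (g t).2 + v.2)).
Proof.
move=> [cg og] /andP[v1 v2]; split=> [|t]; first by ct.
by have := og t; rewrite /offlat /lattice /= !rpredDr.
Qed.

Lemma lattice_const (f : R -> R * R) : continuous f -> (forall t, 0 <= t <= 1 -> lattice (f t)) ->
  forall t, 0 <= t <= 1 -> f t = f 0.
Proof.
move=> cf lf t /andP[t0 t1].
have c1 : continuous (fun t => (f t).1) by ct.
have c2 : continuous (fun t => (f t).2) by ct.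
have sub x : 0 <= x <= t -> lattice (f x) by move=> h; apply: lf; lra.
rewrite (surjective_pairing (f 0)) (int_const c1 t0) => [|x /sub/andP[]//].
by rewrite (int_const c2 t0) => [|x /sub/andP[]//]; rewrite -surjective_pairing.
Qed.

Lemma lift_translate g h : lpath g -> lpath h ->
  (forall t, 0 <= t <= 1 -> torus_pt (g t) = torus_pt (h t)) ->
  exists2 v, lattice v & forall t, 0 <= t <= 1 -> g t = ((h t).1 + v.1, (h t).2 + v.2).
Proof.
move=> lg lh gh; have [[cg og] [ch oh]] := (lg, lh).
pose f t := ((g t).1 - (h t).1, (g t).2 - (h t).2).
have cf : continuous f by rewrite /f; ct.
have lf t : 0 <= t <= 1 -> lattice (f t) by move=> /gh /torus_pt_eq.
have l0 : lattice (f 0) by apply: lf; rewrite lexx ler01.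
have E t : 0 <= t <= 1 -> g t = ((h t).1 + (f 0).1, (h t).2 + (f 0).2).
  by move=> t01; rewrite -(lattice_const cf lf t01) /f /= ![_.1 + (_ - _)]addrC ![_.2 + (_ - _)]addrC !subrK -surjective_pairing.
by exists (f 0).
Qed.

Lemma lift_closed c g : closed_curve c -> lift_of c g -> lattice ((g 1).1 - (g 0).1, (g 1).2 - (g 0).2).
Proof.
move=> [_ _ c01] [_ gc]; apply/torus_pt_eq.
by rewrite !gc ?c01 ?lexx ?ler01.
Qed.

Lemma homotopy_lift c d : freely_homotopic c d -> exists (G : R * R -> R * R) v,
  [/\ continuous G, lattice v, lift_of c (fun t => G (0, t)), lift_of d (fun t => G (1, t)) &
   (forall p, offlat (G p)) /\ forall s, 0 <= s <= 1 -> G (s, 1) = ((G (s, 0)).1 + v.1, (G (s, 0)).2 + v.2)].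
Proof.
move=> [H [[cH oH H0 H1] Hs]].
have cP : continuous (fun p : R * R => H (clamp2 p)).
  by apply: (within_ct ct_clamp2 _ cH) => p; split; exact: kap_itv.
have [|G cG hG] := torus_lift cP; first by move=> p; apply: oH; exact: kap_itv.
have E p : torus_pt (G p) = H (clamp2 p).
  by have [-> _] := hG p; rewrite /clamp2 /= !(kap_id (kap_in _)).
have oG p : offlat (G p) by have [] := hG p.
have lG (f : R -> R * R) : continuous f -> lpath (fun t => G (f t)) by move=> cf; split=> //; ct.
have cl x : continuous (fun t : R => (x : R, t)) by ct.
have cr x : continuous (fun t : R => (t, x : R)) by ct.
have gG : lift_of c (fun t => G (0, t)).
  split=> [|t t01]; first by apply: (lG (fun t => (_, t))).
  by rewrite E /clamp2 /= kap0 // kap_id // H0 // in_itv /=.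
have hG' : lift_of d (fun t => G (1, t)).
  split=> [|t t01]; first by apply: (lG (fun t => (_, t))).
  by rewrite E /clamp2 /= kap1 // kap_id // H1 // in_itv /=.
have l0 : lpath (fun t => G (t, 0)) by apply: (lG (fun t => (t, 0))).
have l1 : lpath (fun t => G (t, 1)) by apply: (lG (fun t => (t, 1))).
have [|v lv Gv] := lift_translate l1 l0.
  by move=> t t01; rewrite !E /clamp2 /= (kap0 (lexx 0)) (kap1 (lexx 1)) kap_id // Hs // in_itv /=.
exists G, v; split=> //.
Qed.

Section Holonomy.
Context {F : fieldType} {N : (R -> R * R) -> R -> R -> 'M[F]_2}.
Hypothesis tN : transport N.

Lemma lift_shift g h : lpath g -> lpath h ->
  (forall t, 0 <= t <= 1 -> torus_pt (g t) = torus_pt (h t)) -> N g 0 1 = N h 0 1.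
Proof.
move=> lg lh gh; have [v lv E] := lift_translate lg lh gh.
rewrite -(tp_shift tN 0 1 lh lv); apply: (tp_ext tN ler01 lg) => //; exact: lpath_shift.
Qed.

Lemma lift_unique c g h : lift_of c g -> lift_of c h -> N g 0 1 = N h 0 1.
Proof.
move=> [lg gc] [lh hc]; apply: lift_shift => //.
by move=> t t01; rewrite gc ?hc.
Qed.

Lemma free_homotopy_trace c d g h : freely_homotopic c d -> lift_of c g -> lift_of d h ->
  \tr (N g 0 1) = \tr (N h 0 1).
Proof.
move=> cd lg lh; have [G [v [cG lv gG hG [oG Gv]]]] := homotopy_lift cd.
rewrite (lift_unique lg gG) (lift_unique lh hG).
have cs : continuous (fun p : R * R => G (p.2, p.1)) by apply: (ct_comp cG); ct.
rewrite (tp_square tN cs (fun p => oG _)) /=.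
have l0 : lpath (fun t => G (t, 0)) by split=> [|t]; [apply: (ct_comp cG); ct|exact: oG].
have l1 : lpath (fun t => G (t, 1)) by split=> [|t]; [apply: (ct_comp cG); ct|exact: oG].
have -> : N (fun t => G (t, 1)) 0 1 = N (fun t => G (t, 0)) 0 1.
  rewrite -(tp_shift tN 0 1 l0 lv); apply: (tp_ext tN ler01 l1) => //; exact: lpath_shift.
by rewrite tr_conj // (tp_det tN).
Qed.

End Holonomy.

End CurveLifts.

Section Traces.
Context {R : realType}.
Implicit Types (p : R * R) (t s : R) (c d : curve R).

Lemma hat_loop c g : closed_curve c -> lift_of c g ->
  is_loop (fun t => torus_pt (hat g 0 1 (3 * t))) /\ freely_homotopic c (fun t => torus_pt (hat g 0 1 (3 * t))).
Proof.
move=> cc lc; have [lg gc] := lc; split; first exact: loop_hat.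
have lv := lift_closed cc lc; have ch := @ct_hat R g 0 1 lg.1.
exists (fun p => torus_pt (hat g 0 1 ((1 - p.1) + p.2 * (1 + 2 * p.1)))); split; first split.
- apply: continuous_subspaceT; apply: ct_torus_pt; apply: (ct_comp ch); ct.
- by move=> s t _ _; apply: ptorus_torus_pt; exact: hat_offlat.
- move=> t; rewrite in_itv /= subr0 mulr0 addr0 mulr1 => t01.
  case: (hat_cases g 0 1 (1 + t)) => -[h ->].
  + have -> : t = 0 by lra.
    by rewrite addr0 kap1 // mix1 gc // lexx ler01.
  + by rewrite subr0 mulr1 add0r addrAC subrr add0r kap_id // gc.
  + have -> : t = 1 by lra.
    by rewrite kap0 ?mix0 ?gc ?lexx ?ler01 //; lra.
- by move=> t _ /=; congr (torus_pt (hat _ _ _ _)); ring.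
move=> s; rewrite in_itv /= => s01.
have -> : 1 - s + 0 * (1 + 2 * s) = 1 - s by ring.
have -> : 1 - s + 1 * (1 + 2 * s) = 2 + s by ring.
set v := (_, _) in lv.
have g1 : g 1 = ((g 0).1 + v.1, (g 0).2 + v.2) by rewrite /v /= !subrKC -surjective_pairing.
have E0 : hat g 0 1 (1 - s) = mix (1 - s) (cell_centre (g 0)) (g 0).
  case: (hat_cases g 0 1 (1 - s)) => -[h ->].
  - by rewrite kap_id //; lra.
  - by rewrite kap0 ?mul0r ?addr0; [have -> : 1 - s = 1 by lra|lra]; rewrite mix1.
  - by exfalso; lra.
have E1 : hat g 0 1 (2 + s) = mix (1 - s) (cell_centre (g 1)) (g 1).
  case: (hat_cases g 0 1 (2 + s)) => -[h ->].
  - by exfalso; lra.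
  - by rewrite kap1 ?mul1r ?add0r ?subr0; [have -> : s = 0 by lra|lra]; rewrite subr0 mix1.
  - by rewrite mixC kap_id addrAC subrr add0r.
clearbody v; rewrite E0 E1 g1 cell_centre_shift //; rewrite -(torus_pt_shift _ lv); congr torus_pt.
by rewrite /mix /=; congr pair; ring.
Qed.

Lemma reverse_lift c g : lift_of c g -> lift_of (reverse c) (fun t => g (1 - t)).
Proof.
move=> [lg gc]; split; first by apply: lpath_comp => //; ct.
by move=> t t01; rewrite gc //; lra.
Qed.

Lemma curve_trace_lift (rho : representation R) c g : closed_curve c -> lift_of c g ->
  curve_trace rho (unoriented_class c) = \tr (holonomy rho g 0 1).
Proof.
move=> cc lc; have tN := holonomy_transport rho; have [ll fl] := hat_loop cc lc.
rewrite /curve_trace; set d := xget _ _.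
have [ld cd] : is_loop d /\ unoriented_class c d.
  by apply: (@xgetPex _ (fun=> basepoint R) [set c0 | is_loop c0 /\ unoriented_class c c0]); exists (fun t => torus_pt (hat g 0 1 (3 * t))); split=> //; left.
have [h lh _] := curve_lift ld.1; have [lph hd] := lh.
rewrite (rho_lift rho ld lph hd); case: cd => cd.
  exact: esym (free_homotopy_trace tN cd lc lh).
rewrite (free_homotopy_trace tN cd lc (reverse_lift lh)).
have -> : holonomy rho (fun t => h (1 - t)) 0 1 = holonomy rho h 1 0.
  by rewrite (tp_aff tN 1 0 lph); congr (holonomy _ _ 0 1); apply: funext => t; congr h; ring.
by rewrite (tp_rev tN) // tr_inv // (tp_det tN).
Qed.

Definition unroll (g : R -> R * R) t : R * R :=
  let f k := g (kap (t - k)) in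
  ((f 0).1 + ((f 1).1 - (g 0).1) + ((f 2).1 - (g 0).1) + ((f 3).1 - (g 0).1),
   (f 0).2 + ((f 1).2 - (g 0).2) + ((f 2).2 - (g 0).2) + ((f 3).2 - (g 0).2)).

Lemma ct_unroll g : continuous g -> continuous (unroll g).
Proof. by move=> cg; rewrite /unroll /=; ct. Qed.

Lemma unrollE g v (k : nat) t : g 1 = ((g 0).1 + v.1, (g 0).2 + v.2) -> (k < 4)%N -> k%:R <= t <= k%:R + 1 ->
  unroll g t = ((g (t - k%:R)).1 + k%:R * v.1, (g (t - k%:R)).2 + k%:R * v.2).
Proof.
move=> g1 k4 /andP[h1 h2].
have lo j : t <= j -> g (kap (t - j)) = g 0 by move=> h; rewrite kap0 //; lra.
have hi j : j + 1 <= t -> g (kap (t - j)) = ((g 0).1 + v.1, (g 0).2 + v.2) by move=> h; rewrite kap1 ?g1 //; lra.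
have me : g (kap (t - k%:R)) = g (t - k%:R) by rewrite kap_id //; lra.
case: k k4 h1 h2 me => [|[|[|[|k]]]] // _ h1 h2 me; rewrite /unroll me.
- by rewrite !lo; [congr pair; ring|lra|lra|lra].
- by rewrite (hi 0) ?(lo 2) ?(lo 3); [cbn [fst snd]; congr pair; ring|lra|lra|lra].
- by rewrite (hi 0) ?(hi 1) ?(lo 3); [cbn [fst snd]; congr pair; ring|lra|lra|lra].
- by rewrite (hi 0) ?(hi 1) ?(hi 2); [cbn [fst snd]; congr pair; ring|lra|lra|lra].
Qed.

Lemma unroll_clamp g t : unroll g t = unroll g (clamp 0 4 t).
Proof.
have c04 : 0 <= (4 : R) by lra.
case: (leP t 0) => t0.
  by rewrite clamp_le // /unroll !kap0 //; lra.
case: (leP 4 t) => t4; last by rewrite clamp_id //; lra.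
by rewrite clamp_ge // /unroll !kap1 //; lra.
Qed.

Lemma nat_cover (n : nat) t : 0 <= t <= n.+1%:R -> exists2 k : nat, (k < n.+1)%N & k%:R <= t <= k%:R + 1.
Proof.
elim: n => [|n IH] /andP[t0 t1]; first by exists 0%N => //; rewrite t0 add0r.
case: (leP t n.+1%:R) => h; last by exists n.+1 => //; rewrite (ltW h) natr1.
by have [|k kn hk] := IH; [rewrite t0|exists k => //; exact: leqW].
Qed.

Lemma unroll_lift c g : closed_curve c -> lift_of c g ->
  [/\ lpath (unroll g), lift_of c (unroll g) &
   forall t, 0 <= t <= 3 -> unroll g (t + 1) = ((unroll g t).1 + ((g 1).1 - (g 0).1), (unroll g t).2 + ((g 1).2 - (g 0).2))].
Proof.
move=> cc lc; have [[cg og] gc] := lc; have lv := lift_closed cc lc.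
set v := (_, _) in lv; have /andP[v1 v2] := lv.
have g1 : g 1 = ((g 0).1 + v.1, (g 0).2 + v.2) by rewrite /v /= !subrKC -surjective_pairing.
have lp : lpath (unroll g).
  split=> [|t]; first exact: ct_unroll.
  rewrite unroll_clamp; have [|k k4 hk] := @nat_cover 3 (clamp 0 4 t); first by apply: clamp_in; lra.
  rewrite (unrollE g1 k4 hk) /offlat /lattice /= !rpredDr ?rpredM ?rpred_nat //; exact: og.
split=> //.
  split=> // t t01; rewrite (@unrollE g v 0%N t g1) // ?add0r // !mul0r !addr0 subr0.
  by rewrite -surjective_pairing gc.
move=> t t03; have [|k k3 hk] := @nat_cover 2 t; first lra.
have k4 : (k < 4)%N by exact: leqW.
rewrite (unrollE g1 k4 hk) (@unrollE g v k.+1 (t + 1) g1) //; last by rewrite -natr1; lra.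
have -> : t + 1 - k.+1%:R = t - k%:R by rewrite -natr1; ring.
by rewrite -natr1 /v; cbn [fst snd]; congr pair; ring.
Qed.

Lemma lpath_margin g : lpath g -> (forall t, g t = g (clamp 0 4 t)) -> exists2 d : R, 0 < d & forall t, margin d (g t).
Proof.
move=> [cg og] gg.
pose f t : R := (1 - cos (2 * pi * (g t).1)) + (1 - cos (2 * pi * (g t).2)).
have ccos (h : R -> R) : continuous h -> continuous (fun t => cos (2 * pi * h t)).
  by move=> ch; apply: (ct_comp (h := cos)); [move=> x; exact: continuous_cos|ct].
have c1 : continuous (fun t => (g t).1) by ct.
have c2 : continuous (fun t => (g t).2) by ct.
have cf : continuous f.
  by apply: ct_add; apply: ct_add; try exact: ct_cst; apply: ct_opp; exact: ccos.
have fpos t : 0 < f t.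
  have k1 := cos_le1 (2 * pi * (g t).1); have k2 := cos_le1 (2 * pi * (g t).2).
  rewrite lt_neqAle; apply/andP; split; last by rewrite /f; lra.
  apply/negP => /eqP f0; have := og t; apply/negP; rewrite negbK; apply/torus_pt_puncture.
  have h1 : cos (2 * pi * (g t).1) = 1 by move: f0; rewrite /f; lra.
  have h2 : cos (2 * pi * (g t).2) = 1 by move: f0; rewrite /f; lra.
  have s0 x : cos x = 1 -> sin x = 0 :> R.
    by move=> hc; have := cos2Dsin2 x; rewrite hc expr1n => /eqP; rewrite -subr_eq0 addrAC subrr add0r sqrf_eq0 => /eqP.
  by rewrite /torus_pt /circ h1 h2 !s0.
have c04 : 0 <= (4 : R) by lra.
have [c _ hc] := EVT_min c04 (continuous_subspaceT cf).
have mu t : f c <= f t.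
  by rewrite /f (gg t); apply: hc; rewrite in_itv /=; exact: clamp_in.
have ctb : continuous (fun x : R => 1 - cos (2 * pi * x)) by apply: ct_add; [exact: ct_cst|apply: ct_opp; apply: (ccos id); exact: ct_id].
have fc2 : 0 < f c / 2 by rewrite divr_gt0.
have [d d0 hd] := unif_cont (@segment_compact R (-1) 1) ctb fc2.
exists d => // t m n /intrP[m' ->] /intrP[n' ->].
have per x (k : int) : cos (2 * pi * x) = cos (2 * pi * (x - k%:~R)) :> R.
  by have [-> _] : circ x = circ (x - k%:~R) by rewrite -mulrNz circ_int.
have near0 x : - d < x < d -> 1 - cos (2 * pi * x) < f c / 2.
  move=> xd; have z : [set` `[(-1 : R), 1]] 0 by rewrite /= in_itv /=; lra.
  have := hd 0 x z; rewrite mulr0 cos0 subrr sub0r normrN => H.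
  apply: le_lt_trans (ler_norm _) (H _); rewrite /ball /= sub0r normrN ltr_norml //.
case: (leP d ((g t).1 - m'%:~R)) => a1; first by constructor 1.
case: (leP ((g t).1 - m'%:~R) (- d)) => a2; first by constructor 2.
case: (leP d ((g t).2 - n'%:~R)) => a3; first by constructor 3.
case: (leP ((g t).2 - n'%:~R) (- d)) => a4; first by constructor 4.
exfalso; have := mu t; rewrite leNgt => /negP; apply.
rewrite /f (per _ m') (per (g t).2 n').
have := near0 ((g t).1 - m'%:~R); rewrite a1 a2 => /(_ isT) b1.
have := near0 ((g t).2 - n'%:~R); rewrite a3 a4 => /(_ isT) b2.
by move: b1 b2; rewrite /f; lra.
Qed.
End Traces.

Section SimpleCurves.
Context {R : realType}.
Implicit Types (p : R * R) (t s : R) (c d : curve R).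

Definition genX (F : fieldType) (N : (R -> R * R) -> R -> R -> 'M[F]_2) := gen (N := N) (true, true).
Definition genY (F : fieldType) (N : (R -> R * R) -> R -> R -> 'M[F]_2) := gen (N := N) (false, true).

Lemma simple_curve_pattern c : simple_closed_curve c -> exists2 W : seq (@crossing R), good_pattern W &
  forall rho : representation R,
    curve_trace rho (unoriented_class c) = \tr (word (genX (holonomy rho)) (genY (holonomy rho)) W).
Proof.
move=> [cc inj]; have [g lg _] := curve_lift cc.
have [lu luc per] := unroll_lift cc lg; have lv := lift_closed cc lg.
have [d d0 md] := lpath_margin lu (@unroll_clamp R g).
have /andP[/intrP[m hm] /intrP[n hn]] := lv; cbn [fst snd] in hm, hn.
rewrite hm hn in per.
have [_ _ c01] := cc; have [_ gc] := lg.
have pos t : 0 <= t <= 4 -> exists2 k : nat, 0 <= t - k%:R < 1 & torus_pt (unroll g t) = c (t - k%:R).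
  move=> t04; have [|k k4 hk] := @nat_cover R 3 t; first exact: t04.
  have g1 : g 1 = ((g 0).1 + ((g 1).1 - (g 0).1, (g 1).2 - (g 0).2).1, (g 0).2 + ((g 1).1 - (g 0).1, (g 1).2 - (g 0).2).2).
    by rewrite /= !subrKC -surjective_pairing.
  have E : torus_pt (unroll g t) = c (t - k%:R).
    rewrite (unrollE g1 k4 hk).
    have lk : lattice (k%:R * (m%:~R : R), k%:R * n%:~R : R) by rewrite /lattice /= !rpredM ?rpred_nat ?intr_int.
    cbn [fst snd]; rewrite hm hn; have := torus_pt_shift (g (t - k%:R)) lk; cbn [fst snd] => ->.
    by rewrite gc //; lra.
  case: (ltP t (k%:R + 1)) => tk; first by exists k; rewrite // ltrBlDl; lra.
  have tk' : t = k.+1%:R by rewrite -natr1; lra.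
  exists k.+1; first by rewrite tk' subrr lexx ltr01.
  by rewrite E tk' subrr -natr1 addrAC subrr add0r c01.
have sim t t' : 0 <= t -> t <= t' -> t' <= 4 -> t' < t + 2 ->
    lattice ((unroll g t').1 - (unroll g t).1, (unroll g t').2 - (unroll g t).2) -> t' = t \/ t' = t + 1.
  move=> t0 tt t4 t2 /torus_pt_eq.
  have [|k hk ->] := pos t; first lra.
  have [|k' hk' ->] := pos t'; first lra.
  move=> /inj; rewrite !in_itv /= hk hk' => /(_ isT isT) E.
  have k1 : (k <= k')%N by rewrite -(ler_nat R); lra.
  have k2 : (k' < k + 2)%N by rewrite -(ltr_nat R) natrD; lra.
  have [kk|kk] : k' = k \/ k' = k.+1 by clear - k1 k2; lia.
    by left; rewrite kk in E; lra.
  by right; rewrite kk -natr1 in E; lra.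
have [W gW HW] := simple_pattern lu d0 md (v := (m, n)) per sim.
exists W => // rho; rewrite (curve_trace_lift rho cc luc); exact: HW (holonomy_transport rho).
Qed.

Lemma displacement_lift c g h : lift_of c g -> lift_of c h ->
  ((g 1).1 - (g 0).1, (g 1).2 - (g 0).2) = ((h 1).1 - (h 0).1, (h 1).2 - (h 0).2).
Proof.
move=> [lg gc] [lh hc]; have gh t : 0 <= t <= 1 -> torus_pt (g t) = torus_pt (h t) by move=> t01; rewrite gc ?hc.
have [|v _ E] := lift_translate lg lh; first exact: gh.
by rewrite !E ?lexx ?ler01 //=; congr pair; ring.
Qed.

Lemma displacement_homotopy c d g h : freely_homotopic c d -> lift_of c g -> lift_of d h ->
  ((g 1).1 - (g 0).1, (g 1).2 - (g 0).2) = ((h 1).1 - (h 0).1, (h 1).2 - (h 0).2).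
Proof.
move=> cd lg lh; have [G [v [_ _ gG hG [_ Gv]]]] := homotopy_lift cd.
rewrite (displacement_lift lg gG) (displacement_lift lh hG) !Gv ?lexx ?ler01 //.
by congr pair; cbn [fst snd]; ring.
Qed.

Lemma displacement_trivial c g : trivial_curve c -> lift_of c g -> ((g 1).1 - (g 0).1, (g 1).2 - (g 0).2) = (0, 0).
Proof.
move=> [p op cp] lg.
have cc : closed_curve (fun _ : R => p) by split=> //; apply: continuous_subspaceT => x; exact: cvg_cst.
have [h lh _] := curve_lift cc; have [lph hp] := lh.
rewrite (displacement_homotopy cp lg lh).
have lc : lift_of (fun=> p) (fun=> h 0).
  split; last by move=> t _; rewrite hp // lexx ler01.
  by split=> [|t]; [exact: ct_cst|case: lph].
by rewrite (displacement_lift lh lc) !subrr.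
Qed.

Lemma displacement_peripheral c g : peripheral c -> lift_of c g -> ((g 1).1 - (g 0).1, (g 1).2 - (g 0).2) = (0, 0).
Proof.
move=> pc lg; have [|d cd Ud] := pc [set z | 0 < z.1.1 /\ 0 < z.2.1].
  apply: open_nbhs_nbhs; split; last by rewrite /= ltr01.
  have -> : [set z : (R * R) * (R * R) | 0 < z.1.1 /\ 0 < z.2.1] =
     (fun z => z.1.1) @^-1` [set x | 0 < x] `&` (fun z => z.2.1) @^-1` [set x | 0 < x] by [].
  apply: openI; apply: open_comp; try exact: open_gt.
    by move=> z _; apply: (_ : continuous (fun z : (R * R) * (R * R) => z.1.1)); ct.
  by move=> z _; apply: (_ : continuous (fun z : (R * R) * (R * R) => z.2.1)); ct.
have cc : closed_curve d.
  have [H [[cH oH H0 H1] Hs]] := cd.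
  have i01 t : 0 <= t <= 1 -> t \in `[0, 1] by rewrite in_itv.
  have z1 : (1 : R) \in `[0, 1] by rewrite in_itv /= lexx ler01.
  have z0 : (0 : R) \in `[0, 1] by rewrite in_itv /= lexx ler01.
  split; last by rewrite -!H1 // Hs.
    have c1 : {within [set` `[(0 : R), 1]], continuous (H \o (fun t => (1, t)))}.
      by apply: within_comp cH => [|t ht]; [ct|split].
    apply: subspace_eq_continuous c1 => t; rewrite inE /= => ht; rewrite /from_subspace /=.
    exact: H1.
  by move=> t ht; rewrite -H1 //; exact: oH.
have [h lh _] := curve_lift cc; have [[ch oh] hd] := lh.
rewrite (displacement_homotopy cd lg lh).
have ld := lift_closed cc lh.
have zero (f : R -> R) : continuous f -> f 1 - f 0 \is a Num.int -> (forall t, 0 <= t <= 1 -> 0 < cos (2 * pi * f t)) ->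
    f 1 - f 0 = 0.
  move=> cf /intrP[m hm] pos; rewrite hm; case: (eqVneq m 0) => [->//|m0]; exfalso.
  have /andP[f0 f1] := floor_itv (f 0); rewrite intrD in f1.
  have bad (k : int) t : 0 <= t <= 1 -> f t = k%:~R + 1 / 2 -> False.
    move=> t01 ft; have := pos t t01; rewrite ft addrC.
    have [-> _] := circ_half (k%:~R : R).
    have [-> _] : circ (k%:~R : R) = (1, 0) by rewrite -[k%:~R]add0r circ_int circ0.
    by rewrite oppr_gt0 ltr10.
  have [mp|mn] : (1%:~R : R) <= m%:~R \/ m%:~R <= ((- 1)%:~R : R).
    by rewrite !ler_int; clear - m0; lia.
    case: (leP (f 0) ((Num.floor (f 0))%:~R + 1 / 2)) => h0.
      have [|t t01 ht] := ivt (v := (Num.floor (f 0))%:~R + 1 / 2) cf ler01; first by left; lra.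
      exact: (bad (Num.floor (f 0)) t).
    have [|t t01 ht] := ivt (v := (Num.floor (f 0) + 1)%:~R + 1 / 2) cf ler01; first by left; rewrite intrD; lra.
    exact: (bad (Num.floor (f 0) + 1) t).
  rewrite mulrNz in mn.
  case: (leP ((Num.floor (f 0))%:~R + 1 / 2) (f 0)) => h0.
    have [|t t01 ht] := ivt (v := (Num.floor (f 0))%:~R + 1 / 2) cf ler01; first by right; lra.
    exact: (bad (Num.floor (f 0)) t).
  have [|t t01 ht] := ivt (v := (Num.floor (f 0) - 1)%:~R + 1 / 2) cf ler01; first by right; rewrite intrD mulrNz; lra.
  exact: (bad (Num.floor (f 0) - 1) t).
have Ucos t : 0 <= t <= 1 -> 0 < cos (2 * pi * (h t).1) /\ 0 < cos (2 * pi * (h t).2).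
  move=> t01; have : t \in `[0, 1] by rewrite in_itv.
  by move/Ud; rewrite -hd.
have c1 : continuous (fun t => (h t).1) by ct.
have c2 : continuous (fun t => (h t).2) by ct.
have /andP[l1 l2] := ld.
by rewrite (zero _ c1 l1) ?(zero _ c2 l2) // => t /Ucos[].
Qed.
End SimpleCurves.

(** * Straight closed curves *)

Section LinearMoves.
Context {R : realType}.
Implicit Types (p q : R * R) (t s : R).

Definition lin1 (m : move) p : R * R :=
  match m with Swap => (p.2, p.1) | Invert => (p.1, - p.2) | Twist => (p.1 + p.2, p.2) end.

Definition lin (ms : seq move) p : R * R := foldr lin1 p ms.

Lemma ct_lin1 m (T : topologicalType) (f : T -> R * R) : continuous f -> continuous (fun x => lin1 m (f x)).
Proof. by move=> cf; case: m => /=; ct. Qed.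

Lemma ct_lin ms (T : topologicalType) (f : T -> R * R) : continuous f -> continuous (fun x => lin ms (f x)).
Proof. by move=> cf; elim: ms => //= m ms IH; exact: ct_lin1. Qed.

Lemma lattice_lin1 m p : lattice (lin1 m p) = lattice p.
Proof.
rewrite /lattice; case: m => /=; [exact: andbC|by rewrite rpredN|].
apply/andP/andP => -[h1 h2]; split=> //; last exact: rpredD.
by rewrite -[p.1](addrK p.2) rpredB.
Qed.

Lemma lattice_lin ms p : lattice (lin ms p) = lattice p.
Proof. by elim: ms => //= m ms IH; rewrite lattice_lin1. Qed.

Lemma lin1D m p q : lin1 m (p.1 + q.1, p.2 + q.2) = ((lin1 m p).1 + (lin1 m q).1, (lin1 m p).2 + (lin1 m q).2).
Proof. by case: m => //=; congr pair; ring. Qed.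

Lemma lin1_seg m p q t : lin1 m (seg p q t) = seg (lin1 m p) (lin1 m q) t.
Proof. by rewrite /seg /mix; case: m => //=; congr pair; ring. Qed.

Lemma linB ms p q : ((lin ms p).1 - (lin ms q).1, (lin ms p).2 - (lin ms q).2) = lin ms (p.1 - q.1, p.2 - q.2).
Proof.
elim: ms => //= m ms <-; case: m => //=; congr pair; ring.
Qed.

Lemma lin_eq0 ms p : lin ms p = (0, 0) -> p = (0, 0).
Proof.
elim: ms => //= m ms IH h; apply: IH; move: h; case: (lin ms p) => x y.
by case: m => /= -[h1 h2]; move: h1 h2 => h1 h2; congr pair; lra.
Qed.

Lemma lpath_lin1 m g : lpath g -> lpath (fun t => lin1 m (g t)).
Proof.
by move=> [cg og]; split=> [|t]; [exact: ct_lin1|rewrite /offlat lattice_lin1; exact: og].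
Qed.

Lemma transport_lin1 (F : fieldType) (N : (R -> R * R) -> R -> R -> 'M[F]_2) m : transport N ->
  transport (fun g => N (fun t => lin1 m (g t))).
Proof.
move=> tN; split.
- by move=> g a b lg; apply: (tp_det tN); exact: lpath_lin1.
- by move=> g a b c lg; apply: (tp_mul tN); exact: lpath_lin1.
- by move=> g a b lg; apply: (tp_aff tN _ _ (lpath_lin1 m lg)).
- move=> G cG oG G0 G1; apply: (tp_hom tN (G := fun p => lin1 m (G p))).
  + exact: ct_lin1.
  + by move=> p; rewrite /offlat lattice_lin1; exact: oG.
  + by move=> s; rewrite G0.
  + by move=> s; rewrite G1.
- move=> g a b v lg lv; rewrite -(tp_shift tN a b (lpath_lin1 m lg) (v := lin1 m v)).
    by congr (N _ a b); apply: funext => t; rewrite lin1D.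
  by rewrite lattice_lin1.
Qed.

Section Generators.
Context {F : fieldType} {N : (R -> R * R) -> R -> R -> 'M[F]_2}.
Hypothesis tN : transport N.

Lemma gen_SL2 l : \det (gen (N := N) l) = 1.
Proof.
apply: (tp_det tN); have := @mid_seg_lpath R (0, 0) l; congr (lpath (seg _ (mid _))).
by rewrite /sadd /= !add0r -surjective_pairing.
Qed.

Lemma offint (x : R) (k : int) : k%:~R < x < (k + 1)%:~R -> x \isn't a Num.int.
Proof. by move=> h; apply/negP => /intrP[m hm]; exact: int_strict h hm. Qed.

Let tri (z p q : R * R) := forall t r, 0 <= t <= 1 -> 0 <= r <= 1 -> offlat (mix r z (mix t p q)).

Let tri_split z p q : tri z p q -> N (seg z p) 0 1 * N (seg p q) 0 1 = N (seg z q) 0 1.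
Proof. by move=> h; exact: tp_triangle. Qed.

Let seg_move p q a b (m n : int) : (forall r, 0 <= r <= 1 -> offlat (mix r p q)) ->
  a = (p.1 + m%:~R, p.2 + n%:~R) -> b = (q.1 + m%:~R, q.2 + n%:~R) -> N (seg a b) 0 1 = N (seg p q) 0 1.
Proof.
move=> h -> ->; apply: (tp_seg_shift tN (v := (m%:~R, n%:~R))); last exact: seg_lpath.
by rewrite /lattice /= !intr_int.
Qed.

Lemma gen_moves m : exists2 S, \det S = 1 &
  conjp S (genX (fun g => N (fun t => lin1 m (g t))), genY (fun g => N (fun t => lin1 m (g t)))) =
  act1 m (genX N, genY N).
Proof.
have gE l : gen (N := fun g => N (fun t => lin1 m (g t))) l = N (seg (lin1 m (mid (0, 0))) (lin1 m (mid (dv l)))) 0 1.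
  by rewrite /gen; congr (N _ 0 1); apply: funext => t; exact: lin1_seg.
rewrite /genX /genY !gE {gE}; case: m.
- exists 1; first by rewrite det1.
  by rewrite /conjp /= invr1 !mul1r !mulr1 /gen; congr (N (seg _ _) 0 1, N (seg _ _) 0 1); rewrite /mid /=; congr pair; ring.
- exists 1; first by rewrite det1.
  rewrite /conjp /= invr1 !mul1r !mulr1; congr pair.
    rewrite -(seg_gen tN (0, -1) (true, true)); congr (N (seg _ _) 0 1);
      by rewrite /mid /sadd /dv /= ?intrD ?mulrNz; congr pair; lra.
  rewrite -[RHS]/(letter (gen (N := N) (true, true)) (gen (N := N) (false, true)) (false, false)) -(gen_letter tN).
  rewrite -(seg_gen tN (0, -1) (false, false)); congr (N (seg _ _) 0 1);
      by rewrite /mid /sadd /dv /= ?intrD ?mulrNz; congr pair; lra.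
- have y2 (p : R * R) (k : int) : k%:~R < p.2 < (k + 1)%:~R -> offlat p.
    by move=> h; rewrite /offlat /lattice negb_and (offint h) orbT.
  have x2 (p : R * R) (k : int) : k%:~R < p.1 < (k + 1)%:~R -> offlat p.
    by move=> h; rewrite /offlat /lattice negb_and (offint h).
  have dg (p : R * R) : p.1 - p.2 = 1 / 2 -> offlat p.
    move=> h; apply/negP => /andP[h1 h2]; have := rpredB h1 h2; rewrite h; apply/negP.
    by apply: (@offint _ 0); rewrite intrD; lra.
  pose a : R * R := (1 / 2, 1 / 2); pose b : R * R := (1, 1 / 2); pose c : R * R := (3 / 2, 1 / 2).
  pose d : R * R := (2, 1 / 2); pose f : R * R := (3 / 2, 1); pose h : R * R := (3 / 2, 3 / 2).
  pose k : R * R := (2, 3 / 2); pose a' : R * R := (1 / 2, 3 / 2).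
  have r1 : tri a b c by move=> t r ht hr; apply: (@y2 _ 0); rewrite /mix /= intrD; lra.
  have r2 : tri b c d by move=> t r ht hr; apply: (@y2 _ 0); rewrite /mix /= intrD; lra.
  have r3 : tri b f k by move=> t r ht hr; apply: dg; rewrite /mix /=; field.
  have r6 : tri c f h by move=> t r ht hr; apply: (@x2 _ 1); rewrite /mix /= intrD; lra.
  have r4 : tri b c f.
    move=> t r ht /andP[]; rewrite le_eqVlt => /orP[/eqP <- _|r0 hr].
      by apply: (@y2 _ 0); rewrite /mix /= intrD; lra.
    by apply: (@x2 _ 1); rewrite /mix /= intrD; lra.
  have r5 : tri f h k.
    move=> t r ht /andP[]; rewrite le_eqVlt => /orP[/eqP <- _|r0 hr].
      by apply: (@x2 _ 1); rewrite /mix /= intrD; lra.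
    by apply: (@y2 _ 1); rewrite /mix /= intrD; lra.
  have ab r : 0 <= r <= 1 -> offlat (mix r a b) by move=> hr; apply: (@y2 _ 0); rewrite /mix /= intrD; lra.
  have aa r : 0 <= r <= 1 -> offlat (mix r a a') by move=> hr; apply: (@x2 _ 0); rewrite /mix /= intrD; lra.
  have m1 : N (seg c d) 0 1 = N (seg a b) 0 1.
    by apply: (seg_move (m := 1) (n := 0) ab); congr pair; rewrite /=; lra.
  have m2 : N (seg h k) 0 1 = N (seg a b) 0 1.
    by apply: (seg_move (m := 1) (n := 1) ab); congr pair; rewrite /=; lra.
  have m3 : N (seg c h) 0 1 = N (seg a a') 0 1.
    by apply: (seg_move (m := 1) (n := 0) aa); congr pair; rewrite /=; lra.
  have dS : \det (N (seg a b) 0 1) = 1 by apply: (tp_det tN); exact: seg_lpath.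
  have uS := SL2_unit dS.
  have gX : gen (N := N) (true, true) = N (seg a b) 0 1 * N (seg b c) 0 1.
    by rewrite tri_split // /gen; congr (N (seg _ _) 0 1); rewrite /mid /a /c /=; congr pair; lra.
  have gY : gen (N := N) (false, true) = N (seg a a') 0 1.
    by rewrite /gen; congr (N (seg _ _) 0 1); rewrite /mid /a /a' /=; congr pair; lra.
  exists (N (seg a b) 0 1); first by [].
  have -> : N (seg (lin1 Twist (mid (0, 0))) (lin1 Twist (mid (dv (true, true))))) 0 1 = N (seg b d) 0 1.
    by congr (N (seg _ _) 0 1); rewrite /mid /b /d /=; congr pair; lra.
  have -> : N (seg (lin1 Twist (mid (0, 0))) (lin1 Twist (mid (dv (false, true))))) 0 1 = N (seg b k) 0 1.
    by congr (N (seg _ _) 0 1); rewrite /mid /b /k /=; congr pair; lra.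
  rewrite /conjp; cbn [fst snd act1].
  rewrite -(tri_split r2) m1 -(tri_split r3) -(tri_split r4) -(tri_split r5) m2 gX gY -m3 -(tri_split r6).
  by rewrite !mulrA; congr pair; rewrite -?mulrA mulrV // mulr1 ?mulrA.
Qed.

End Generators.

Lemma lin_trace (F : fieldType) (N : (R -> R * R) -> R -> R -> 'M[F]_2) ms : transport N ->
  \tr (genX (fun g => N (fun t => lin ms (g t)))) = \tr (act ms (genX N, genY N)).1.
Proof.
elim: ms N => [|m ms IH] N tN; first by rewrite /genX.
have tN' := transport_lin1 m tN; rewrite (IH _ tN').
rewrite -[act (m :: ms) _]/(act ms (act1 m _)).
have [S dS <-] := gen_moves tN m; rewrite tr_act_conj //.
by split; exact: gen_SL2.
Qed.

End LinearMoves.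

Section Lines.
Context {R : realType}.
Implicit Types (p q : R * R) (t s : R) (rho : representation R).

Definition line (ms : seq move) : curve R := fun t => torus_pt (lin ms (1 / 2 + t, 1 / 2)).

Lemma half_not_int : (1 / 2 : R) \isn't a Num.int.
Proof. by apply: (@offint _ _ 0); rewrite intrD; lra. Qed.

Lemma row_lpath : lpath (fun t : R => (1 / 2 + t, 1 / 2 : R)).
Proof.
split=> [|t]; first by ct.
by rewrite /offlat /lattice negb_and /= half_not_int orbT.
Qed.

Lemma lin_lpath ms g : lpath g -> lpath (fun t => lin ms (g t)).
Proof. by move=> [cg og]; split=> [|t]; [exact: ct_lin|rewrite /offlat lattice_lin; exact: og]. Qed.

Lemma line_lift ms : lift_of (line ms) (fun t => lin ms (1 / 2 + t, 1 / 2)).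
Proof. by split=> //; apply: lin_lpath; exact: row_lpath. Qed.

Lemma line_simple ms : simple_closed_curve (line ms).
Proof.
have [[cg og] _] := line_lift ms; split; first split.
- by apply: continuous_subspaceT; exact: ct_torus_pt.
- by move=> t _; apply: ptorus_torus_pt; exact: og.
- apply/torus_pt_eq; rewrite linB lattice_lin /lattice /= subrr rpred0 andbT.
  by have -> : 1 / 2 + 0 - (1 / 2 + 1) = - 1 :> R by [lra]; rewrite rpredN rpred1.
move=> t s; rewrite !in_itv /= => ht hs /torus_pt_eq; rewrite linB lattice_lin => /andP[/= /intrP[m hm] _].
have m0 : m = 0.
  have h1 : (m%:~R : R) < 1%:~R by lra.
  have h2 : ((- 1)%:~R : R) < m%:~R by rewrite mulrNz; lra.
  by move: h1 h2; rewrite !ltr_int; clear; lia.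
by move: hm; rewrite m0; lra.
Qed.

Lemma line_displacement ms : ((lin ms (1 / 2 + 1, 1 / 2)).1 - (lin ms (1 / 2 + 0, 1 / 2)).1,
  (lin ms (1 / 2 + 1, 1 / 2)).2 - (lin ms (1 / 2 + 0, 1 / 2)).2) <> (0, 0) :> R * R.
Proof. by rewrite linB => /lin_eq0 [h _]; lra. Qed.

Lemma line_essential ms : essential_classes R (unoriented_class (line ms)).
Proof.
exists (line ms) => //; split; first exact: line_simple.
- by move=> h; have := displacement_trivial h (line_lift ms); exact: line_displacement.
- by move=> h; have := displacement_peripheral h (line_lift ms); exact: line_displacement.
Qed.

Definition XY rho := (genX (holonomy rho), genY (holonomy rho)).

Lemma XY_SL2 rho : SL2pair (XY rho).
Proof. by split; exact: gen_SL2 (holonomy_transport rho) _. Qed.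

Lemma line_trace ms rho : curve_trace rho (unoriented_class (line ms)) = \tr (act ms (XY rho)).1.
Proof.
have tN := holonomy_transport rho.
rewrite (curve_trace_lift rho (proj1 (line_simple ms)) (line_lift ms)) -(lin_trace ms tN); congr (\tr _).
have ls : lpath (seg (mid (0, 0)) (mid (dv (true, true)) : R * R)).
  by have := @mid_seg_lpath R (0, 0) (true, true).
apply: (tp_ext tN ler01); [exact: lin_lpath row_lpath|exact: lin_lpath|].
move=> t ht; congr (lin ms _); rewrite /seg kap_id // /mix /mid /=; congr pair; lra.
Qed.

Lemma X0_lift : lift_of (X0 R) (seg (mid (0, 0)) (mid (1, 0))).
Proof.
split; first by have := @mid_seg_lpath R (0, 0) (true, true).
move=> t ht; rewrite /seg kap_id // /torus_pt /X0 -circ_half.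
have -> : (-1, 0) = circ (1 / 2) :> R * R by have := circ_half (0 : R); rewrite addr0 mulr0 cos0 sin0 oppr0.
by rewrite /mix /mid /=; congr (circ _, circ _); lra.
Qed.

Lemma Y0_lift : lift_of (Y0 R) (seg (mid (0, 0)) (mid (0, 1))).
Proof.
split; first by have := @mid_seg_lpath R (0, 0) (false, true).
move=> t ht; rewrite /seg kap_id // /torus_pt /Y0 -circ_half.
have -> : (-1, 0) = circ (1 / 2) :> R * R by have := circ_half (0 : R); rewrite addr0 mulr0 cos0 sin0 oppr0.
by rewrite /mix /mid /=; congr (circ _, circ _); lra.
Qed.

Lemma XYE rho : XY rho = (rho (X0 R), rho (Y0 R)).
Proof.
have [lX lY] := is_loop_X0Y0 R.
rewrite (rho_lift rho lX (proj1 X0_lift) (proj2 X0_lift)).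
by rewrite (rho_lift rho lY (proj1 Y0_lift) (proj2 Y0_lift)).
Qed.

Lemma is_loop_reverse (c : curve R) : is_loop c -> is_loop (reverse c).
Proof.
move=> [[cc oc c01] c0]; split; last by rewrite /reverse subr0 -c01.
split; last by rewrite /reverse subr0 subrr c01.
  apply: within_comp cc => [|t] /=; first by ct.
  by rewrite !in_itv /=; lra.
by move=> t; rewrite in_itv /= => ht; apply: oc; rewrite in_itv /=; lra.
Qed.

Lemma rho_reverse rho (c : curve R) : is_loop c -> rho (reverse c) = (rho c)^-1.
Proof.
move=> lc; have [g lg _] := curve_lift lc.1; have tN := holonomy_transport rho; have [lp gc] := lg.
have lr := reverse_lift lg.
rewrite (rho_lift rho lc lp gc) (rho_lift rho (is_loop_reverse lc) (proj1 lr) (proj2 lr)) -(tp_rev tN) //.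
by rewrite (tp_aff tN 1 0 lp); congr (holonomy _ _ 0 1); apply: funext => t; congr g; ring.
Qed.

Lemma commutator_trace (rho : type_preserving R) :
  \tr ((XY rho).1 * (XY rho).2 * (XY rho).1^-1 * (XY rho).2^-1) = - 2.
Proof.
have [lX lY] := is_loop_X0Y0 R; have rX := is_loop_reverse lX; have rY := is_loop_reverse lY.
rewrite -(tp_commutator rho) XYE !rep_concat ?rho_reverse //; do ?exact: is_loop_concat.
by apply: is_loop_concat => //; exact: is_loop_concat.
Qed.

Lemma essential_line (rho : type_preserving R) X : essential_classes R X -> `|curve_trace rho X| < 1 / 2 ->
  exists ms, forall sigma : representation R, curve_trace sigma X = \tr (act ms (XY sigma)).1.
Proof.
move=> [c [sc _ _] <-]; have [W gW HW] := simple_curve_pattern sc => small.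
have [d1 d2] := XY_SL2 rho.
have := pattern_word R[i] gW => -[H|H|[ms H]]; last first.
- by exists ms => sigma; rewrite HW; have [e1 e2] := XY_SL2 sigma; exact: H.
- exfalso; move: small; rewrite HW H // -[genX _]/(XY rho).1 -[genY _]/(XY rho).2 commutator_trace.
  by rewrite normrN normr_nat => h; have := lt_trans h (_ : 1 / 2 < 2); rewrite ltxx => H2; apply: notF (H2 _); rewrite ltr_pdivrMr ?ltr0n // -natrM ltr1n.
exfalso; move: small; rewrite HW H // normr_nat => h.
by have := lt_trans h (_ : 1 / 2 < 2); rewrite ltxx => H2; apply: notF (H2 _); rewrite ltr_pdivrMr ?ltr0n // -natrM ltr1n.
Qed.
End Lines.

(** * Descent on traces *)

Section Inequality.
Context {R : realType}.
Implicit Types (x y z w l a b : R[i]).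

Definition modulus z : R := complex.Re `|z|.

Lemma modulusE z : `|z| = (modulus z)%:C%C.
Proof. by rewrite /modulus RRe_real. Qed.

Lemma modulusM z w : modulus (z * w) = modulus z * modulus w.
Proof. by apply: complexI; rewrite rmorphM /= -!modulusE normrM. Qed.

Lemma modulusD z w : modulus (z + w) <= modulus z + modulus w.
Proof. by rewrite -lecR rmorphD /= -!modulusE ler_normD. Qed.

Lemma modulusN z : modulus (- z) = modulus z.
Proof. by rewrite /modulus normrN. Qed.

Lemma modulus_ge0 z : 0 <= modulus z.
Proof. by rewrite -lecR -modulusE normr_ge0. Qed.

Lemma modulus_eq0 z : (modulus z == 0) = (z == 0).
Proof. by rewrite -[RHS]normr_eq0 modulusE -[LHS](inj_eq (@complexI R)). Qed.

Lemma modulus_sq z : modulus z ^+ 2 = (complex.Re z) ^+ 2 + (complex.Im z) ^+ 2.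
Proof. by apply: complexI; rewrite rmorphXn /= -modulusE add_Re2_Im2. Qed.

Lemma modulus_nat n : modulus n%:R = n%:R.
Proof. by apply: complexI; rewrite -modulusE normr_nat rmorph_nat. Qed.

Lemma modulus1 : modulus 1 = 1.
Proof. exact: (modulus_nat 1). Qed.

Lemma Re_le_modulus z : complex.Re z <= modulus z.
Proof.
case: (leP (complex.Re z) 0) => h; first exact: le_trans h (modulus_ge0 z).
have := modulus_sq z; have := modulus_ge0 z; have := sqr_ge0 (complex.Im z).
by rewrite !expr2; nra.
Qed.

Lemma sum_squares a b l w :
  modulus (a + b) ^+ 2 + modulus (l * a + w * b) ^+ 2 =
  modulus a ^+ 2 * (1 + modulus l ^+ 2) + modulus b ^+ 2 * (1 + modulus w ^+ 2) +
  2 * complex.Re (a * b^*%C * (1 + l * w^*%C)).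
Proof.
rewrite !modulus_sq; case: a => a1 a2; case: b => b1 b2; case: l => l1 l2; case: w => w1 w2 /=.
ring.
Qed.

Lemma modulus_conj z : modulus z^*%C = modulus z.
Proof. by rewrite /modulus normcJ. Qed.

(* The eigenvalues l, w of an SL2 matrix of small trace x are close to +-i, so
   that the mixed terms of |a + b|^2 and |l a + w b|^2 nearly cancel. *)
Lemma cross_bound l w x : l * w = 1 -> l + w = x -> modulus (1 + l * w^*%C) <= modulus x.
Proof.
move=> lw lx; have mlw : modulus l * modulus w = 1 by rewrite -modulusM lw modulus1.
have -> : 1 + l * w^*%C = w^*%C * (l^*%C + l).
  rewrite mulrDr; congr (_ + _); last by rewrite mulrC.
  by rewrite -rmorphM mulrC lw rmorph1.
rewrite modulusM modulus_conj.
have := modulus_sq w; have := modulus_sq l; have := modulus_sq x; have := modulus_sq (l^*%C + l).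
move: lw lx mlw (modulus_ge0 w) (modulus_ge0 l) (modulus_ge0 x) (modulus_ge0 (l^*%C + l)).
move: (modulus w) (modulus l) (modulus x) (modulus (l^*%C + l)) => mw ml mx mc.
case: l => p q; case: w => u v [h1 h2] <- /= mlw w0 l0 x0 c0 ec ex el ew.
have eu : u = p * mw ^+ 2.
  rewrite ew; have -> : p * (u ^+ 2 + v ^+ 2) = (p * u - q * v) * u + (p * v + q * u) * v by ring.
  by rewrite h1 h2; ring.
have c2 : mc ^+ 2 = 4 * p ^+ 2 by rewrite ec; ring.
have X2 : p ^+ 2 * (1 + mw ^+ 2) ^+ 2 <= mx ^+ 2.
  rewrite ex eu; have -> : (p + p * mw ^+ 2) ^+ 2 = p ^+ 2 * (1 + mw ^+ 2) ^+ 2 by ring.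
  by rewrite lerDl sqr_ge0.
rewrite -(@ler_pXn2r _ 2) ?nnegrE ?mulr_ge0 //; apply: le_trans X2; rewrite exprMn c2.
have -> : p ^+ 2 * (1 + mw ^+ 2) ^+ 2 = mw ^+ 2 * (4 * p ^+ 2) + p ^+ 2 * (1 - mw ^+ 2) ^+ 2 by ring.
by rewrite lerDl mulr_ge0 ?sqr_ge0.
Qed.

Lemma small_pair l w x a b : l * w = 1 -> l + w = x -> 1 < modulus l ->
  modulus a <= modulus b <= modulus l ^+ 2 * modulus a -> a * b * (x ^+ 2 - 4) = x ^+ 2 ->
  x != 0 -> modulus x < 1 / 2 ->
  modulus (a + b) < modulus x \/ modulus (l * a + w * b) < modulus x.
Proof.
move=> lw lx l1 /andP[ab ba] eab xn xs.
have mlw : modulus l * modulus w = 1 by rewrite -modulusM lw modulus1.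
have x0 : 0 < modulus x by rewrite lt_neqAle modulus_ge0 eq_sym modulus_eq0 xn.
have lwx : modulus l <= modulus x + modulus w.
  by rewrite -(modulusN w); have -> : l = x + - w; [rewrite -lx addrK|exact: modulusD].
have prod : modulus a * modulus b * (15 / 4) <= modulus x ^+ 2.
  have mx2 : modulus (x ^+ 2) = modulus x ^+ 2 by rewrite !expr2 modulusM.
  have := congr1 modulus eab; rewrite !modulusM => h; rewrite expr2 -h.
  have h4 : modulus 4 <= modulus (x ^+ 2) + modulus (x ^+ 2 - 4).
    have := modulusD (x ^+ 2) (- (x ^+ 2 - 4)); rewrite modulusN.
    by have -> : x ^+ 2 + - (x ^+ 2 - 4) = 4 by ring.
  rewrite modulus_nat mx2 in h4.
  have ab0 := mulr_ge0 (modulus_ge0 a) (modulus_ge0 b).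
  by apply: ler_wpM2l => //; nra.
have cr := cross_bound lw lx.
have re := Re_le_modulus (a * b^*%C * (1 + l * w^*%C)).
rewrite !modulusM modulus_conj in re.
have ss := sum_squares a b l w.
case: (ltP (modulus (a + b)) (modulus x)) => h1; first by left.
case: (ltP (modulus (l * a + w * b)) (modulus x)) => h2; first by right.
exfalso.
have s1 : modulus x ^+ 2 <= modulus (a + b) ^+ 2 by rewrite ler_pXn2r ?nnegrE ?modulus_ge0.
have s2 : modulus x ^+ 2 <= modulus (l * a + w * b) ^+ 2 by rewrite ler_pXn2r ?nnegrE ?modulus_ge0.
move: mlw x0 lwx prod cr re ss s1 s2 l1 ab ba xs (modulus_ge0 a) (modulus_ge0 b) (modulus_ge0 w) (modulus_ge0 (1 + l * w^*%C)).
move: (modulus (1 + l * w^*%C)) (modulus (a + b) ^+ 2) (modulus (l * a + w * b) ^+ 2) (complex.Re _).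
move: (modulus a) (modulus b) (modulus l) (modulus w) (modulus x) => {eab xn lx lw h1 h2 a b l w x} al be L W X.
move=> c S1 S2 re LW X0 LX pr cX rc ss s1 s2 L1 ab ba X2 a0 b0 W0 c0.
have m0 := mulr_ge0 a0 b0.
have rc' : re <= al * be / 2 by nra.
have LW2 : (L + W) ^+ 2 <= 17 / 4.
  have -> : (L + W) ^+ 2 = (L - W) ^+ 2 + 4 * (L * W) by ring.
  have W1 : W <= 1 by nra.
  have D0 : 0 <= L - W by lra.
  have D1 : L - W <= 1 / 2 by lra.
  by rewrite LW expr2; nra.
have main : al ^+ 2 * (1 + L ^+ 2) + be ^+ 2 * (1 + W ^+ 2) <= al * be * (L + W) ^+ 2.
  have W2 : L ^+ 2 * W ^+ 2 = 1 by rewrite -exprMn LW expr1n.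
  have -> : (L + W) ^+ 2 = (1 + L ^+ 2) * (1 + W ^+ 2) by have := congr1 (fun u => (1 - u) ^+ 2) LW; rewrite /= subrr => h; apply/eqP; rewrite -subr_eq0 -oppr_eq0; apply/eqP; rewrite -[RHS](expr0n R 2) -h; ring.
  have -> : be ^+ 2 * (1 + W ^+ 2) = (1 + L ^+ 2) * (be ^+ 2 * W ^+ 2) by have -> : be ^+ 2 * (1 + W ^+ 2) = (1 + L ^+ 2) * (be ^+ 2 * W ^+ 2) + be ^+ 2 * (1 - L ^+ 2 * W ^+ 2); [ring|rewrite W2 subrr mulr0 addr0].
  have h : W ^+ 2 * be <= al.
    have -> : al = W ^+ 2 * (L ^+ 2 * al) by rewrite mulrA [W ^+ 2 * _]mulrC W2 mul1r.
    by rewrite ler_wpM2l ?sqr_ge0.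
  have K0 : 0 <= 1 + L ^+ 2 by rewrite addr_ge0 ?sqr_ge0.
  rewrite -subr_ge0; have -> : al * be * ((1 + L ^+ 2) * (1 + W ^+ 2)) -
      (al ^+ 2 * (1 + L ^+ 2) + (1 + L ^+ 2) * (be ^+ 2 * W ^+ 2)) =
      (1 + L ^+ 2) * ((be - al) * (al - W ^+ 2 * be)) by ring.
  by rewrite mulr_ge0 // mulr_ge0 ?subr_ge0.
have X0' : 0 < X ^+ 2 by rewrite exprn_gt0.
have : al * be * (L + W) ^+ 2 <= al * be * (17 / 4) by rewrite ler_wpM2l.
move: main ss rc' s1 s2 pr X0'; move: (al ^+ 2 * _) (be ^+ 2 * _) (al * be * (L + W) ^+ 2) (X ^+ 2) => u1 u2 u3 u4.
by move: (al * be) m0 => m m0; lra.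
Qed.
Lemma eigenvalues x : ~ (- 2 <= x <= 2) -> exists l w, [/\ l * w = 1, l + w = x & 1 < modulus l].
Proof.
move=> nx; pose s := sqrtC (x ^+ 2 - 4).
have s2 : s ^+ 2 = x ^+ 2 - 4 by exact: sqrtCK.
have two : (2 : R[i]) != 0 by rewrite pnatr_eq0.
pose l := (x + s) / 2; pose w := (x - s) / 2.
have lw : l * w = 1.
  have -> : l * w = (x ^+ 2 - s ^+ 2) / 4 by rewrite /l /w; field.
  by rewrite s2; field.
have lx : l + w = x by rewrite /l /w; field.
have mlw : modulus l * modulus w = 1 by rewrite -modulusM lw modulus1.
case: (ltgtP (modulus l) 1) => h.
- exists w, l; rewrite mulrC addrC; split=> //.
  rewrite ltNge; apply/negP => w1; have := ler_wpM2l (modulus_ge0 l) w1.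
  by rewrite mlw mulr1 leNgt h.
- by exists l, w.
exfalso; apply: nx.
have wl : w = l^*%C.
  have l0 : l != 0 by rewrite -modulus_eq0 h oner_eq0.
  by apply: (mulfI l0); rewrite lw -sqr_normc modulusE h expr1n.
have xr : x = (2 * complex.Re l)%:C%C.
  by rewrite -lx wl addcJ rmorphM /= rmorph_nat.
have h1 : complex.Re l <= 1 by rewrite -h Re_le_modulus.
have h2 : - complex.Re l <= 1.
  by have := Re_le_modulus (- l); rewrite modulusN h; case: (l).
have -> : (2 : R[i]) = (2 : R)%:C%C by rewrite rmorph_nat.
by rewrite xr -rmorphN /= !lecR; lra.
Qed.

Lemma power_unbounded (L c a : R) : 1 < L -> 0 < a -> exists n, c < a * L ^+ n.
Proof.
move=> L1 a0.
have bern n : 1 + n%:R * (L - 1) <= L ^+ n.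
  elim: n => [|n IH]; first by rewrite mul0r addr0 expr0.
  have n0 : 0 <= n%:R :> R by rewrite ler0n.
  have h1 := ler_wpM2l (ltW (lt_trans ltr01 L1)) IH.
  have h2 : 0 <= n%:R * (L - 1) ^+ 2 by rewrite mulr_ge0 ?sqr_ge0.
  rewrite exprS -natr1; apply: le_trans h1; rewrite -subr_ge0; move: h2; congr (is_true (0 <= _)); ring.
pose q := c / (a * (L - 1)).
have q0 : 0 < a * (L - 1) by rewrite mulr_gt0 // subr_gt0.
exists (Num.bound `|q|); have hb := archi_boundP (normr_ge0 q).
have h1 : q < (Num.bound `|q|)%:R by apply: le_lt_trans hb; exact: ler_norm.
move: h1; rewrite /q ltr_pdivrMr // => h1.
have := bern (Num.bound `|q|); move: (L ^+ _) (_%:R : R) h1 => u v h1 h2.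
have : a * (1 + v * (L - 1)) <= a * u by rewrite ler_wpM2l // ltW.
by rewrite mulrDr; lra.
Qed.

Lemma balance (L a b : R) : 1 < L -> 0 < a -> a <= b -> exists n, a * L ^+ n <= b <= a * L ^+ n.+1.
Proof.
move=> L1 a0 ab; have [n hn] := power_unbounded b L1 a0.
have ex : exists n, b < a * L ^+ n by exists n.
case: (ex_minnP ex) => m hm mm; case: m hm mm => [|m] hm mm.
  by move: hm; rewrite expr0 mulr1 ltNge ab.
exists m; rewrite (ltW hm) andbT leNgt; apply/negP => h.
by have := mm _ h; rewrite ltnn.
Qed.

Lemma small_sequence x (y : nat -> R[i]) l w a b : l * w = 1 -> l + w = x -> 1 < modulus l ->
  (forall n, y n.+2 = x * y n.+1 - y n) -> y 0%N = a + b -> y 1%N = l * a + w * b ->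
  a * b * (x ^+ 2 - 4) = x ^+ 2 -> x != 0 -> modulus x < 1 / 2 -> modulus a <= modulus b ->
  exists n, modulus (y n) < modulus x.
Proof.
move=> lw lx l1 rec y0 y1 ab x0 xs mab.
have yn n : y n = l ^+ n * a + w ^+ n * b /\ y n.+1 = l ^+ n.+1 * a + w ^+ n.+1 * b.
  elim: n => [|n [IH1 IH2]]; first by rewrite !expr0 !mul1r !expr1.
  split=> //; rewrite rec IH1 IH2 -lx.
  have -> : l ^+ n = l ^+ n * (l * w) by rewrite lw mulr1.
  have -> : w ^+ n = w ^+ n * (l * w) by rewrite lw mulr1.
  by rewrite !exprS; ring.
have mlw : modulus l * modulus w = 1 by rewrite -modulusM lw modulus1.
have mX z n : modulus (z ^+ n) = modulus z ^+ n.
  by elim: n => [|n IH]; rewrite ?expr0 ?modulus1 // !exprS modulusM IH.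
have a0 : 0 < modulus a.
  rewrite lt_neqAle modulus_ge0 andbT eq_sym modulus_eq0; apply/negP => /eqP a0.
  by move: ab; rewrite a0 !mul0r => /esym/eqP; rewrite sqrf_eq0 (negbTE x0).
have L1 : 1 < modulus l ^+ 2 by rewrite expr2; nra.
have [n /andP[n1 n2]] := balance L1 a0 mab.
have ww : 0 < modulus w by rewrite -(pmulr_rgt0 _ (lt_trans ltr01 l1)) mlw.
have wn : 0 < modulus w ^+ n by rewrite exprn_gt0.
have lwn : modulus w ^+ n * modulus l ^+ n = 1 by rewrite -exprMn mulrC mlw expr1n.
have Lsq : (modulus l ^+ 2) ^+ n = modulus l ^+ n * modulus l ^+ n by rewrite exprAC expr2.
have lwn' : l ^+ n * w ^+ n = 1 by rewrite -exprMn lw expr1n.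
have e1 : modulus (l ^+ n * a) <= modulus (w ^+ n * b) <= modulus l ^+ 2 * modulus (l ^+ n * a).
  rewrite !modulusM !mX; apply/andP; split.
    have -> : modulus l ^+ n * modulus a = modulus w ^+ n * (modulus a * (modulus l ^+ 2) ^+ n).
      by rewrite Lsq -[LHS]mul1r -lwn; ring.
    by rewrite ler_pM2l.
  have -> : modulus l ^+ 2 * (modulus l ^+ n * modulus a) = modulus w ^+ n * (modulus a * (modulus l ^+ 2) ^+ n.+1).
    by rewrite [_ ^+ n.+1]exprS Lsq -[LHS]mul1r -lwn; ring.
  by rewrite ler_pM2l.
have e2 : l ^+ n * a * (w ^+ n * b) * (x ^+ 2 - 4) = x ^+ 2.
  have -> : l ^+ n * a * (w ^+ n * b) * (x ^+ 2 - 4) = l ^+ n * w ^+ n * (a * b * (x ^+ 2 - 4)) by ring.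
  by rewrite lwn' mul1r.
have [yn0 yn1] := yn n.
case: (small_pair lw lx l1 e1 e2 x0 xs) => h; [exists n|exists n.+1].
  by rewrite yn0.
by rewrite yn1 !exprS -!mulrA.
Qed.

Lemma markov_descent x (y y' : nat -> R[i]) : ~ (- 2 <= x <= 2) -> modulus x < 1 / 2 ->
  (forall n, y n.+2 = x * y n.+1 - y n) -> (forall n, y' n.+2 = x * y' n.+1 - y' n) ->
  y' 0%N = y 0%N -> y' 1%N = x * y 0%N - y 1%N ->
  x ^+ 2 + y 0%N ^+ 2 + y 1%N ^+ 2 = x * y 0%N * y 1%N ->
  exists n, modulus (y n) < modulus x \/ modulus (y' n) < modulus x.
Proof.
move=> nx xs rec rec' y0 y1 mk.
have [l [w [lw lx l1]]] := eigenvalues nx.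
have x0 : x != 0.
  by apply/eqP => x0; apply: nx; rewrite x0 oppr_le0 ler0n.
have lw2 : (l - w) ^+ 2 = x ^+ 2 - 4.
  have -> : (l - w) ^+ 2 = (l + w) ^+ 2 - 4 * (l * w) by ring.
  by rewrite lw mulr1 lx.
have dlw : l - w != 0.
  apply/eqP => h; have E : w = l by apply/eqP; rewrite eq_sym -subr_eq0 h.
  have : modulus l * modulus l = 1 by rewrite -modulusM -{2}E lw modulus1.
  by move: l1; move: (modulus l) => L; nra.
pose a := (y 1%N - y 0%N * w) / (l - w); pose b := (y 0%N * l - y 1%N) / (l - w).
have ab : a * b * (x ^+ 2 - 4) = x ^+ 2.
  have -> : a * b * (x ^+ 2 - 4) = (y 1%N - y 0%N * w) * (y 0%N * l - y 1%N) by rewrite -lw2 /a /b; field.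
  have -> : (y 1%N - y 0%N * w) * (y 0%N * l - y 1%N) = (l + w) * y 0%N * y 1%N - y 0%N ^+ 2 * (l * w) - y 1%N ^+ 2 by ring.
  by rewrite lx lw -mk; ring.
have ya : y 0%N = a + b by rewrite /a /b; field.
have yb : y 1%N = l * a + w * b by rewrite /a /b; field.
case: (leP (modulus a) (modulus b)) => mab.
  by have [n hn] := small_sequence lw lx l1 rec ya yb ab x0 xs mab; exists n; left.
have ya' : y' 0%N = b + a by rewrite y0 ya addrC.
have yb' : y' 1%N = l * b + w * a by rewrite y1 -lx ya yb; ring.
have ab' : b * a * (x ^+ 2 - 4) = x ^+ 2 by rewrite [b * a]mulrC.
by have [n hn] := small_sequence lw lx l1 rec' ya' yb' ab' x0 xs (ltW mab); exists n; right.
Qed.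
End Inequality.

Section Markov.
Context {F : fieldType}.
Implicit Types (U V : 'M[F]_2) (p : 'M[F]_2 * 'M[F]_2) (x : F * F * F).

Lemma tr_sqr_mul U V : \det U = 1 -> \tr (U * U * V) = \tr U * \tr (U * V) - \tr V.
Proof.
move=> dU; rewrite CH dU mulrBl mul1r -scalerAl.
by rewrite raddfB /= mxtraceZ.
Qed.

Lemma tr_mul_inv U V : \det V = 1 -> \tr (U * V^-1) = \tr U * \tr V - \tr (U * V).
Proof.
move=> dV; rewrite SL2_inv // mulrBr -scalemx1 -scalerAr mulr1.
by rewrite raddfB /= mxtraceZ mulrC.
Qed.

Lemma tr_commutator U V : \det U = 1 -> \det V = 1 -> \tr (U * V * U^-1 * V^-1) =
  \tr U ^+ 2 + \tr V ^+ 2 + \tr (U * V) ^+ 2 - \tr U * \tr V * \tr (U * V) - 2.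
Proof.
move=> dU dV; rewrite tr_mul_inv //.
have -> : \tr (U * V * U^-1) = \tr V by rewrite trC mulrA mulVr ?SL2_unit // mul1r.
have -> : \tr (U * V * U^-1 * V) = \tr (V * U * V * U^-1) by rewrite trC !mulrA.
rewrite tr_mul_inv //.
have -> : \tr (V * U * V) = \tr (V * V * U) by rewrite trC mulrA.
have -> : \tr (V * U * V * U) = \tr (V * U * (V * U) * 1) by rewrite mulr1 mulrA.
rewrite !tr_sqr_mul // ?SL2_mul // mulr1 mxtrace1 (trC V U); ring.
Qed.

Definition triple p := (\tr p.1, \tr p.2, \tr (p.1 * p.2)).

Definition triple_move (m : move) x : F * F * F :=
  match m with
  | Swap => (x.1.2, x.1.1, x.2)
  | Invert => (x.1.1, x.1.2, x.1.1 * x.1.2 - x.2)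
  | Twist => (x.1.1, x.2, x.1.1 * x.2 - x.1.2)
  end.

Lemma triple_act ms p : SL2pair p -> triple (act ms p) = foldl (fun x m => triple_move m x) (triple p) ms.
Proof.
elim: ms p => [//|m ms IH] p sp; rewrite -[act (m :: ms) p]/(act ms (act1 m p)) IH; last exact: act1_SL2.
rewrite /=; congr foldl; have [d1 d2] := sp; case: m => /=; rewrite /triple /=.
- by rewrite trC.
- by rewrite tr_inv // tr_mul_inv.
- by rewrite mulrA tr_sqr_mul.
Qed.

Lemma commutator_act ms p : SL2pair p ->
  \tr ((act ms p).1 * (act ms p).2 * (act ms p).1^-1 * (act ms p).2^-1) = \tr (p.1 * p.2 * p.1^-1 * p.2^-1).
Proof.
elim: ms p => [//|m ms IH] p sp; rewrite -[act (m :: ms) p]/(act ms (act1 m p)) IH; last exact: act1_SL2.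
have [d1 d2] := sp; have [e1 e2] := act1_SL2 m sp; rewrite !tr_commutator //.
case: m {e1 e2} => /=; [rewrite (trC p.2)|rewrite tr_inv // tr_mul_inv //|rewrite mulrA tr_sqr_mul //]; ring.
Qed.

Lemma act_twists n p : act (nseq n Twist) p = (p.1, p.1 ^+ n * p.2).
Proof.
elim: n p => [|n IH] p; first by rewrite expr0 mul1r -surjective_pairing.
by rewrite -[act _ _]/(act (nseq n Twist) (act1 Twist p)) IH /= mulrA -exprSr.
Qed.

Lemma act_power n p : (act (nseq n Twist ++ [:: Swap]) p).1 = p.1 ^+ n * p.2.
Proof. by rewrite act_cat act_twists. Qed.

Lemma tr_power_rec n U V : \det U = 1 -> \tr (U ^+ n.+2 * V) = \tr U * \tr (U ^+ n.+1 * V) - \tr (U ^+ n * V).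
Proof. by move=> dU; rewrite !exprS -!mulrA [U * (U * _)]mulrA tr_sqr_mul. Qed.
End Markov.

Section Descent.
Context {R : realType}.

Lemma smaller_trace (p : 'M[R[i]]_2 * 'M[R[i]]_2) : SL2pair p ->
  \tr (p.1 * p.2 * p.1^-1 * p.2^-1) = - 2 -> ~ (- 2 <= \tr p.1 <= 2) -> modulus (\tr p.1) < 1 / 2 ->
  exists ms, modulus (\tr (act ms p).1) < modulus (\tr p.1).
Proof.
move=> [d1 d2] cm nx xs.
have [|||n [h|h]] := @markov_descent R (\tr p.1) (fun n => \tr (p.1 ^+ n * p.2)) (fun n => \tr (p.1 ^+ n * p.2^-1)) nx xs
  (fun n => tr_power_rec n p.2 d1) (fun n => tr_power_rec n p.2^-1 d1).
- by rewrite !expr0 !mul1r tr_inv.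
- by rewrite !expr1 expr0 mul1r tr_mul_inv.
- rewrite expr0 mul1r expr1; move: cm; rewrite tr_commutator // => /(congr1 (fun u => u + 2)).
  rewrite addNr subrK => /eqP; rewrite subr_eq0 => /eqP <-; ring.
- by exists (nseq n Twist ++ [:: Swap]); rewrite act_power.
- by exists (Invert :: (nseq n Twist ++ [:: Swap])); rewrite -[act _ _]/(act _ (act1 Invert p)) act_power.
Qed.

Lemma finite_min (T : Type) (f : T -> R) (A : set T) : finite_set A -> A !=set0 ->
  exists2 m, A m & forall x, A x -> f m <= f x.
Proof.
move=> fA [a Aa].
have [s hs] : exists s : seq R, f @` A = [set` s] by apply/finite_seqP; exact: finite_image.
have min : forall s : seq R, s != [::] -> exists2 m, m \in s & forall x, x \in s -> m <= x.
  elim=> // x [|y s'] IH _; first by exists x; rewrite ?inE // => z; rewrite inE => /eqP ->.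
  have [//|m ms hm] := IH; case: (leP x m) => xm.
    exists x; first by rewrite inE eqxx.
    by move=> z; rewrite inE => /orP[/eqP ->//|/hm]; exact: le_trans.
  exists m; first by rewrite inE ms orbT.
  by move=> z; rewrite inE => /orP[/eqP ->|/hm//]; exact: ltW.
have fas : f a \in s by have : (f @` A) (f a) by [exists a]; rewrite hs.
have [|m ms hm] := min s; first by case: (s) fas.
have : (f @` A) m by rewrite hs.
by move=> [b Ab fb]; exists b => // x Ax; rewrite fb; apply: hm; have : (f @` A) (f x) by [exists x]; rewrite hs.
Qed.

Lemma modulus_lt_half (z : R[i]) : (`|z| < 1 / 2) = (modulus z < 1 / 2).
Proof.
rewrite modulusE -ltcR; congr (_ < _).
by rewrite rmorphM /= fmorphV rmorph1 rmorph_nat.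
Qed.

Lemma bowditch_trace (rho : type_preserving R) ms :
  (forall X, essential_classes R X -> ~ (- 2 <= curve_trace rho X <= 2)) ->
  finite_set [set X | essential_classes R X /\ `|curve_trace rho X| <= 2] ->
  ~ `|\tr (act ms (XY rho)).1| < 1 / 2.
Proof.
move=> h1 h2 sm.
pose A := [set X | (exists ms, X = unoriented_class (line ms)) /\ `|curve_trace rho X| < 1 / 2].
have fA : finite_set A.
  apply: sub_finite_set h2 => X [[ms' ->] hX]; split; first exact: line_essential.
  by apply: ltW; apply: lt_trans hX _; rewrite ltr_pdivrMr ?ltr0n // -natrM ltr1n.
have [|X [[ms' eX] sX] mX] := finite_min (fun X => modulus (curve_trace rho X)) fA.
  by exists (unoriented_class (line ms)); split; [exists ms|rewrite line_trace].
have nX := h1 X; rewrite eX in nX; have {}nX := nX (line_essential ms').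
move: sX mX; rewrite eX line_trace modulus_lt_half => sX mX; rewrite line_trace in nX.
have sp := act_SL2 ms' (XY_SL2 rho).
have cm := commutator_act ms' (XY_SL2 rho); rewrite commutator_trace in cm.
have [ms2 hlt] := smaller_trace sp cm nX sX.
have := mX (unoriented_class (line (ms' ++ ms2))); rewrite line_trace act_cat leNgt hlt.
apply/not_implyP; split=> //; split; first by exists (ms' ++ ms2).
by rewrite line_trace act_cat modulus_lt_half; apply: lt_trans hlt sX.
Qed.

Lemma ct_triple_move (T : topologicalType) (f : T -> R[i]^o * R[i]^o * R[i]^o) m :
  continuous f -> continuous (fun t => triple_move m (f t) : R[i]^o * R[i]^o * R[i]^o).
Proof.
move=> cf.
have c1 : continuous (fun t => (f t).1.1) by apply: (ct_fst (f := fun t => (f t).1)); apply: ct_fst.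
have c2 : continuous (fun t => (f t).1.2) by apply: (ct_snd (f := fun t => (f t).1)); apply: ct_fst.
have c3 : continuous (fun t => (f t).2) by apply: ct_snd.
have sub (g h k : T -> R[i]^o) : continuous g -> continuous h -> continuous k ->
    continuous (fun t => g t * h t - k t : R[i]^o).
  by move=> cg ch ck t; apply: cvgB; [apply: cvgM; [exact: cg|exact: ch]|exact: ck].
case: m => /=.
- exact: (ct_pair (ct_pair c2 c1) c3).
- exact: (ct_pair (ct_pair c1 c2) (sub _ _ _ c1 c2 c3)).
- exact: (ct_pair (ct_pair c1 c3) (sub _ _ _ c1 c3 c2)).
Qed.

Lemma ct_triple_moves (T : topologicalType) (f : T -> R[i]^o * R[i]^o * R[i]^o) ms : continuous f ->
  continuous (fun t => foldl (fun x m => triple_move m x) (f t) ms : R[i]^o * R[i]^o * R[i]^o).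
Proof.
elim: ms f => [//|m ms IH] f cf.
exact: (IH (fun t => triple_move m (f t)) (@ct_triple_move T f m cf)).
Qed.

End Descent.

Theorem theorem1p1 (R : realType) (rho : type_preserving R) :
  (exists2 X, essential_classes R X & `|curve_trace rho X| < 1 / 2) ->
  interior (~` bowditch R) (char_class rho).
Proof.
move=> [X eX sX]; have [ms HX] := essential_line eX sX.
pose f (chi : char_variety R) : R[i]^o := (foldl (fun x m => triple_move m x) (char_coords chi) ms).1.1.
have cf : continuous f.
  have cc : continuous (@char_coords R) by exact: initial_continuous.
  have cm := @ct_triple_moves R _ (@char_coords R) ms cc.
  exact: (ct_fst (ct_fst cm)).
have fE (sigma : type_preserving R) : f (char_class sigma) = \tr (act ms (XY sigma)).1.
  have [lX lY] := is_loop_X0Y0 R.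
  have := triple_act ms (XY_SL2 sigma); rewrite /f char_coords_class rep_concat // XYE => <-.
  by [].
have small : `|f (char_class rho)| < 1 / 2 by rewrite fE -HX.
have : nbhs (char_class rho) [set chi | `|f chi| < 1 / 2].
  have nb : nbhs (f (char_class rho)) [set w : R[i]^o | `|w| < 1 / 2].
    apply/nbhs_ballP; exists (1 / 2 - `|f (char_class rho)|); first by rewrite /= subr_gt0.
    move=> w; rewrite /ball /= => hw; have -> : w = f (char_class rho) - (f (char_class rho) - w) by rewrite subKr.
    by apply: le_lt_trans (ler_normB _ _) _; rewrite -ltrBrDl.
  exact: cf nb.
rewrite /interior; apply: filterS => chi hchi [sigma [h1 h2] schi].
by have := @bowditch_trace R sigma ms h1 h2; rewrite -fE schi; apply.
Qed.
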